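(* Let $n\ge 2$, let $\Omega\subset\mathbb R^n$ be a bounded domain with $\partial\Omega\in C^3$, and let $\gamma$ be the inward unit normal to $\partial\Omega$. Suppose $u\in C^2(\overline\Omega)\cap C^3(\Omega)$ is a bounded solution of the boundary value problem $$\operatorname{div}\left(\frac{Du}{\sqrt{1+|Du|^2}}\right)=f(x,u)\quad\text{in }\Omega,\qquad \frac{\partial u}{\partial\gamma}=\psi(x,u)\quad\text{on }\partial\Omega .$$ Assume that $f(x,z)\in C^1(\overline\Omega\times[-M_0,M_0])$ and $\psi(x,z)\in C^3(\overline\Omega\times[-M_0,M_0])$, and that there exist positive constants $M_0,L_1,L_2$ such that $$|u|\le M_0\quad\text{in }\overline\Omega,$$ $$f_z(x,z)\ge 0\quad\text{in }\overline\Omega\times[-M_0,M_0],$$ $$|f(x,z)|+|f_x(x,z)|\le L_1\quad\text{in }\overline\Omega\times[-M_0,M_0],$$ $$|\psi(x,z)|_{C^3(\overline\Omega\times[-M_0,M_0])}\le L_2 .$$ Then there exists a small positive constant $\mu_0$ such that $$\sup_{\overline\Omega_{\mu_0}}|Du|\le\max\{M_1,M_2\},$$ where $M_1$ is a positive constant depending only on $n,\mu_0,M_0,L_1$ (coming from the interior gradient estimates), and $M_2$ is a positive constant depending only on $n,\Omega,\mu_0,M_0,L_1,L_2$.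
   Context: Notation: $d(x)=\operatorname{dist}(x,\partial\Omega)$ and, for $\mu>0$, $\Omega_\mu=\{x\in\Omega: d(x)<\mu\}$. $Du$ is the gradient of $u$; $f_x$ denotes the gradient of $f(x,z)$ in the variable $x\in\overline\Omega$ and $f_z$ the derivative in the variable $z\in[-M_0,M_0]$. $|\cdot|_{C^3(\overline\Omega\times[-M_0,M_0])}$ is the $C^3$ norm in both variables $(x,z)$. The interior gradient estimate referred to is the following known fact: if $u\in C^3(\Omega)$ solves $\operatorname{div}(Du/\sqrt{1+|Du|^2})=f(x,u)$ in $\Omega$ with $|u|\le M_0$, where $f\in C^1(\overline\Omega\times[-M_0,M_0])$ satisfies $f_z\ge0$ and $|f|+|f_x|\le L_1$, then for every subdomain $\Omega'\subset\subset\Omega$ one has $\sup_{\Omega'}|Du|\le M_1$ with a positive constant $M_1$ depending only on $n$, $M_0$, $\operatorname{dist}(\Omega',\partial\Omega)$, $L_1$. *)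

(* Defs.v *)
From HB Require Import structures.
From mathcomp Require Import all_boot all_order all_algebra.
From mathcomp Require Import all_classical all_reals all_analysis.

Set Implicit Arguments.
Unset Strict Implicit.
Unset Printing Implicit Defensive.

Import Order.TTheory GRing.Theory Num.Theory.
Import numFieldNormedType.Exports.

Local Open Scope classical_set_scope.
Local Open Scope ring_scope.

Section Euclidean.
Variables (R : realType) (n : nat).
Implicit Types (x y v : 'rV[R]_n) (A B : set 'rV[R]_n).

Definition dotp x y : R := \sum_(i < n) x 0 i * y 0 i.

(* The library norm `|x| on row vectors is the sup norm. It induces the same
   topology and the same bounded sets, but lengths and distances have to be
   measured with the Euclidean norm. *)
Definition enorm x : R := Num.sqrt (dotp x x).

Definition boundary A := closure A `\` interior A.

Definition dist A B : R :=
  inf [set enorm (p.1 - p.2) | p in [set p | A p.1 /\ B p.2]].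

Definition bdist A x : R := dist [set x] (boundary A).

Definition collar A (mu : R) := [set x | A x /\ bdist A x < mu].

Definition domain A := [/\ A !=set0, open A & connected A].

Definition compactly_inside A B := compact (closure A) /\ closure A `<=` B.

End Euclidean.

Section Calculus.
Variables (R : realType) (n : nat).
Implicit Types (u : 'rV[R]_n -> R) (A : set 'rV[R]_n) (s : seq 'I_n).

Definition partial (i : 'I_n) u : 'rV[R]_n -> R := 'D_(delta_mx 0 i) u.

Definition partials s u : 'rV[R]_n -> R := foldr partial u s.

Definition grad u (x : 'rV[R]_n) : 'rV[R]_n := \row_i partial i u x.

Definition divergence (F : 'rV[R]_n -> 'rV[R]_n) (x : 'rV[R]_n) : R :=
  \sum_(i < n) partial i (fun y => F y 0 i) x.

Definition mean_curvature_op u : 'rV[R]_n -> R :=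
  divergence (fun x => (Num.sqrt (1 + enorm (grad u x) ^+ 2))^-1 *: grad u x).

(* C^k(A) for open A *)
Definition Ck (k : nat) A u :=
  (forall s, (size s < k)%N ->
     forall x, A x -> forall i, derivable (partials s u) x (delta_mx 0 i)) /\
  (forall s, (size s <= k)%N ->
     forall x, A x -> {for x, continuous (partials s u)}).

(* C^k(closure A) for open A: the derivatives of order at most k, which are
   only defined inside A, extend continuously to the closure. The values of u
   itself on the boundary must agree with its extension. *)
Definition Ckc (k : nat) A u :=
  [/\ Ck k A u,
      {within closure A, continuous u} &
      forall s, (size s <= k)%N -> exists g : 'rV[R]_n -> R,
        {within closure A, continuous g} /\ {in A, g =1 partials s u}].

(* Value at x, in the closure of A, of the continuous extension of g from A *)
Definition ext A (g : 'rV[R]_n -> R) (x : 'rV[R]_n) : R :=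
  lim (g @ within A (nbhs x)).

(* Gradient up to the boundary *)
Definition gradc A u (x : 'rV[R]_n) : 'rV[R]_n :=
  \row_i ext A (partial i u) x.

(* The C^k norm on the closure of A: the sum over j <= k of the supremum of
   all derivatives of order j *)
Definition Ck_norm (k : nat) A u : \bar R :=
  (\sum_(j < k.+1) ereal_sup
    [set (`|ext A (partials p.1 u) p.2|)%:E
      | p in [set p : j.-tuple 'I_n * 'rV[R]_n | closure A p.2]])%E.

(* rho is a C^k defining function of A in the open set V, positive on the A
   side *)
Definition local_defining (k : nat) A (V : set 'rV[R]_n)
    (rho : 'rV[R]_n -> R) :=
  [/\ open V, Ck k V rho,
      forall y, V y -> grad rho y != 0,
      V `&` A = V `&` [set y | 0 < rho y] &
      V `&` boundary A = V `&` [set y | rho y = 0]].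

Definition Ck_boundary (k : nat) A :=
  forall x, boundary A x -> exists V rho, V x /\ local_defining k A V rho.

Definition inward_unit_normal A (x nu : 'rV[R]_n) :=
  exists V rho, [/\ V x, local_defining 1 A V rho &
    nu = (enorm (grad rho x))^-1 *: grad rho x].

End Calculus.

Section Cylinder.
Variables (R : realType) (n : nat).
Implicit Types (O : set 'rV[R]_n) (f : 'rV[R]_n -> R -> R).

(* Pairs (x, z) are coded as row vectors of length n + 1, with z last. *)
Definition pt (x : 'rV[R]_n) (z : R) : 'rV[R]_(n + 1) := row_mx x z%:M.

Definition joint f (p : 'rV[R]_(n + 1)) : R := f (lsubmx p) (rsubmx p 0 0).

(* The open cylinder O x ]-M0, M0[; for 0 < M0 its closure is
   (closure O) x [-M0, M0]. *)
Definition cyl O (M0 : R) : set 'rV[R]_(n + 1) :=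
  [set p | O (lsubmx p) /\ - M0 < rsubmx p 0 0 < M0].

Definition f_x O M0 f (x : 'rV[R]_n) (z : R) : 'rV[R]_n :=
  \row_i ext (cyl O M0) (partial (lshift 1 i) (joint f)) (pt x z).

Definition f_z O M0 f (x : 'rV[R]_n) (z : R) : R :=
  ext (cyl O M0) (partial (rshift n ord0) (joint f)) (pt x z).

Definition f_conditions O (M0 L1 : R) f :=
  [/\ Ckc 1 (cyl O M0) (joint f),
      forall x z, closure O x -> - M0 <= z <= M0 -> 0 <= f_z O M0 f x z &
      forall x z, closure O x -> - M0 <= z <= M0 ->
        `|f x z| + enorm (f_x O M0 f x z) <= L1].

Definition psi_conditions O (M0 L2 : R) (psi : 'rV[R]_n -> R -> R) :=
  Ckc 3 (cyl O M0) (joint psi) /\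
  (Ck_norm 3 (cyl O M0) (joint psi) <= L2%:E)%E.

End Cylinder.

(* M1 n delta M0 L1 is a constant for the interior gradient estimate: it bounds
   |Du| on every subdomain O' at distance delta from the boundary, for every
   solution u in any bounded domain O. *)
Definition interior_gradient_bound (R : realType)
    (M1 : nat -> R -> R -> R -> R) :=
  forall (n : nat) (O O' : set 'rV[R]_n) (M0 L1 : R)
    (f : 'rV[R]_n -> R -> R) (u : 'rV[R]_n -> R),
  (2 <= n)%N -> domain O -> bounded_set O -> 0 < M0 -> 0 < L1 ->
  f_conditions O M0 L1 f ->
  Ck 3 O u ->
  (forall x, O x -> `|u x| <= M0) ->
  (forall x, O x -> mean_curvature_op u x = f x (u x)) ->
  domain O' -> compactly_inside O' O ->
  (ereal_sup [set (enorm (grad u x))%:E | x in O']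
     <= (M1 n (dist O' (boundary O)) M0 L1)%:E)%E.

(* Main.v *)
Require Import Defs.
From mathcomp Require Import all_boot all_order all_algebra.
From mathcomp Require Import all_classical all_reals all_analysis.
From mathcomp Require Import ring lra.

(* The proof is a Bernstein argument. At a point of the graph of [u] with p = Du
   and q = 1 + |p|^2, let L be the linearized operator
   (delta_ij - p_i p_j / q) D_ij minus the drift f(x, u) nu . D, nu = p / sqrt(q).
   Differentiating the equation gives L(log q / 2) >= - C, because f_z >= 0.
   In the interior this is played against a cut-off function, exponential in u
   and in the squared distance to the point. Near the boundary one maximizes
       log(q - 2 psi(x, u) p . g) / 2 + alpha sigma + Lambda exp(K (u - psi(x, u) sigma)),
   where g extends the inward normal gamma, sigma = 0 and D sigma = gamma on the
   boundary. Differentiating the boundary condition along the tangential part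
   of p shows that the normal derivative of the first term is bounded below
   there; that of the last one vanishes, so a large alpha excludes a boundary
   maximum. At an interior point with q large |nu| is close to 1, hence the
   gradient of u - psi sigma in the metric of L is bounded below, and large K
   and Lambda exclude a maximum. What remains is the interior estimate at distance mu0.

   Neither the distance function nor third derivatives of u at the boundary are
   used: all derivatives at a point are expansions, along lines at interior
   points and within the closed domain at boundary points. The frame [xi_k] in
   which L is computed is the square root of its coefficient matrix. *)

Set Implicit Arguments.
Unset Strict Implicit.
Unset Printing Implicit Defensive.

Import Order.TTheory GRing.Theory Num.Theory.
Import numFieldNormedType.Exports.

Local Open Scope classical_set_scope.
Local Open Scope ring_scope.

(** * Little-o calculus and second-order expansions in one variable *)

(** The correction 2 psi p . g is dictated by the boundary. There p . gamma = psi, so p' = p - psi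
    gamma is tangential, and half the normal derivative of q - 2 psi p . g is D^2u(p', gamma) up to
    terms of order q. The second normal derivative of u, for which no bound is available, has
    dropped out, and the mixed term is read off from the tangential derivative of the boundary
    condition. Inside, the drift removes the undifferentiated f from the equations for the D_m u and
    keeps L u bounded, while the logarithm cancels the square of the gradient of q; a positive
    square of second derivatives survives and absorbs the errors of the correction.

    The constant alpha is fixed before K and Lambda, which have to beat alpha L sigma; this is
    possible because the exponential term has zero normal derivative whatever K and Lambda are.

    Everything happens where the slope is large. There |u| < M0: where |u| = M0, u is extremal, so
    its gradient vanishes inside and is purely normal, hence bounded, on the boundary. Thus f(x, z)
    and psi(x, z) are differentiated only at values z strictly between -M0 and M0. *)

Section Gauge.
Context {R : realType} {T : Type}.
Implicit Types (F : set_system T) (w r s : T -> R).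

Definition osmall F w r := forall e : R, 0 < e -> \forall y \near F, `|r y| <= e * w y.

Definition obig F w r := exists2 C : R, 0 < C & \forall y \near F, `|r y| <= C * w y.

Lemma osmall_ext F {FF : Filter F} w r s :
  (\forall y \near F, r y = s y) -> osmall F w r -> osmall F w s.
Proof.
by move=> rs rw e e0; near=> y; rewrite -(near rs y) //; near: y; exact: rw.
Unshelve. all: by end_near. Qed.

Lemma obig_ext F {FF : Filter F} w r s :
  (\forall y \near F, r y = s y) -> obig F w r -> obig F w s.
Proof.
move=> rs [C C0 rw]; exists C => //; near=> y; rewrite -(near rs y) //.
by near: y.
Unshelve. all: by end_near. Qed.

Lemma osmall0 F {FF : Filter F} w : (forall y, 0 <= w y) -> osmall F w (fun=> 0).
Proof. by move=> w0 e e0; near=> y; rewrite normr0 mulr_ge0 // ltW. Unshelve. all: by end_near. Qed.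

Lemma osmall_obig F w r : osmall F w r -> obig F w r.
Proof. by move=> rw; exists 1 => //; exact: rw. Qed.

Lemma osmallD F {FF : Filter F} w r s :
  osmall F w r -> osmall F w s -> osmall F w (fun y => r y + s y).
Proof.
move=> rw sw e e0; have e20 : 0 < e / 2 by rewrite divr_gt0.
near=> y; rewrite (le_trans (ler_normD _ _)) // (splitr e) mulrDl lerD //; near: y;
  [exact: rw|exact: sw].
Unshelve. all: by end_near. Qed.

Lemma obigD F {FF : Filter F} w r s :
  obig F w r -> obig F w s -> obig F w (fun y => r y + s y).
Proof.
move=> [C C0 rw] [D D0 sw]; exists (C + D); first exact: addr_gt0.
by near=> y; rewrite (le_trans (ler_normD _ _)) // mulrDl lerD //; near: y.
Unshelve. all: by end_near. Qed.

Lemma osmall_sum F {FF : Filter F} w n (r : 'I_n -> T -> R) :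
  (forall y, 0 <= w y) -> (forall i, osmall F w (r i)) ->
  osmall F w (fun y => \sum_i r i y).
Proof.
move=> w0 rw; suff H (s : seq 'I_n) : osmall F w (fun y => \sum_(i <- s) r i y).
  exact: H.
elim: s => [|i s ih].
  by apply: osmall_ext (osmall0 w0); near=> y; rewrite big_nil.
by apply: osmall_ext (osmallD (rw i) ih); near=> y; rewrite big_cons.
Unshelve. all: by end_near. Qed.

Lemma osmallM F {FF : Filter F} w w' r s :
  osmall F w r -> obig F w' s -> osmall F (fun y => w y * w' y) (fun y => r y * s y).
Proof.
move=> rw [C C0 sw] e e0.
have eC : 0 < e / C by rewrite divr_gt0.
near=> y; rewrite normrM.
rewrite (_ : e * _ = (e / C * w y) * (C * w' y)); last by field; rewrite gt_eqF.
by apply: ler_pM => //; near: y; [exact: rw|exact: sw].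
Unshelve. all: by end_near. Qed.

Lemma osmallZ F {FF : Filter F} w (c : R) r :
  osmall F w r -> osmall F w (fun y => c * r y).
Proof.
move=> rw e e0; have c0 : 0 < `|c| + 1 by rewrite ltr_wpDl.
have ec : 0 < e / (`|c| + 1) by rewrite divr_gt0.
near=> y; rewrite normrM.
have H : `|r y| <= e / (`|c| + 1) * w y by near: y; exact: rw.
apply: (@le_trans _ _ ((`|c| + 1) * `|r y|)); first by rewrite mulrDl mul1r lerDl.
apply: (le_trans (ler_wpM2l (ltW c0) H)).
by rewrite mulrA mulrCA divff ?mulr1 // gt_eqF.
Unshelve. all: by end_near. Qed.

Lemma osmallN F {FF : Filter F} w r : osmall F w r -> osmall F w (fun y => - r y).
Proof. by move=> rw e e0; near=> y; rewrite normrN; near: y; exact: rw. Unshelve. all: by end_near. Qed.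

Lemma osmallB F {FF : Filter F} w r s :
  osmall F w r -> osmall F w s -> osmall F w (fun y => r y - s y).
Proof. by move=> rw sw; apply: osmallD => //; exact: osmallN. Qed.

Lemma obig_cst F {FF : Filter F} (c : R) : obig F (fun=> 1) (fun=> c).
Proof.
exists (`|c| + 1); first by rewrite ltr_wpDl.
by near=> y; rewrite mulr1 lerDl.
Unshelve. all: by end_near. Qed.

End Gauge.

Lemma osmall_comp {R : realType} {S T : Type} (F : set_system S) (G : set_system T)
    {FF : Filter F} (w r : T -> R) (w' : S -> R) (h : S -> T) (C : R) :
  0 < C -> h @ F --> G -> (\forall y \near F, w (h y) <= C * w' y) ->
  osmall G w r -> osmall F w' (r \o h).
Proof.
move=> C0 hFG hw rw e e0; have eC : 0 < e / C by rewrite divr_gt0.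
near=> y.
have H : `|r (h y)| <= e / C * w (h y).
  by near: y; apply: (hFG (fun z => `|r z| <= e / C * w z)); exact: rw.
apply: (le_trans H); rewrite -mulrA ler_pM2l // ler_pdivrMl //.
by near: y.
Unshelve. all: by end_near. Qed.

Section J2.
Context {R : realType}.
Implicit Types (p q h : R -> R).

(** The coefficient [a] is half a second derivative. The neighbourhood is not punctured, so
    [p 0 = c] is part of the statement; away from 0 only closeness to the polynomial is asked, and
    no derivative need exist there. *)
Definition J2 p (c b a : R) :=
  osmall (nbhs (0 : R)) (fun t => t ^+ 2) (fun t => p t - (c + b * t + a * t ^+ 2)).

Lemma obig_poly (a b : R) : obig (nbhs (0 : R)) (fun t => `|t|) (fun t => a * t + b * t ^+ 2).
Proof.
exists (`|a| + `|b| + 1); first by rewrite ltr_wpDl // addr_ge0.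
near=> t; have t1 : `|t| <= 1.
  by near: t; apply: (@nbhs0_le _ R).
rewrite (le_trans (ler_normD _ _)) // !normrM.
rewrite !mulrDl mul1r; rewrite -[leLHS]addr0 lerD // lerD //.
by rewrite ler_pM // ler_piMl.
Unshelve. all: by end_near. Qed.

Lemma osmall_t : osmall (nbhs (0 : R)) (fun=> 1) (fun t : R => t).
Proof. by move=> e e0; near=> t; rewrite mulr1; near: t; exact: (@nbhs0_le _ R). Unshelve. all: by end_near. Qed.


Lemma obig_weaken (w w' r : R -> R) C : 0 < C ->
  (\forall t \near (0 : R), w t <= C * w' t) ->
  obig (nbhs (0 : R)) w r -> obig (nbhs (0 : R)) w' r.
Proof.
move=> C0 ww [D D0 rw]; exists (D * C); first exact: mulr_gt0.
near=> t; rewrite -mulrA (@le_trans _ _ (D * w t)) //; first by near: t.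
by rewrite ler_pM2l //; near: t.
Unshelve. all: by end_near. Qed.

Lemma J2_inc p c b a : J2 p c b a -> obig (nbhs (0 : R)) (fun t => `|t|) (fun t => p t - c).
Proof.
move=> /osmall_obig pw; have {}pw : obig (nbhs (0 : R)) (fun t => `|t|)
    (fun t => p t - (c + b * t + a * t ^+ 2)).
  apply: obig_weaken pw; first exact: ltr01.
  near=> t; have t1 : `|t| <= 1 by near: t; apply: (@nbhs0_le _ R).
  by rewrite mul1r -real_normK ?num_real // expr2 ler_piMl.
apply: obig_ext (obigD pw (obig_poly b a)).
by near=> t; ring.
Unshelve. all: by end_near. Qed.

Lemma J2_bnd p c b a : J2 p c b a -> obig (nbhs (0 : R)) (fun=> 1) p.
Proof.
move=> /J2_inc pw; have {}pw : obig (nbhs (0 : R)) (fun=> 1) (fun t => p t - c).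
  apply: obig_weaken pw; first exact: ltr01.
  by near=> t; rewrite mulr1; near: t; apply: (@nbhs0_le _ R).
apply: obig_ext (obigD pw (obig_cst c)).
by near=> t; ring.
Unshelve. all: by end_near. Qed.

Lemma J2_ext p q c b a : (\forall t \near (0 : R), p t = q t) -> J2 p c b a -> J2 q c b a.
Proof. by move=> pq; apply: osmall_ext; near=> t; rewrite (near pq t). Unshelve. all: by end_near. Qed.

Lemma J2_eq p c b a c' b' a' : c = c' -> b = b' -> a = a' -> J2 p c b a -> J2 p c' b' a'.
Proof. by move=> -> -> ->. Qed.

Lemma J2_poly c b a : J2 (fun t => c + b * t + a * t ^+ 2) c b a.
Proof.
apply: osmall_ext (osmall0 (@sqr_ge0 R)).
by near=> t; rewrite subrr.
Unshelve. all: by end_near. Qed.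

Lemma J2_cst c : J2 (fun=> c) c 0 0.
Proof. by apply: J2_ext (J2_poly c 0 0); near=> t; ring. Unshelve. all: by end_near. Qed.

Lemma J2_lin c b : J2 (fun t => c + b * t) c b 0.
Proof. by apply: J2_ext (J2_poly c b 0); near=> t; ring. Unshelve. all: by end_near. Qed.

Lemma J2_D p q c b a c' b' a' : J2 p c b a -> J2 q c' b' a' ->
  J2 (fun t => p t + q t) (c + c') (b + b') (a + a').
Proof.
move=> pw qw; apply: osmall_ext (osmallD pw qw).
by near=> t; ring.
Unshelve. all: by end_near. Qed.

Lemma J2_Z k p c b a : J2 p c b a -> J2 (fun t => k * p t) (k * c) (k * b) (k * a).
Proof.
move=> pw; apply: osmall_ext (osmallZ k pw).
by near=> t; ring.
Unshelve. all: by end_near. Qed.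

Lemma J2_sum n (p : 'I_n -> R -> R) (c b a : 'I_n -> R) :
  (forall i, J2 (p i) (c i) (b i) (a i)) ->
  J2 (fun t => \sum_i p i t) (\sum_i c i) (\sum_i b i) (\sum_i a i).
Proof.
move=> H; suff K (s : seq 'I_n) : J2 (fun t => \sum_(i <- s) p i t)
   (\sum_(i <- s) c i) (\sum_(i <- s) b i) (\sum_(i <- s) a i) by exact: K.
elim: s => [|i s ih].
  rewrite !big_nil; apply: J2_ext (J2_cst 0).
  by near=> t; rewrite big_nil.
rewrite !big_cons; apply: J2_ext (J2_D (H i) ih).
by near=> t; rewrite big_cons.
Unshelve. all: by end_near. Qed.

Lemma osmall_t3 : osmall (nbhs (0 : R)) (fun t => t ^+ 2) (fun t : R => t ^+ 3).
Proof.
have H : obig (nbhs (0 : R)) (fun t : R => t ^+ 2) (fun t : R => t ^+ 2).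
  by exists 1 => //; near=> t; rewrite mul1r ger0_norm // sqr_ge0.
have := osmallM osmall_t H.
move=> K e e0; near=> t; rewrite -[t ^+ 2]mul1r exprS; near: t.
exact: K.
Unshelve. all: by end_near. Qed.

Lemma J2_M p q c b a c' b' a' : J2 p c b a -> J2 q c' b' a' ->
  J2 (fun t => p t * q t) (c * c') (c * b' + c' * b) (c * a' + c' * a + b * b').
Proof.
move=> pw qw.
(* With P and Q the two quadratic polynomials, p q - P Q = (p - P) q + (q - Q) P; [r3] collects the
   terms of degree three and four of P Q. *)
have r1 : osmall (nbhs (0 : R)) (fun t => t ^+ 2)
    (fun t => (p t - (c + b * t + a * t ^+ 2)) * q t).
  have H := osmallM pw (J2_bnd qw).
  by move=> e e0; near=> t; rewrite -[X in e * X]mulr1; near: t; exact: H.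
have r2 : osmall (nbhs (0 : R)) (fun t => t ^+ 2)
    (fun t => (q t - (c' + b' * t + a' * t ^+ 2)) * (c + b * t + a * t ^+ 2)).
  have H := osmallM qw (J2_bnd (J2_poly c b a)).
  by move=> e e0; near=> t; rewrite -[X in e * X]mulr1; near: t; exact: H.
have r3 : osmall (nbhs (0 : R)) (fun t => t ^+ 2)
    (fun t => t ^+ 3 * (b * a' + a * b' + a * a' * t)).
  have H0 : obig (nbhs (0 : R)) (fun=> 1) (fun t => b * a' + a * b' + a * a' * t).
    exact: J2_bnd (J2_lin (b * a' + a * b') (a * a')).
  have H := osmallM osmall_t3 H0.
  by move=> e e0; near=> t; rewrite -[X in e * X]mulr1; near: t; exact: H.
apply: osmall_ext (osmallD (osmallD r1 r2) r3).
by near=> t; ring.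
Unshelve. all: by end_near. Qed.

Lemma J2_cvg p c b a : J2 p c b a -> p @ (0 : R) --> c.
Proof.
move=> /J2_inc [C C0 H]; apply/cvgrPdist_le => e e0.
near=> t; rewrite distrC; apply: (@le_trans _ _ (C * `|t|)); first by near: t.
rewrite -ler_pdivlMl //; near: t; apply: (@nbhs0_le _ R).
by rewrite mulr_gt0 // invr_gt0.
Unshelve. all: by end_near. Qed.

Lemma J2_comp h p c b a (h0 h1 h2 : R) :
  J2 (fun s => h (c + s)) h0 h1 h2 -> J2 p c b a ->
  J2 (fun t => h (p t)) h0 (h1 * b) (h1 * a + h2 * b ^+ 2).
Proof.
move=> hw pw.
have cp : (fun t => p t - c) @ (0 : R) --> (0 : R).
  rewrite -[X in _ --> X](subrr c); apply: cvgB; [exact: J2_cvg pw|exact: cvg_cst].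
have [C C0 pC] := J2_inc pw.
have r1 : osmall (nbhs (0 : R)) (fun t => t ^+ 2) ((fun s => h (c + s) - (h0 + h1 * s + h2 * s ^+ 2)) \o (fun t => p t - c)).
  have C20 : 0 < C ^+ 2 by rewrite exprn_gt0.
  apply: (osmall_comp C20 cp _ hw).
  near=> t; rewrite -real_normK ?num_real // -[t ^+ 2]real_normK ?num_real //.
  rewrite -exprMn lerXn2r ?nnegrE ?mulr_ge0 //; first exact: ltW.
  by near: t.
have sq : J2 (fun t => (p t - c) * (p t - c)) 0 0 (b ^+ 2).
  have K : J2 (fun t => p t - c) 0 b a.
    by apply: J2_eq (J2_D pw (J2_cst (- c))); ring.
  by apply: J2_eq (J2_M K K); ring.
have lin : J2 (fun t => h1 * (p t - c)) 0 (h1 * b) (h1 * a).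
  have K : J2 (fun t => p t - c) 0 b a.
    by apply: J2_eq (J2_D pw (J2_cst (- c))); ring.
  by apply: J2_eq (J2_Z h1 K); ring.
have tot := J2_D (J2_D (J2_cst h0) lin) (J2_Z h2 sq).
apply: osmall_ext (osmallD r1 tot).
near=> t => /=.
by rewrite [c + (_ - c)]addrC subrK; ring.
Unshelve. all: by end_near. Qed.

Lemma J2_at0 p c b a : J2 p c b a -> p 0 = c.
Proof.
move=> H; have /nbhs_singleton /= := H 1 ltr01.
rewrite expr0n /= !mulr0 !addr0 normr_le0 => /eqP/subr0_eq.
by [].
Qed.

Lemma J2_max p c b a : J2 p c b a -> (\forall t \near (0 : R), p t <= p 0) -> b = 0 /\ a <= 0.
Proof.
move=> pw pm; have p0 := J2_at0 pw.
have key e : 0 < e -> \forall t \near (0 : R), b * t + a * t ^+ 2 <= e * t ^+ 2.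
  move=> e0; near=> t.
  have H1 : `|p t - (c + b * t + a * t ^+ 2)| <= e * t ^+ 2 by near: t; exact: pw.
  have H2 : p t <= p 0 by near: t.
  move: H1; rewrite ler_norml => /andP[H1 _]; rewrite p0 in H2.
  by lra.
have b0 : b = 0.
  apply/eqP/negPn/negP => b0.
  have /nbhs_ballP[d /= d0 H] := key 1 ltr01.
  set k := `|a| + 1; have k0 : 0 < k by rewrite ltr_wpDl.
  have ak : `|a| < k by rewrite ltrDl.
  (* For t with the sign of b and size s, [key] with constant 1 would give |b| s <= k s^2, whereas s
     <= |b| / (2 k) gives |b| s >= 2 k s^2. *)
  pose s := Num.min (d / 2) (`|b| / (2 * k)).
  have s0 : 0 < s.
    by rewrite lt_min !divr_gt0 ?mulr_gt0 ?normr_gt0.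
  have sd : s < d by rewrite gt_min; apply/orP; left; lra.
  have sb : s * (2 * k) <= `|b| by rewrite -ler_pdivlMr ?mulr_gt0 // ge_min lexx orbT.
  pose t := Num.sg b * s.
  have tn : `|t| = s by rewrite normrM normr_sg b0 mul1r gtr0_norm.
  have := H t; rewrite /= /ball /= sub0r normrN tn => /(_ sd).
  have -> : b * t = `|b| * s by rewrite mulrA [b * _]mulrC -normrEsg.
  have -> : t ^+ 2 = s ^+ 2 by rewrite exprMn sqr_sg b0 mul1r.
  have aN : - `|a| <= a by rewrite lerNnormlW.
  apply/negP; rewrite -ltNge.
  have H3 : s * s * (2 * k) <= `|b| * s by rewrite -mulrA [_ * s]mulrC ler_pM2l.
  have s20 : 0 < s * s by rewrite mulr_gt0.
  have H4 : - (s * s) * `|a| <= a * (s * s).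
    by rewrite mulNr -mulrN mulrC ler_pM2r.
  rewrite expr2; rewrite /k in H3.
  have H5 : 0 <= s * s * `|a| by rewrite mulr_ge0 // ltW.
  by nra.
split=> //; rewrite leNgt; apply/negP => a0.
have a20 : 0 < a / 2 by rewrite divr_gt0.
have /nbhs_ballP[d /= d0 H] := key _ a20.
have := H (d / 2); rewrite /ball /= sub0r normrN gtr0_norm ?divr_gt0 //.
have dd : d / 2 < d by lra.
move=> /(_ dd); rewrite b0 mul0r add0r; apply/negP; rewrite -ltNge.
have : 0 < (d / 2) ^+ 2 by rewrite exprn_gt0 // divr_gt0.
by nra.
Unshelve. all: by end_near. Qed.

End J2.

(** * The Euclidean norm *)

Section Dotp.
Context {R : realType} {n : nat}.
Implicit Types x y z : 'rV[R]_n.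

Lemma coord_le_norm x i : `|x 0 i| <= `|x|.
Proof.
rewrite [leRHS]/Num.norm /= mx_normrE.
exact: (@le_bigmax _ _ _ _ (fun ij : 'I_1 * 'I_n => `|x ij.1 ij.2|) (0, i)).
Qed.

Lemma norm_le_coord x (c : R) : 0 <= c -> (forall i, `|x 0 i| <= c) -> `|x| <= c.
Proof.
move=> c0 H; rewrite [leLHS]/Num.norm /= mx_normrE.
by apply/bigmax_leP; split=> // -[i j] _; rewrite (ord1 i) /=; exact: H.
Qed.

Lemma dotpC x y : dotp x y = dotp y x.
Proof. by apply: eq_bigr => i _; rewrite mulrC. Qed.

Lemma dotpDl x y z : dotp (x + y) z = dotp x z + dotp y z.
Proof. by rewrite -big_split; apply: eq_bigr => i _; rewrite mxE mulrDl. Qed.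

Lemma dotpDr x y z : dotp z (x + y) = dotp z x + dotp z y.
Proof. by rewrite dotpC dotpDl !(dotpC z). Qed.

Lemma dotpZl k x y : dotp (k *: x) y = k * dotp x y.
Proof. by rewrite /dotp big_distrr; apply: eq_bigr => i _ /=; rewrite mxE mulrA. Qed.

Lemma dotpZr k x y : dotp y (k *: x) = k * dotp y x.
Proof. by rewrite dotpC dotpZl dotpC. Qed.

Lemma dotpNl x y : dotp (- x) y = - dotp x y.
Proof. by rewrite -scaleN1r dotpZl mulN1r. Qed.

Lemma dotpNr x y : dotp y (- x) = - dotp y x.
Proof. by rewrite dotpC dotpNl dotpC. Qed.

Lemma dotpBl x y z : dotp (x - y) z = dotp x z - dotp y z.
Proof. by rewrite dotpDl dotpNl. Qed.

Lemma dotpBr x y z : dotp z (x - y) = dotp z x - dotp z y.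
Proof. by rewrite dotpDr dotpNr. Qed.

Lemma dotp0l x : dotp 0 x = 0.
Proof. by rewrite /dotp big1 // => i _; rewrite mxE mul0r. Qed.

Lemma dotp0r x : dotp x 0 = 0.
Proof. by rewrite dotpC dotp0l. Qed.

Lemma dotp_suml (I : finType) (F : I -> 'rV[R]_n) y :
  dotp (\sum_i F i) y = \sum_i dotp (F i) y.
Proof.
rewrite /dotp exchange_big; apply: eq_bigr => i _ /=.
by rewrite summxE big_distrl.
Qed.

Lemma dotp_sumr (I : finType) (F : I -> 'rV[R]_n) y :
  dotp y (\sum_i F i) = \sum_i dotp y (F i).
Proof. by rewrite dotpC dotp_suml; apply: eq_bigr => i _; rewrite dotpC. Qed.

Lemma dotp_delta x i : dotp x (delta_mx 0 i) = x 0 i.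
Proof.
rewrite /dotp (bigD1 i) //= big1 => [|j ji]; first by rewrite mxE !eqxx mulr1 addr0.
by rewrite mxE (negbTE ji) andbF mulr0.
Qed.

Lemma dotp_ge0 x : 0 <= dotp x x.
Proof. by apply: sumr_ge0 => i _; rewrite -expr2 sqr_ge0. Qed.

Lemma dotp_eq0 x : dotp x x = 0 -> x = 0.
Proof.
move=> H; apply/rowP => i; rewrite mxE.
have := psumr_eq0P _ H => /(_ (fun j _ => _) i isT) K.
have /eqP : x 0 i * x 0 i = 0 by apply: K => j; rewrite -expr2 sqr_ge0.
by rewrite mulf_eq0 orbb => /eqP.
Qed.

Lemma dotp_gt0 x : x != 0 -> 0 < dotp x x.
Proof.
by move=> x0; rewrite lt_def dotp_ge0 andbT; apply: contra x0 => /eqP/dotp_eq0 ->.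
Qed.

Lemma dotp_CS x y : dotp x y ^+ 2 <= dotp x x * dotp y y.
Proof.
have [->|y0] := eqVneq y 0; first by rewrite !dotp0r mulr0 expr0n.
have yy := dotp_gt0 y0.
have := dotp_ge0 (dotp y y *: x - dotp x y *: y).
rewrite !(dotpBl, dotpBr, dotpZl, dotpZr) (dotpC y x) => H.
have {}H : 0 <= dotp y y * (dotp x x * dotp y y - dotp x y ^+ 2).
  by move: H; congr (_ <= _); ring.
by move: H; rewrite pmulr_rge0 // subr_ge0.
Qed.

Lemma enorm_ge0 x : 0 <= enorm x. Proof. exact: sqrtr_ge0. Qed.

Lemma enorm_sqr x : enorm x ^+ 2 = dotp x x.
Proof. by rewrite sqr_sqrtr // dotp_ge0. Qed.

Lemma dotp_le_enorm x y : `|dotp x y| <= enorm x * enorm y.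
Proof.
rewrite -(@ler_pXn2r _ 2) ?nnegrE ?mulr_ge0 ?enorm_ge0 //.
by rewrite exprMn !enorm_sqr real_normK ?num_real // dotp_CS.
Qed.

Lemma enorm_gt0 x : x != 0 -> 0 < enorm x.
Proof. by move=> x0; rewrite sqrtr_gt0 dotp_gt0. Qed.

Lemma enorm0 : enorm (0 : 'rV[R]_n) = 0.
Proof. by rewrite /enorm dotp0l sqrtr0. Qed.

Lemma enormZ k x : enorm (k *: x) = `|k| * enorm x.
Proof. by rewrite /enorm dotpZl dotpZr mulrA -expr2 sqrtrM ?sqr_ge0 // sqrtr_sqr. Qed.

Lemma enormN x : enorm (- x) = enorm x.
Proof. by rewrite -scaleN1r enormZ normrN normr1 mul1r. Qed.

Lemma enormD x y : enorm (x + y) <= enorm x + enorm y.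
Proof.
rewrite -(@ler_pXn2r _ 2) ?nnegrE ?addr_ge0 ?enorm_ge0 //.
rewrite sqrrD !enorm_sqr dotpDl !dotpDr (dotpC y x).
have := le_trans (ler_norm _) (dotp_le_enorm x y).
by rewrite mulr2n; lra.
Qed.

Lemma coord_le_enorm x i : `|x 0 i| <= enorm x.
Proof.
rewrite -(@ler_pXn2r _ 2) ?nnegrE ?enorm_ge0 // real_normK ?num_real // enorm_sqr.
rewrite /dotp (bigD1 i) //= -expr2 lerDl sumr_ge0 // => j _.
by rewrite -expr2 sqr_ge0.
Qed.

Lemma norm_le_enorm x : `|x| <= enorm x.
Proof. by apply: norm_le_coord => [|i]; rewrite ?enorm_ge0 ?coord_le_enorm. Qed.

Lemma enorm_le_norm x : enorm x <= n%:R * `|x|.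
Proof.
rewrite -(@ler_pXn2r _ 2) ?nnegrE ?mulr_ge0 ?enorm_ge0 // enorm_sqr exprMn.
apply: (@le_trans _ _ (n%:R * `|x| ^+ 2)).
  rewrite mulr_natl -[X in _ *+ X](card_ord n) -sumr_const; apply: ler_sum => i _.
  by rewrite -expr2 -real_normK ?num_real // lerXn2r ?nnegrE // coord_le_norm.
rewrite ler_wpM2r ?sqr_ge0 // -natrX ler_nat.
by case: (n) => // m; rewrite expnS expn1 leq_pmulr.
Qed.

Lemma dotp_le_norm x y : `|dotp x y| <= n%:R * `|x| * `|y|.
Proof.
rewrite /dotp (le_trans (ler_norm_sum _ _ _)) //.
rewrite -mulrA mulr_natl -[X in _ *+ X](card_ord n) -sumr_const.
by apply: ler_sum => i _; rewrite normrM ler_pM // coord_le_norm.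
Qed.

End Dotp.

(** * First-order expansions in one variable and the mean value theorem *)

Section J1.
Context {R : realType}.
Implicit Types (p q h : R -> R).

Definition J1 p (c b : R) :=
  osmall (nbhs (0 : R)) (fun t => `|t|) (fun t => p t - (c + b * t)).

Lemma J2_J1 p c b a : J2 p c b a -> J1 p c b.
Proof.
move=> pw; have Ha : osmall (nbhs (0 : R)) (fun t => `|t|) (fun t => a * t ^+ 2).
  have H : obig (nbhs (0 : R)) (fun t => `|t|) (fun t : R => a * t).
    apply: obig_ext (obig_poly a 0).
    by near=> t; rewrite mul0r addr0.
  have K := osmallM (@osmall_t R) H.
  move=> e e0; near=> t.
  have -> : a * t ^+ 2 = t * (a * t) by ring.
  by rewrite -[X in e * X]mul1r; near: t; exact: K.
have H2 : osmall (nbhs (0 : R)) (fun t => `|t|) (fun t => p t - (c + b * t + a * t ^+ 2)).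
  move=> e e0; near=> t; have t1 : `|t| <= 1 by near: t; exact: (@nbhs0_le _ R).
  apply: (@le_trans _ _ (e * t ^+ 2)); first by near: t; exact: pw.
  by rewrite ler_pM2l // -real_normK ?num_real // expr2 ler_piMl.
by apply: osmall_ext (osmallD H2 Ha); near=> t; ring.
Unshelve. all: by end_near. Qed.

Lemma J1_is_derive p (t d : R) : J1 (fun s => p (t + s)) (p t) d -> is_derive t 1 p d.
Proof.
move=> H.
have K : (fun h : R => h^-1 *: ((p \o shift t) (h *: 1) - p t)) @ (0 : R)^' --> d.
  apply/cvgrPdist_le => e e0; near=> h.
  have h0 : h != 0 by near: h; exact: nbhs_dnbhs_neq.
  have : `|p (t + h) - (p t + d * h)| <= e * `|h|.
    by near: h; apply: nbhs_dnbhs; exact: H.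
  rewrite /= /shift /= [h *: 1]mulr1 [h + t]addrC.
  rewrite (_ : p (t + h) - _ = - (h * (d - h^-1 * (p (t + h) - p t)))); last by field.
  by rewrite normrN normrM mulrC ler_pM2r ?normr_gt0.
by apply: DeriveDef; [apply/cvg_ex; exists d|apply: cvg_lim].
Unshelve. all: by end_near. Qed.

Lemma derivable_J1 (V : normedModType R) (f : V -> R) x v :
  derivable f x v -> J1 (fun s => f (s *: v + x)) (f x) ('D_v f x).
Proof.
move=> /derivableP[fd fE] e e0.
have /cvgrPdist_le/(_ e e0) : (fun h : R => h^-1 *: ((f \o shift x) (h *: v) - f x)) @ (0 : R)^' --> 'D_v f x by exact: fd.
move=> H0; have H : \forall t \near (0:R)^', `|f (t *: v + x) - (f x + 'D_v f x * t)| <= e * `|t|.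
  near=> h.
  have h0 : h != 0 by near: h; exact: nbhs_dnbhs_neq.
  have : `|'D_v f x - h^-1 *: ((f \o shift x) (h *: v) - f x)| <= e by near: h; exact: H0.
  rewrite /= /shift /=.
  rewrite (_ : f (h *: v + x) - _ = - (h * ('D_v f x - h^-1 * (f (h *: v + x) - f x)))); last by field.
  by rewrite normrN normrM mulrC => K; rewrite ler_pM2r ?normr_gt0.
move: H; rewrite /dnbhs /within /= => H; near=> t.
have [->|t0] := eqVneq t 0; last by move: t0; near: t.
by rewrite scale0r add0r mulr0 addr0 subrr normr0 mulr0.
Unshelve. all: by end_near. Qed.

(** Expansions are asked for at interior parameters only, and mere continuity at the endpoints, so
    that segments ending on the boundary of a domain are allowed. *)
Lemma J1_MVT p (d : R -> R) : {within `[0, 1], continuous p} ->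
  (forall t : R, 0 < t < 1 -> J1 (fun s => p (t + s)) (p t) (d t)) ->
  exists2 t : R, 0 < t < 1 & p 1 - p 0 = d t.
Proof.
move=> cp H; have D (x : R) : x \in `]0, 1[%R -> is_derive x 1 p (d x).
  by rewrite in_itv /= => x01; apply: J1_is_derive; exact: H.
have [c c01 E] := MVT ltr01 D cp; exists c => //; by rewrite E subr0 mulr1.
Qed.

Lemma J1_cvg p c b : J1 p c b -> p @ (0 : R) --> c.
Proof.
move=> H; apply/cvgrPdist_le => e e0.
have k0 : 0 < `|b| + 1 by rewrite ltr_wpDl.
near=> t.
have H1 : `|p t - (c + b * t)| <= 1 * `|t| by near: t; exact: H.
have H2 : `|t| <= e / (`|b| + 1).
  by near: t; apply: (@nbhs0_le _ R); rewrite divr_gt0.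
rewrite distrC (_ : p t - c = p t - (c + b * t) + b * t); last by ring.
rewrite (le_trans (ler_normD _ _)) // normrM.
by move: H2; rewrite ler_pdivlMr //; lra.
Unshelve. all: by end_near. Qed.

Lemma J1_continuous p (t d : R) : J1 (fun s => p (t + s)) (p t) d -> {for t, continuous p}.
Proof.
move=> /J1_cvg H.
have : (fun s => p (t + s)) \o (fun y => y - t) @ t --> p t.
  apply: cvg_comp H.
  have : (fun y : R => y - t) @ t --> t - t by apply: cvgB; [exact: cvg_id|exact: cvg_cst].
  by rewrite subrr.
by apply: cvg_trans; apply: near_eq_cvg; near=> y => /=; rewrite addrC subrK.
Unshelve. all: by end_near. Qed.

End J1.

(** * First-order expansions within a set *)

Section J1more.
Context {R : realType}.
Implicit Types (p q : R -> R).

Lemma J1_scale p (c b k : R) : J1 p c b -> J1 (fun s => p (k * s)) c (b * k).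
Proof.
move=> H; have k0 : 0 < `|k| + 1 by rewrite ltr_wpDl.
have K : (fun s : R => k * s) @ (0 : R) --> (0 : R).
  have : (fun s : R => k * s) @ (0 : R) --> k * 0 by apply: cvgM; [exact: cvg_cst|exact: cvg_id].
  by rewrite mulr0.
have kw : \forall s \near (0 : R), `|k * s| <= (`|k| + 1) * `|s|.
  by near=> s; rewrite normrM mulrDl lerDl mul1r.
apply: osmall_ext (osmall_comp k0 K kw H).
by near=> s => /=; ring.
Unshelve. all: by end_near. Qed.

Lemma J1_ext p q (c b : R) : (\forall t \near (0 : R), p t = q t) -> J1 p c b -> J1 q c b.
Proof. by move=> pq; apply: osmall_ext; near=> t; rewrite (near pq t). Unshelve. all: by end_near. Qed.

Lemma J1_unique p (c b c' b' : R) : J1 p c b -> J1 p c' b' -> c = c' /\ b = b'.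
Proof.
move=> H H'; have E : c' = c.
  have /(cvg_lim (@norm_hausdorff _ R)) <- := J1_cvg H.
  by apply/esym/(cvg_lim (@norm_hausdorff _ R)); exact: J1_cvg H'.
split=> //; apply/eqP/negPn/negP => bb.
have bb0 : 0 < `|b - b'| by rewrite normr_gt0 subr_eq0.
have e0 : 0 < `|b - b'| / 4 by rewrite divr_gt0.
have [d /= d0 K] : exists2 d : R, 0 < d & forall t, `|t| < d ->
    `|p t - (c + b * t)| <= `|b - b'| / 4 * `|t| /\
    `|p t - (c' + b' * t)| <= `|b - b'| / 4 * `|t|.
  have : \forall t \near (0 : R), `|p t - (c + b * t)| <= `|b - b'| / 4 * `|t| /\
    `|p t - (c' + b' * t)| <= `|b - b'| / 4 * `|t|.
    by near=> t; split; near: t; [exact: H|exact: H'].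
  by move=> /nbhs_norm0P[d /= d0 K]; exists d.
have d2 : 0 < d / 2 by rewrite divr_gt0.
have [] := K (d / 2); first by rewrite gtr0_norm //; lra.
rewrite (gtr0_norm d2) => K1 K2.
have : `|(b - b') * (d / 2)| <= `|b - b'| / 2 * (d / 2).
  rewrite (_ : (b - b') * (d / 2) = (p (d / 2) - (c' + b' * (d / 2))) - (p (d / 2) - (c + b * (d / 2)))); last by rewrite E; ring.
  by rewrite (le_trans (ler_normB _ _)) //; lra.
rewrite normrM (gtr0_norm d2) ler_pM2r //; lra.
Unshelve. all: by end_near. Qed.

End J1more.

Section Jet1.
Context {R : realType} {n : nat}.
Implicit Types (K : set 'rV[R]_n) (f g : 'rV[R]_n -> R) (x v : 'rV[R]_n).

(** With [K] the closure of a domain and [x] on its boundary, this is differentiability up to the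
    boundary. The vector [v] is unique for [K = setT]; for a thin [K] it need not be. *)
Definition jet1 K f x v :=
  osmall (within K (nbhs x)) (fun y => `|y - x|)
    (fun y => f y - (f x + dotp v (y - x))).

Lemma within_norm_le K x (e : R) : 0 < e -> \forall y \near within K (nbhs x), `|y - x| <= e.
Proof.
move=> e0; apply: cvg_within; apply/nbhs_ballP; exists e => //= y.
by rewrite -ball_normE /= distrC => /ltW.
Qed.

Lemma withinP K x (P : set 'rV[R]_n) :
  (\forall y \near within K (nbhs x), P y) <-> (\forall y \near x, K y -> P y).
Proof. by []. Qed.

Lemma jet1_sub K K' f x v : (\forall y \near x, K' y -> K y) -> jet1 K f x v -> jet1 K' f x v.
Proof.
move=> KK H e e0; have /withinP H' := H e e0; apply/withinP.
by near=> y => K'y; have Ky : K y; [move: K'y; near: y|move: Ky; near: y].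
Unshelve. all: by end_near. Qed.

Lemma jet1T K f x v : jet1 setT f x v -> jet1 K f x v.
Proof. by apply: jet1_sub; near=> y. Unshelve. all: by end_near. Qed.

Lemma jet1_ext K f g x v : (\forall y \near within K (nbhs x), f y = g y) -> f x = g x ->
  jet1 K f x v -> jet1 K g x v.
Proof.
by move=> fg fgx; apply: osmall_ext; near=> y; rewrite fgx (near fg y).
Unshelve. all: by end_near. Qed.

Lemma jet1_ext_near f g x v : (\forall y \near x, f y = g y) ->
  jet1 setT f x v -> jet1 setT g x v.
Proof.
move=> fg; apply: jet1_ext; last exact: nbhs_singleton fg.
by apply/withinP; near=> y => _; near: y.
Unshelve. all: by end_near. Qed.

Lemma jet1_eq K f x v v' : v = v' -> jet1 K f x v -> jet1 K f x v'.
Proof. by move=> ->. Qed.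

Lemma osmall_within0 K x : osmall (within K (nbhs x)) (fun y => `|y - x|) (fun=> 0 : R).
Proof. by apply: osmall0. Qed.

Lemma jet1_cst K (c : R) x : jet1 K (fun=> c) x 0.
Proof. by apply: osmall_ext (osmall_within0 K x); near=> y; rewrite dotp0l; ring. Unshelve. all: by end_near. Qed.

Lemma jet1_dotp K v x : jet1 K (fun y => dotp v y) x v.
Proof. by apply: osmall_ext (osmall_within0 K x); near=> y; rewrite dotpBr; ring. Unshelve. all: by end_near. Qed.

Lemma jet1_coord K i x : jet1 K (fun y => y 0 i) x (delta_mx 0 i).
Proof.
apply: jet1_ext (jet1_dotp K (delta_mx 0 i) x); last by rewrite dotpC dotp_delta.
by near=> y; rewrite dotpC dotp_delta.
Unshelve. all: by end_near. Qed.

Lemma jet1_D K f g x v w : jet1 K f x v -> jet1 K g x w ->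
  jet1 K (fun y => f y + g y) x (v + w).
Proof.
move=> H H'; apply: osmall_ext (osmallD H H').
by near=> y; rewrite dotpDl; ring.
Unshelve. all: by end_near. Qed.

Lemma jet1_Z K f x v k : jet1 K f x v -> jet1 K (fun y => k * f y) x (k *: v).
Proof.
move=> H; apply: osmall_ext (osmallZ k H).
by near=> y; rewrite dotpZl; ring.
Unshelve. all: by end_near. Qed.

Lemma jet1_B K f g x v w : jet1 K f x v -> jet1 K g x w ->
  jet1 K (fun y => f y - g y) x (v - w).
Proof.
move=> H H'; apply: osmall_ext (osmallB H H').
by near=> y; rewrite dotpBl; ring.
Unshelve. all: by end_near. Qed.

Lemma jet1_sum K (m : nat) (f : 'I_m -> 'rV[R]_n -> R) x (v : 'I_m -> 'rV[R]_n) :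
  (forall i, jet1 K (f i) x (v i)) -> jet1 K (fun y => \sum_i f i y) x (\sum_i v i).
Proof.
move=> H; suff L (s : seq 'I_m) :
    jet1 K (fun y => \sum_(i <- s) f i y) x (\sum_(i <- s) v i) by exact: L.
elim: s => [|i s ih].
  rewrite big_nil; apply: jet1_ext (jet1_cst K 0 x); last by rewrite big_nil.
  by near=> y; rewrite big_nil.
rewrite big_cons; apply: jet1_ext (jet1_D (H i) ih); last by rewrite big_cons.
by near=> y; rewrite big_cons.
Unshelve. all: by end_near. Qed.

Lemma jet1_inc K f x v : jet1 K f x v ->
  obig (within K (nbhs x)) (fun y => `|y - x|) (fun y => f y - f x).
Proof.
move=> /osmall_obig H.
have H2 : obig (within K (nbhs x)) (fun y => `|y - x|) (fun y => dotp v (y - x)).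
  exists (n%:R * `|v| + 1); first by rewrite ltr_wpDl // mulr_ge0.
  near=> y; rewrite (le_trans (dotp_le_norm _ _)) // ler_wpM2r // lerDl //.
apply: obig_ext (obigD H H2); near=> y; ring.
Unshelve. all: by end_near. Qed.

Lemma jet1_cvg K f x v : jet1 K f x v -> f @ within K (nbhs x) --> f x.
Proof.
move=> /jet1_inc[C C0 H]; apply/cvgrPdist_le => e e0; near=> y.
rewrite distrC; apply: (@le_trans _ _ (C * `|y - x|)); first by near: y.
rewrite -ler_pdivlMl //; near: y; apply: within_norm_le.
by rewrite mulr_gt0 // invr_gt0.
Unshelve. all: by end_near. Qed.

Lemma jet1_M K f g x v w : jet1 K f x v -> jet1 K g x w ->
  jet1 K (fun y => f y * g y) x (f x *: w + g x *: v).
Proof.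
move=> H H'.
have [C C0 Hf] := jet1_inc H; have [D D0 Hg] := jet1_inc H'.
have q : osmall (within K (nbhs x)) (fun y => `|y - x|) (fun y => (f y - f x) * (g y - g x)).
  move=> e e0; near=> y; rewrite normrM.
  have A1 : `|f y - f x| <= C * `|y - x| by near: y.
  have A2 : `|g y - g x| <= D * `|y - x| by near: y.
  have A3 : `|y - x| <= e / (C * D).
    by near: y; apply: within_norm_le; rewrite divr_gt0 // mulr_gt0.
  apply: (le_trans (ler_pM _ _ A1 A2)) => //.
  rewrite mulrACA mulrA ler_wpM2r //.
  by move: A3; rewrite ler_pdivlMr ?mulr_gt0 // mulrC.
apply: osmall_ext (osmallD q (osmallD (osmallZ (g x) H) (osmallZ (f x) H'))).
by near=> y; rewrite dotpDl !dotpZl; ring.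
Unshelve. all: by end_near. Qed.

Lemma jet1_comp K f x v (h : R -> R) (h1 : R) :
  J1 (fun s => h (f x + s)) (h (f x)) h1 -> jet1 K f x v ->
  jet1 K (fun y => h (f y)) x (h1 *: v).
Proof.
move=> hj fj; have [C C0 Hf] := jet1_inc fj.
have cf : (fun y => f y - f x) @ within K (nbhs x) --> (0 : R).
  have : (fun y => f y - f x) @ within K (nbhs x) --> f x - f x.
    by apply: cvgB; [exact: jet1_cvg fj|exact: cvg_cst].
  by rewrite subrr.
have r1 := osmall_comp C0 cf Hf hj.
apply: osmall_ext (osmallD (r1 _) (osmallZ h1 fj)).
by near=> y => /=; rewrite dotpZl [f x + _]addrC subrK; ring.
Unshelve. all: by end_near. Qed.

Lemma jet1_line f x v w : jet1 setT f x v -> J1 (fun s => f (x + s *: w)) (f x) (dotp v w).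
Proof.
move=> H; have k0 : 0 < `|w| + 1 by rewrite ltr_wpDl.
have K : (fun s : R => x + s *: w) @ (0 : R) --> within setT (nbhs x).
  have L : (fun s : R => x + s *: w) @ (0 : R) --> x + 0 *: w.
    by apply: cvgD; [exact: cvg_cst|apply: cvgZr_tmp; exact: cvg_id].
  rewrite scale0r addr0 in L; apply: (cvg_trans L).
  by move=> P /withinP; apply: filterS => y; exact.
have kw : \forall s \near (0 : R), `|x + s *: w - x| <= (`|w| + 1) * `|s|.
  by near=> s; rewrite addrC addKr normrZ mulrDl mulrC lerDl mul1r.
apply: osmall_ext (osmall_comp k0 K kw H).
by near=> s => /=; rewrite addrAC subrr add0r dotpZr; ring.
Unshelve. all: by end_near. Qed.

Lemma jet1_unique f x v w : jet1 setT f x v -> jet1 setT f x w -> v = w.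
Proof.
move=> H H'; apply/rowP => i.
have [_] := J1_unique (jet1_line (delta_mx 0 i) H) (jet1_line (delta_mx 0 i) H').
by rewrite !dotp_delta.
Qed.

Lemma norm_le_sum x : `|x| <= \sum_i `|x 0 i|.
Proof.
apply: norm_le_coord => [|i]; first exact: sumr_ge0.
by rewrite (bigD1 i) //= lerDl sumr_ge0.
Qed.

End Jet1.

Lemma obig_vec {R : realType} {T : Type} (F : set_system T) {FF : Filter F} (n : nat)
    (w : T -> R) (v : T -> 'rV[R]_n) :
  (forall y, 0 <= w y) -> (forall i, obig F w (fun y => v y 0 i)) ->
  exists2 C : R, 0 < C & \forall y \near F, `|v y| <= C * w y.
Proof.
move=> w0 H.
have [C C0 K] : obig F w (fun y => \sum_i `|v y 0 i|).
  suff L (s : seq 'I_n) : obig F w (fun y => \sum_(i <- s) `|v y 0 i|) by exact: L.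
  elim: s => [|i s ih].
    by exists 1 => //; near=> y; rewrite big_nil normr0 mul1r.
  have [D D0 L] := H i.
  have L' : obig F w (fun y => `|v y 0 i|) by exists D => //; near=> y; rewrite normr_id; near: y.
  by apply: obig_ext (obigD L' ih); near=> y; rewrite big_cons.
exists C => //; near=> y; apply: (le_trans (norm_le_sum _)).
by apply: (le_trans (ler_norm _)); near: y.
Unshelve. all: by end_near. Qed.

Section Jet1comp.
Context {R : realType} {n m : nat}.

(** The inner map only has to send [K] into [L]. This allows [psi], expanded within the closed
    cylinder, to be composed with the graph map of [u] at a boundary point. *)
Lemma jet1_mcomp (K : set 'rV[R]_n) (L : set 'rV[R]_m) (F : 'rV[R]_n -> 'rV[R]_m)
    (D : 'I_m -> 'rV[R]_n) (P : 'rV[R]_m -> R) x G :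
  jet1 L P (F x) G -> (forall i, jet1 K (fun y => F y 0 i) x (D i)) ->
  (\forall y \near within K (nbhs x), L (F y)) ->
  jet1 K (fun y => P (F y)) x (\sum_i G 0 i *: D i).
Proof.
move=> PG FD KL.
have [C C0 HF] : exists2 C : R, 0 < C & \forall y \near within K (nbhs x), `|F y - F x| <= C * `|y - x|.
  apply: (@obig_vec R _ _ _ m (fun y => `|y - x|) (fun y => F y - F x)) => // i.
  apply: obig_ext (jet1_inc (FD i)).
  by near=> y; rewrite !mxE.
have cF : F @ within K (nbhs x) --> within L (nbhs (F x)).
  have c1 : F @ within K (nbhs x) --> F x.
    apply/cvgrPdist_le => e e0; near=> y.
    rewrite distrC; apply: (@le_trans _ _ (C * `|y - x|)); first by near: y.
    rewrite -ler_pdivlMl //; near: y; apply: within_norm_le.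
    by rewrite mulr_gt0 // invr_gt0.
  move=> Q LQ.
  have H : \forall y \near within K (nbhs x), L (F y) -> Q (F y) by exact: (c1 _ LQ).
  rewrite -[nbhs _ Q]/(\forall y \near within K (nbhs x), Q (F y)).
  near=> y; suff : L (F y) by near: y; exact: H.
  by near: y.
have r1 := osmall_comp C0 cF HF PG.
have r2 : osmall (within K (nbhs x)) (fun y => `|y - x|)
   (fun y => \sum_i G 0 i * (F y 0 i - (F x 0 i + dotp (D i) (y - x)))).
  by apply: osmall_sum => // i; apply: osmallZ; exact: FD.
apply: osmall_ext (osmallD (r1 _) r2).
near=> y => /=.
rewrite [dotp G _]/dotp dotp_suml.
under [X in _ + X = _]eq_bigr do rewrite mulrBr mulrDr opprD addrA.
rewrite big_split /= sumrN.
under [X in _ - (_ + X)]eq_bigr do rewrite mxE mxE mulrDr mulrN.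
under [X in _ = _ - (_ + X)]eq_bigr do rewrite dotpZl.
ring.
Unshelve. all: by end_near. Qed.

End Jet1comp.

(** * Functions of class C^1 and C^2 *)

Lemma near_ord {T : Type} (F : set_system T) {FF : Filter F} n (P : 'I_n -> T -> Prop) :
  (forall i, \forall y \near F, P i y) -> \forall y \near F, forall i, P i y.
Proof.
move=> H; suff K (s : seq 'I_n) : \forall y \near F, forall i, i \in s -> P i y.
  by apply: filterS (K (enum 'I_n)) => y Hy i; apply: Hy; rewrite mem_enum.
elim: s => [|i s ih]; first by near=> y => i.
near=> y => j; rewrite inE => /predU1P[->|js]; first by near: y; exact: H.
by move: j js; near: y.
Unshelve. all: by end_near. Qed.

Section C1.
Context {R : realType} {n : nat}.
Implicit Types (A K : set 'rV[R]_n) (f : 'rV[R]_n -> R) (x y v g : 'rV[R]_n).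

Lemma within01_continuous (p : R -> R) :
  (forall t, 0 <= t <= 1 -> {for t, continuous p}) -> {within `[0, 1], continuous p}.
Proof.
move=> H; apply/subspace_continuousP => t; rewrite /= in_itv /= => t01.
by apply: cvg_within_filter; exact: H.
Qed.

Lemma open_normP A x : open A -> A x -> exists2 e : R, 0 < e & forall y, `|y - x| < e -> A y.
Proof.
move=> oA Ax; have /nbhs_ballP[e /= e0 H] : nbhs x A by exact: open_nbhs_nbhs.
by exists e => // y yx; apply: H; rewrite -ball_normE /= distrC.
Qed.

Lemma near_normP x (P : set 'rV[R]_n) : (\forall y \near x, P y) <->
  exists2 e : R, 0 < e & forall y, `|y - x| < e -> P y.
Proof.
split.
  move=> /nbhs_ballP[e /= e0 H]; exists e => // y yx.
  by apply: H; rewrite -ball_normE /= distrC.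
move=> [e e0 H]; apply/nbhs_ballP; exists e => // y.
by rewrite -ball_normE /= distrC; exact: H.
Qed.

(** The passage from [x] to [y] changes one coordinate at a time; the mean value theorem on each
    edge turns the increment into a partial derivative at a point near [x], which by continuity is
    close to its value at [x]. *)
Lemma partial_jet1 f x : (\forall y \near x, forall i, derivable f y (delta_mx 0 i)) ->
  (forall i, {for x, continuous (partial i f)}) ->
  jet1 setT f x (\row_i partial i f x).
Proof.
move=> df cf e e0.
have e'0 : 0 < e / (n%:R + 1) by rewrite divr_gt0 // ltr_wpDl.
set e' := e / (n%:R + 1) in e'0 *.
have : \forall y \near x, forall i, `|partial i f y - partial i f x| <= e'.
  apply: (@near_ord _ (nbhs x) _ n (fun i y => `|partial i f y - partial i f x| <= e')) => i; have /cvgrPdist_le/(_ _ e'0) H := cf i.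
  by near=> y; rewrite distrC; near: y.
move=> /(filterI df)/near_normP[d d0 H].
apply/withinP/near_normP; exists d => // y yx _.
pose Z (k : nat) : 'rV[R]_n := \row_j (if (j < k)%N then y 0 j else x 0 j).
have Zd k (t : R) (i : 'I_n) : 0 <= t <= 1 -> k = i ->
    `|Z k + (t * (y 0 i - x 0 i)) *: delta_mx 0 i - x| <= `|y - x|.
  move=> /andP[t0 t1] ->; apply: norm_le_coord => // j; rewrite !mxE eqxx /=.
  have yxj : `|y 0 j - x 0 j| <= `|y - x|.
    by have := coord_le_norm (y - x) j; rewrite !mxE.
  have [->|ji] := eqVneq j i.
    rewrite ltnn mulr1 addrAC subrr add0r normrM ger0_norm //.
    have := coord_le_norm (y - x) i; rewrite !mxE; apply: le_trans.
    by rewrite ler_piMl.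
  by rewrite mulr0 addr0; case: ifP => // _; rewrite subrr normr0.
have step (i : 'I_n) : `|f (Z i.+1) - f (Z i) - partial i f x * (y 0 i - x 0 i)| <= e' * `|y - x|.
  pose c := y 0 i - x 0 i.
  pose p (t : R) := f (Z i + (t * c) *: delta_mx 0 i).
  have pj (t : R) : 0 <= t <= 1 -> J1 (fun s => p (t + s)) (p t)
      (partial i f (Z i + (t * c) *: delta_mx 0 i) * c).
    move=> t01; pose z := Z i + (t * c) *: delta_mx 0 i.
    have /H[dz _] : `|z - x| < d by apply: le_lt_trans yx; exact: Zd.
    have := J1_scale c (derivable_J1 (dz i)).
    apply: J1_ext; near=> s; rewrite /p /z; congr f.
    by rewrite addrCA -scalerDl; congr (_ + _ *: _); ring.
  have cp : {within `[0, 1], continuous p}.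
    by apply: within01_continuous => t t01; apply: J1_continuous (pj t t01).
  have [|t t01 E] := J1_MVT cp (d := fun t => partial i f (Z i + (t * c) *: delta_mx 0 i) * c).
    by move=> t /andP[t0 t1]; apply: pj; rewrite !ltW.
  have p0 : p 0 = f (Z i) by rewrite /p mul0r scale0r addr0.
  have p1 : p 1 = f (Z i.+1).
    rewrite /p mul1r; congr f; apply/rowP => j; rewrite !mxE eqxx /= ltnS.
    have [->|ji] := eqVneq j i; first by rewrite ltnn leqnn mulr1 /c addrC subrK.
    have -> : (j <= i)%N = (j < i)%N by rewrite leq_eqVlt -[(j == i :> nat)]/(j == i) (negbTE ji).
    by rewrite mulr0 addr0.
  rewrite -p0 -p1 E -/c -mulrBl normrM.
  have t01' : 0 <= t <= 1 by case/andP: t01 => ? ?; rewrite !ltW.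
  have /H[_ /(_ i) K] : `|Z i + (t * c) *: delta_mx 0 i - x| < d.
    by apply: le_lt_trans yx; exact: Zd.
  apply: ler_pM => //.
  by have := coord_le_norm (y - x) i; rewrite !mxE.
have Z0 : Z 0%N = x by apply/rowP => j; rewrite mxE ltn0.
have Zn : Z n = y by apply/rowP => j; rewrite mxE ltn_ord.
have -> : f y - (f x + dotp (\row_i partial i f x) (y - x)) =
    \sum_(i < n) (f (Z i.+1) - f (Z i) - partial i f x * (y 0 i - x 0 i)).
  rewrite big_split /= sumrN; have -> : \sum_(i < n) (f (Z i.+1) - f (Z i)) = f y - f x.
    rewrite -(big_mkord xpredT (fun k => f (Z k.+1) - f (Z k))).
    by rewrite (telescope_sumr (fun k => f (Z k))) // Zn Z0.
  rewrite opprD addrA; congr (_ - _).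
  by apply: eq_bigr => i _; rewrite !mxE.
rewrite (le_trans (ler_norm_sum _ _ _)) //.
apply: (@le_trans _ _ (\sum_(i < n) e' * `|y - x|)); first exact: ler_sum.
rewrite sumr_const card_ord -mulr_natl mulrA ler_wpM2r // /e'.
rewrite mulrA ler_pdivrMr ?ltr_wpDl // mulrDr mulr1 mulrC lerDl ltW //.
Unshelve. all: by end_near. Qed.

Lemma Ck_jet1 k A f s x : Ck k A f -> open A -> A x -> (size s < k)%N ->
  jet1 setT (partials s f) x (\row_i partials (i :: s) f x).
Proof.
move=> [df cf] oA Ax sk; apply: partial_jet1.
  have := open_nbhs_nbhs (conj oA Ax); apply: filterS => y Ay i.
  exact: df.
by move=> i; apply: (cf (i :: s)).
Qed.

Lemma segment_bound A f (G : 'rV[R]_n -> 'rV[R]_n) x y g (e : R) :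
  (forall z, A z -> jet1 setT f z (G z)) ->
  (forall t, 0 < t < 1 -> A (x + t *: (y - x))) ->
  {within `[0, 1], continuous (fun t => f (x + t *: (y - x)))} ->
  (forall t, 0 < t < 1 -> `|G (x + t *: (y - x)) - g| <= e) ->
  `|f y - f x - dotp g (y - x)| <= n%:R * e * `|y - x|.
Proof.
move=> fG Axy cf Ge; pose p t := f (x + t *: (y - x)).
have [|t t01] := @J1_MVT R p (fun t => dotp (G (x + t *: (y - x))) (y - x)) cf.
  move=> t t01; have := jet1_line (y - x) (fG _ (Axy _ t01)).
  by apply: J1_ext; near=> s; rewrite /p -addrA -scalerDl.
rewrite {1 2}/p scale1r scale0r addr0 [x + _]addrC subrK => ->.
rewrite -dotpBl (le_trans (dotp_le_norm _ _)) // ler_wpM2r // ler_wpM2l //.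
exact: Ge.
Unshelve. all: by end_near. Qed.

(* The interior cone condition at [x], in a form that passes to products with
   open intervals and that, for [v = 0], holds at interior points. *)
Definition cone A x v := exists c r : R, [/\ 0 < c, 0 < r &
  forall y s z, closure A y -> `|y - x| < r -> 0 < s < r -> `|z| <= c * s ->
    A (y + s *: v + z)].

(** The segment from [x] to [y] may leave [A]. It is replaced by three legs: from [x] to x + s v,
    across to y + s v, and back to [y]. With s = |y - x| / c the cone condition keeps the middle leg
    in [A], and every leg has length comparable to |y - x|, so the mean value theorem on each of
    them leaves an error o(|y - x|). *)
Lemma cone_jet1 A f (G : 'rV[R]_n -> 'rV[R]_n) x v g :
  closure A x -> cone A x v ->
  (forall z, A z -> jet1 setT f z (G z)) ->
  {within closure A, continuous f} ->
  G @ within A (nbhs x) --> g ->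
  jet1 (closure A) f x g.
Proof.
move=> Ax [c [r [c0 r0 H]]] fG /subspace_continuousP cf Gg e e0.
(* The three legs have total length k |y - x|. *)
pose k := 2 * `|v| / c + 1.
have k1 : 1 <= k by rewrite lerDr divr_ge0 ?mulr_ge0 // ltW.
have k0 : 0 < k by apply: lt_le_trans k1.
have e'0 : 0 < e / ((n%:R + 1) * k) by rewrite divr_gt0 // mulr_gt0 // ltr_wpDl.
set e' := e / _ in e'0.
have [d d0 Hd] : exists2 d : R, 0 < d & forall y, `|y - x| < d -> A y -> `|G y - g| <= e'.
  apply/near_normP; apply/withinP; have /cvgrPdist_le/(_ _ e'0) L := Gg.
  by near=> y; rewrite distrC; near: y.
pose d' := Num.min (Num.min r (r * c)) (d / (1 + `|v| / c)).
have vc0 : 0 < 1 + `|v| / c by rewrite ltr_pwDl // divr_ge0 // ltW.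
have d'0 : 0 < d' by rewrite !lt_min r0 mulr_gt0 //= divr_gt0.
apply/withinP/near_normP; exists d' => // y yx Ay.
have [->|yx0] := eqVneq y x; first by rewrite !subrr dotp0r normr0 addr0 subrr normr0 mulr0.
have yn0 : 0 < `|y - x| by rewrite normr_gt0 subr_eq0.
pose s := `|y - x| / c.
have s0 : 0 < s by rewrite divr_gt0.
have sr : s < r by rewrite ltr_pdivrMr // (lt_le_trans yx) // !ge_min lexx orbT.
have yr : `|y - x| < r by rewrite (lt_le_trans yx) // !ge_min lexx.
have yd : `|y - x| + s * `|v| < d.
  have : `|y - x| < d / (1 + `|v| / c) by rewrite (lt_le_trans yx) // !ge_min lexx orbT.
  by rewrite ltr_pdivlMr // mulrDr mulr1 mulrA /s mulrAC.
have near_x w (t : R) : `|w - x| <= `|y - x| -> 0 <= t <= s -> `|w + t *: v - x| < d.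
  move=> wx /andP[t0 ts]; rewrite addrAC; apply: le_lt_trans yd.
  by rewrite (le_trans (ler_normD _ _)) // lerD // normrZ ger0_norm // ler_wpM2r.
have cont a b : (forall t : R, 0 <= t <= 1 -> closure A (a + t *: (b - a))) ->
    {within `[0, 1], continuous (fun t : R => f (a + t *: (b - a)))}.
  move=> Aab; apply/subspace_continuousP => t; rewrite /= in_itv /= => t01.
  apply: (cvg_comp _ _ _ (cf _ (Aab _ t01))).
  have L : (fun t : R => a + t *: (b - a)) @ t --> a + t *: (b - a).
    by apply: cvgD; [exact: cvg_cst|apply: cvgZr_tmp; exact: cvg_id].
  move=> P PP; have := L _ PP; rewrite /= => L'.
  have {}L' : \forall u \near t, closure A (a + u *: (b - a)) -> P (a + u *: (b - a)) by exact: L'.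
  suff : \forall u \near within `[0, 1] (nbhs t), P (a + u *: (b - a)) by [].
  rewrite near_withinE; near=> u => /=; rewrite in_itv /= => u01.
  by have := Aab _ u01; near: u.
have leg w : closure A w -> `|w - x| <= `|y - x| ->
    `|f (w + s *: v) - f w - dotp g (s *: v)| <= n%:R * e' * `|s *: v|.
  move=> Aw wx.
  have Aws t : 0 < t < 1 -> A (w + t *: (w + s *: v - w)).
    move=> /andP[t0 t1]; rewrite [w + s *: v]addrC addrK scalerA.
    have := H w (t * s) 0 Aw; rewrite addr0 normr0; apply.
    - exact: le_lt_trans yr.
    - by rewrite mulr_gt0 //= (le_lt_trans _ sr) // ler_piMl // ltW.
    - by rewrite ltW // mulr_gt0 // mulr_gt0.
  have := @segment_bound A f G w (w + s *: v) g e' fG Aws.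
  rewrite [X in `|X - _|]addrC [w + s *: v - w]addrAC subrr add0r addrC; apply.
    have -> : (fun t : R => f (w + t *: (s *: v))) = (fun t : R => f (w + t *: (w + s *: v - w))).
      by apply/funext => t; rewrite [w + s *: v - w]addrAC subrr add0r.
    apply: cont => t /andP[t0 t1].
    move: t0; rewrite le_eqVlt => /predU1P[<-|t0]; first by rewrite scale0r addr0.
    rewrite [w + s *: v - w]addrAC subrr add0r scalerA.
    apply: subset_closure; have := H w (t * s) 0 Aw; rewrite addr0 normr0; apply.
    - exact: le_lt_trans yr.
    - by rewrite mulr_gt0 //= (le_lt_trans _ sr) // ler_piMl // ltW.
    - by rewrite ltW // mulr_gt0 // mulr_gt0.
  move=> t t01; have := Aws _ t01; rewrite [w + s *: v - w]addrAC subrr add0r => At.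
  apply: Hd => //; rewrite scalerA; apply: near_x => //.
  by case/andP: t01 => t0 t1; rewrite mulr_ge0 ?(ltW t0) ?(ltW s0) //= ler_piMl ?(ltW t1) ?(ltW s0).
have mid : `|f (y + s *: v) - f (x + s *: v) - dotp g (y - x)| <= n%:R * e' * `|y - x|.
  have Ams t : 0 <= t <= 1 -> A (x + s *: v + t *: (y + s *: v - (x + s *: v))).
    move=> /andP[t0 t1]; apply: H; rewrite ?subrr ?normr0 ?s0 //.
    have -> : c * s = `|y - x| by rewrite mulrC divfK // gt_eqF.
    by rewrite opprD addrACA subrr addr0 normrZ ger0_norm // ler_piMl.
  have E : y + s *: v - (x + s *: v) = y - x by rewrite opprD addrACA subrr addr0.
  have := @segment_bound A f G (x + s *: v) (y + s *: v) g e' fG.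
  rewrite E; apply.
  - by move=> t /andP[t0 t1]; rewrite -E; apply: Ams; rewrite !ltW.
  - by rewrite -E; apply: cont => t t01; apply: subset_closure; exact: Ams.
  - move=> t /andP[t0 t1]; apply: Hd; last by rewrite -E; apply: Ams; rewrite !ltW.
    rewrite [x + s *: v + _]addrAC; apply: near_x; last by rewrite lexx ltW.
    by rewrite addrAC subrr add0r normrZ gtr0_norm // ler_piMl // ltW.
have L1 := leg x Ax _; have L2 := leg y Ay (lexx _).
have {}L1 : `|f (x + s *: v) - f x - dotp g (s *: v)| <= n%:R * e' * `|s *: v|.
  by apply: L1; rewrite subrr normr0.
have -> : f y - (f x + dotp g (y - x)) = (f (x + s *: v) - f x - dotp g (s *: v))
  + (f (y + s *: v) - f (x + s *: v) - dotp g (y - x))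
  - (f (y + s *: v) - f y - dotp g (s *: v)) by ring.
rewrite (le_trans (ler_normB _ _)) // (le_trans (lerD (ler_normD _ _) (lexx _))) //.
apply: (le_trans (lerD (lerD L1 mid) L2)).
have -> : n%:R * e' * `|s *: v| + n%:R * e' * `|y - x| + n%:R * e' * `|s *: v|
   = n%:R * e' * k * `|y - x|.
  rewrite normrZ gtr0_norm // /s /k; field; rewrite gt_eqF //.
rewrite ler_wpM2r // /e'.
rewrite -mulrA -[in leLHS]mulrA invfM mulrCA -!mulrA [_ * k]mulrC !mulrA.
rewrite -[leLHS]mulrA mulfV ?gt_eqF // mulr1 -mulrA ler_piMr ?ltW //.
by rewrite ltr_pdivrMr ?ltr_wpDl // mul1r ltrDl.
Unshelve. all: by end_near. Qed.

End C1.

(** * Second-order expansions and the symmetry of second derivatives *)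

Section Jet2.
Context {R : realType} {n : nat}.
Implicit Types (f : 'rV[R]_n -> R) (x y v g : 'rV[R]_n) (H : 'M[R]_n).

Definition quad H v : R := \sum_i v 0 i * dotp (row i H) v.

Definition jet2 f x g H :=
  osmall (nbhs x) (fun y => `|y - x| ^+ 2)
    (fun y => f y - (f x + dotp g (y - x) + quad H (y - x) / 2)).

Lemma J1_B (p q : R -> R) (c b c' b' : R) : J1 p c b -> J1 q c' b' ->
  J1 (fun t => p t - q t) (c - c') (b - b').
Proof.
move=> H H'; apply: osmall_ext (osmallB H H').
by near=> t; ring.
Unshelve. all: by end_near. Qed.

Lemma quadZ k H v : quad H (k *: v) = k ^+ 2 * quad H v.
Proof.
by rewrite /quad big_distrr; apply: eq_bigr => i _; rewrite mxE dotpZr /=; ring.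
Qed.

(** The gradient is differentiable at [x] alone. Once the quadratic polynomial is subtracted along
    the segment in direction h = y - x, the mean value theorem leaves the error of the expansion of
    [G], which is o(|h|), paired with h. *)
Lemma peano2 f (G : 'rV[R]_n -> 'rV[R]_n) x H :
  (\forall y \near x, jet1 setT f y (G y)) ->
  (forall i, jet1 setT (fun y => G y 0 i) x (row i H)) ->
  jet2 f x (G x) H.
Proof.
move=> fG GH e e0.
have e'0 : 0 < e / (n%:R + 1) by rewrite divr_gt0 // ltr_wpDl.
set e' := e / (n%:R + 1) in e'0 *.
have : \forall y \near x, forall i,
    `|G y 0 i - (G x 0 i + dotp (row i H) (y - x))| <= e' * `|y - x|.
  apply: (@near_ord _ (nbhs x) _ n (fun i y => `|G y 0 i - (G x 0 i + dotp (row i H) (y - x))| <= e' * `|y - x|)) => i.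
  by have /withinP := GH i e' e'0; apply: filterS => y; apply.
move=> /(filterI fG)/near_normP[d d0 K].
apply/near_normP; exists d => // y yx.
pose h := y - x.
pose a := dotp (G x) h; pose b := quad H h / 2.
pose p (t : R) := f (x + t *: h) - (a * t + b * t ^+ 2).
have hd (t : R) : 0 <= t <= 1 -> `|x + t *: h - x| <= t * `|h|.
  by move=> /andP[t0 t1]; rewrite addrAC subrr add0r normrZ ger0_norm.
have hd' (t : R) : 0 <= t <= 1 -> `|x + t *: h - x| < d.
  move=> t01; apply: le_lt_trans yx; apply: (le_trans (hd t t01)).
  by case/andP: t01 => t0 t1; rewrite ler_piMl.
have pj (t : R) : 0 <= t <= 1 ->
    J1 (fun s => p (t + s)) (p t) (dotp (G (x + t *: h)) h - (a + 2 * b * t)).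
  move=> t01; have [fj _] := K _ (hd' t t01).
  have p1 := jet1_line h fj.
  have p2 := J2_J1 (J2_poly (a * t + b * t ^+ 2) (a + 2 * b * t) b).
  apply: J1_ext (J1_B p1 p2); near=> s.
  by rewrite /p -addrA -scalerDl; ring.
have cp : {within `[0, 1], continuous p}.
  by apply: within01_continuous => t t01; exact: J1_continuous (pj t t01).
have [|t t01 E] := J1_MVT cp (d := fun t => dotp (G (x + t *: h)) h - (a + 2 * b * t)).
  by move=> t /andP[t0 t1]; apply: pj; rewrite !ltW.
have {}E : f y - (f x + a + b) = dotp (G (x + t *: h)) h - (a + 2 * b * t).
  rewrite -E /p scale1r scale0r addr0 /h [x + _]addrC subrK; ring.
rewrite -/h E /a /b.
have t01' : 0 <= t <= 1 by case/andP: t01 => ? ?; rewrite !ltW.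
have [_ Gb] := K _ (hd' t t01').
have -> : dotp (G (x + t *: h)) h - (dotp (G x) h + 2 * (quad H h / 2) * t) =
    dotp (\row_i (G (x + t *: h) 0 i - (G x 0 i + dotp (row i H) (x + t *: h - x)))) h.
  have xt : x + t *: h - x = t *: h by rewrite addrAC subrr add0r.
  rewrite [2 * _]mulrC divfK ?pnatr_eq0 // /quad mulr_suml opprD addrA -dotpBl.
  rewrite [dotp (_ - _) _]/dotp [RHS]/dotp -sumrB; apply: eq_bigr => i _.
  have -> : (G (x + t *: h) - G x) 0 i = G (x + t *: h) 0 i - G x 0 i by rewrite !mxE.
  by rewrite [in RHS]mxE xt dotpZr; ring.
rewrite (le_trans (dotp_le_norm _ _)) //.
have Hb : `|\row_i (G (x + t *: h) 0 i - (G x 0 i + dotp (row i H) (x + t *: h - x)))| <= e' * `|h|.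
  apply: norm_le_coord => [|i]; first by rewrite mulr_ge0 // ltW.
  rewrite mxE (le_trans (Gb i)) // ler_wpM2l ?(ltW e'0) // (le_trans (hd _ t01')) //.
  by case/andP: t01' => t0 t1; rewrite ler_piMl.
apply: (@le_trans _ _ (n%:R * (e' * `|h|) * `|h|)); first by rewrite ler_wpM2r // ler_wpM2l.
rewrite mulrA -mulrA -expr2 ler_wpM2r ?exprn_ge0 // /e' mulrA.
rewrite ler_pdivrMr ?ltr_wpDl // mulrDr mulr1 mulrC lerDl ltW //.
Unshelve. all: by end_near. Qed.

(** Young's form of the theorem, with a gradient differentiable at [x] alone. The second difference
    [D i j t] is symmetric in [i] and [j]; the mean value theorem in direction [i] and the expansion
    of the i-th partial derivative identify it with [t ^+ 2 * H i j] up to o(t^2). *)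
Lemma schwarz f (G : 'rV[R]_n -> 'rV[R]_n) x H i j :
  (\forall y \near x, jet1 setT f y (G y)) ->
  (forall i, jet1 setT (fun y => G y 0 i) x (row i H)) ->
  H i j = H j i.
Proof.
move=> fG GH.
pose D (i j : 'I_n) (t : R) := f (x + t *: delta_mx 0 i + t *: delta_mx 0 j)
  - f (x + t *: delta_mx 0 i) - f (x + t *: delta_mx 0 j) + f x.
have key i' j' (e : R) : 0 < e -> \forall t \near (0 : R),
    0 < t -> `|D i' j' t - t ^+ 2 * H i' j'| <= 3 * e * t ^+ 2.
  move=> e0.
  have /withinP GHe := GH i' e e0.
  have : \forall y \near x, jet1 setT f y (G y) /\
     `|G y 0 i' - (G x 0 i' + dotp (row i' H) (y - x))| <= e * `|y - x|.
    by near=> y; split; near: y => //; apply: filterS GHe => y; apply.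
  move=> /near_normP[d d0 K].
  have d20 : 0 < d / 2 by rewrite divr_gt0.
  near=> t => t0.
  have td : `|t| < d / 2 by near: t; exact: (@nbhs0_lt _ R).
  rewrite gtr0_norm // in td.
  have td1 : 2 * t < d by lra.
  have td2 : t < d by lra.
  pose p (s : R) := f (x + t *: delta_mx 0 j' + s *: (t *: delta_mx 0 i')) - f (x + s *: (t *: delta_mx 0 i')).
  have dn (k : 'I_n) : `|delta_mx 0 k : 'rV[R]_n| <= 1.
    by apply: norm_le_coord => // k'; rewrite mxE; case: (_ && _); rewrite ?normr1 ?normr0.
  have n1 (s : R) : 0 <= s <= 1 -> `|x + t *: delta_mx 0 j' + s *: (t *: delta_mx 0 i') - x| <= 2 * t.
    move=> /andP[s0 s1].
    have -> : x + t *: delta_mx 0 j' + s *: (t *: delta_mx 0 i') - x = t *: delta_mx 0 j' + s *: (t *: delta_mx 0 i').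
      by apply/rowP => k; rewrite !mxE; ring.
    rewrite (le_trans (ler_normD _ _)) // mulr_natl mulr2n lerD //.
      by rewrite normrZ gtr0_norm // ler_piMr // ltW.
    rewrite scalerA normrZ ger0_norm ?mulr_ge0 ?(ltW t0) //.
    by rewrite -[leRHS]mulr1 ler_pM ?mulr_ge0 ?(ltW t0) // ler_piMl // ltW.
  have n2 (s : R) : 0 <= s <= 1 -> `|x + s *: (t *: delta_mx 0 i') - x| <= t.
    move=> /andP[s0 s1]; rewrite addrAC subrr add0r.
    rewrite scalerA normrZ ger0_norm ?mulr_ge0 ?(ltW t0) //.
    by rewrite -[leRHS]mulr1 ler_pM ?mulr_ge0 ?(ltW t0) // ler_piMl // ltW.
  pose dp (s : R) := t * (G (x + t *: delta_mx 0 j' + s *: (t *: delta_mx 0 i')) 0 i'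
       - G (x + s *: (t *: delta_mx 0 i')) 0 i').
  have pj (s : R) : 0 <= s <= 1 -> J1 (fun r => p (s + r)) (p s) (dp s).
    move=> s01.
    have [J1' _] := K (x + t *: delta_mx 0 j' + s *: (t *: delta_mx 0 i')) (le_lt_trans (n1 s s01) td1).
    have [J2' _] := K (x + s *: (t *: delta_mx 0 i')) (le_lt_trans (n2 s s01) td2).
    have L := J1_B (jet1_line (t *: delta_mx 0 i') J1') (jet1_line (t *: delta_mx 0 i') J2').
    have -> : dp s = dotp (G (x + t *: delta_mx 0 j' + s *: (t *: delta_mx 0 i'))) (t *: delta_mx 0 i') - dotp (G (x + s *: (t *: delta_mx 0 i'))) (t *: delta_mx 0 i').
      by rewrite !dotpZr !dotp_delta -mulrBr.
    apply: J1_ext L; near=> r.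
    by rewrite /p -!addrA -!scalerDl.
  have cp : {within `[0, 1], continuous p}.
    by apply: within01_continuous => s s01; exact: J1_continuous (pj s s01).
  have [|s s01 E] := J1_MVT cp (d := dp).
    by move=> s /andP[s0 s1]; apply: pj; rewrite !ltW.
  have s01' : 0 <= s <= 1 by case/andP: s01 => ? ?; rewrite !ltW.
  have {}E : D i' j' t = dp s.
    rewrite -E /p /D scale1r !scale0r !addr0 [x + t *: _ + _]addrAC; ring.
  have [_ K1] := K (x + t *: delta_mx 0 j' + s *: (t *: delta_mx 0 i')) (le_lt_trans (n1 s s01') td1).
  have [_ K2] := K (x + s *: (t *: delta_mx 0 i')) (le_lt_trans (n2 s s01') td2).
  have E2 : t ^+ 2 * H i' j' = t * (dotp (row i' H) (x + t *: delta_mx 0 j' + s *: (t *: delta_mx 0 i') - x)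
     - dotp (row i' H) (x + s *: (t *: delta_mx 0 i') - x)).
    rewrite -dotpBr.
    have -> : x + t *: delta_mx 0 j' + s *: (t *: delta_mx 0 i') - x - (x + s *: (t *: delta_mx 0 i') - x) = t *: delta_mx 0 j'.
      by apply/rowP => k; rewrite !mxE; ring.
    by rewrite dotpZr dotp_delta mxE; ring.
  rewrite E E2 /dp -mulrBr normrM gtr0_norm //.
  have := le_trans K1 (ler_wpM2l (ltW e0) (n1 s s01')).
  have := le_trans K2 (ler_wpM2l (ltW e0) (n2 s s01')).
  set A0 := G x 0 i'; set A1 := G _ 0 i'; set A2 := G _ 0 i'.
  set B1 := dotp _ _; set B2 := dotp _ _ => L2 L1.
  have -> : A2 - A1 - (B2 - B1) = (A2 - (A0 + B2)) - (A1 - (A0 + B1)) by ring.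
  have : `|(A2 - (A0 + B2)) - (A1 - (A0 + B1))| <= e * (2 * t) + e * t.
    by rewrite (le_trans (ler_normB _ _)) // lerD.
  move=> /(ler_wpM2l (ltW t0)).
  by congr (_ <= _); ring.
apply/eqP/negPn/negP => ne.
have ne0 : 0 < `|H i j - H j i| by rewrite normr_gt0 subr_eq0.
have e0 : 0 < `|H i j - H j i| / 12 by rewrite divr_gt0.
have /nbhs_norm0P[d /= d0 K] : \forall t \near (0 : R),
    (0 < t -> `|D i j t - t ^+ 2 * H i j| <= 3 * (`|H i j - H j i| / 12) * t ^+ 2) /\
    (0 < t -> `|D j i t - t ^+ 2 * H j i| <= 3 * (`|H i j - H j i| / 12) * t ^+ 2).
  by near=> t; split; near: t; exact: key.
have d20 : 0 < d / 2 by rewrite divr_gt0.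
have d2d : `|d / 2| < d by rewrite gtr0_norm //; lra.
have [K1 K2] := K (d / 2) d2d.
have {}K1 := K1 d20; have {}K2 := K2 d20.
have Dsym : D j i (d / 2) = D i j (d / 2).
  by rewrite /D [x + _ + _]addrAC; ring.
rewrite Dsym in K2.
have : `|(d / 2) ^+ 2 * (H i j - H j i)| <= `|H i j - H j i| / 2 * (d / 2) ^+ 2.
  have -> : (d / 2) ^+ 2 * (H i j - H j i) = (D i j (d / 2) - (d / 2) ^+ 2 * H j i) - (D i j (d / 2) - (d / 2) ^+ 2 * H i j) by ring.
  rewrite (le_trans (ler_normB _ _)) // (le_trans (lerD K2 K1)) //.
  by rewrite le_eqVlt; apply/orP; left; apply/eqP; field.
rewrite normrM ger0_norm ?sqr_ge0 // [leRHS]mulrC ler_pM2l ?exprn_gt0 //.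
by lra.
Unshelve. all: by end_near. Qed.

Lemma Ck_open_near k A f s x : Ck k A f -> open A -> A x -> (size s < k)%N ->
  \forall y \near x, jet1 setT (partials s f) y (\row_i partials (i :: s) f y).
Proof.
move=> fC oA Ax sk; have := open_nbhs_nbhs (conj oA Ax).
by apply: filterS => y Ay; exact: Ck_jet1 fC oA Ay sk.
Qed.

Lemma Ck_hess k A f s x i : Ck k A f -> open A -> A x -> ((size s).+1 < k)%N ->
  jet1 setT (fun y => (\row_i partials (i :: s) f y) 0 i) x
    (row i (\matrix_(i, j) partials [:: j, i & s] f x)).
Proof.
move=> fC oA Ax sk.
have := Ck_jet1 fC oA Ax (s := i :: s) sk.
have -> : row i (\matrix_(i, j) partials [:: j, i & s] f x) = \row_j partials [:: j, i & s] f x.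
  by apply/rowP => j; rewrite !mxE.
by apply: jet1_ext_near; near=> y; rewrite mxE.
Unshelve. all: by end_near. Qed.

Lemma Ck_jet2 k A f s x : Ck k A f -> open A -> A x -> ((size s).+1 < k)%N ->
  jet2 (partials s f) x (\row_i partials (i :: s) f x)
     (\matrix_(i, j) partials [:: j, i & s] f x).
Proof.
move=> fC oA Ax sk.
apply: (peano2 (G := fun y => \row_i partials (i :: s) f y)).
  by apply: Ck_open_near fC oA Ax _; exact: ltnW.
by move=> i; exact: Ck_hess fC oA Ax sk.
Qed.

Lemma Ck_sym k A f s x i j : Ck k A f -> open A -> A x -> ((size s).+1 < k)%N ->
  partials [:: i, j & s] f x = partials [:: j, i & s] f x.
Proof.
move=> fC oA Ax sk.
have := @schwarz (partials s f) (fun y => \row_i partials (i :: s) f y) x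
  (\matrix_(i, j) partials [:: j, i & s] f x) j i.
rewrite !mxE; apply.
  by apply: Ck_open_near fC oA Ax _; exact: ltnW.
by move=> l; exact: Ck_hess fC oA Ax sk.
Qed.

Lemma jet2_line f x g H v : jet2 f x g H ->
  J2 (fun t => f (x + t *: v)) (f x) (dotp g v) (quad H v / 2).
Proof.
move=> fj; have k0 : 0 < `|v| ^+ 2 + 1 by rewrite ltr_wpDl // exprn_ge0.
have L : (fun s : R => x + s *: v) @ (0 : R) --> x.
  have : (fun s : R => x + s *: v) @ (0 : R) --> x + 0 *: v.
    by apply: cvgD; [exact: cvg_cst|apply: cvgZr_tmp; exact: cvg_id].
  by rewrite scale0r addr0.
have kw : \forall s \near (0 : R), `|x + s *: v - x| ^+ 2 <= (`|v| ^+ 2 + 1) * s ^+ 2.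
  near=> s; rewrite addrAC subrr add0r normrZ exprMn real_normK ?num_real //.
  by rewrite mulrDl mul1r mulrC lerDl sqr_ge0.
apply: osmall_ext (osmall_comp k0 L kw fj).
near=> s => /=; have -> : x + s *: v - x = s *: v by rewrite addrAC subrr add0r.
by rewrite dotpZr quadZ; ring.
Unshelve. all: by end_near. Qed.

End Jet2.

Lemma J2_mcomp {R : realType} {m : nat} (P : 'rV[R]_m -> R) (F : R -> 'rV[R]_m)
    (y b a g : 'rV[R]_m) (H : 'M[R]_m) :
  jet2 P y g H -> (forall i, J2 (fun t => F t 0 i) (y 0 i) (b 0 i) (a 0 i)) ->
  J2 (fun t => P (F t)) (P y) (dotp g b) (dotp g a + quad H b / 2).
Proof.
move=> PJ FJ.
have [C C0 HF] : exists2 C : R, 0 < C & \forall t \near (0 : R), `|F t - y| <= C * `|t|.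
  apply: (@obig_vec R _ (nbhs (0 : R)) _ m (fun t => `|t|) (fun t => F t - y)) => // i.
  apply: obig_ext (J2_inc (FJ i)).
  by near=> t; rewrite !mxE.
have cF : F @ (0 : R) --> y.
  apply/cvgrPdist_le => e e0; near=> t.
  rewrite distrC; apply: (@le_trans _ _ (C * `|t|)); first by near: t.
  rewrite -ler_pdivlMl //; near: t; apply: (@nbhs0_le _ R).
  by rewrite mulr_gt0 // invr_gt0.
have C20 : 0 < C ^+ 2 by rewrite exprn_gt0.
have HF2 : \forall t \near (0 : R), `|F t - y| ^+ 2 <= C ^+ 2 * t ^+ 2.
  near=> t; rewrite -[t ^+ 2]real_normK ?num_real // -exprMn lerXn2r ?nnegrE ?mulr_ge0 ?(ltW C0) //.
  by near: t.
have r1 := osmall_comp C20 cF HF2 PJ.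
have FJ' i : J2 (fun t => F t 0 i - y 0 i) 0 (b 0 i) (a 0 i).
  by apply: J2_eq (J2_D (FJ i) (J2_cst (- y 0 i))); ring.
have lin : J2 (fun t => dotp g (F t - y)) 0 (dotp g b) (dotp g a).
  apply: (@J2_eq _ _ (\sum_i g 0 i * 0) (\sum_i g 0 i * b 0 i) (\sum_i g 0 i * a 0 i)) => //.
    by rewrite big1 // => i _; rewrite mulr0.
  apply: J2_ext (J2_sum (fun i => J2_Z (g 0 i) (FJ' i))).
  by near=> t; apply: eq_bigr => i _; rewrite !mxE.
have qd : J2 (fun t => quad H (F t - y)) 0 0 (quad H b).
  have Q i j : J2 (fun t => (F t 0 i - y 0 i) * (H i j * (F t 0 j - y 0 j))) 0 0 (b 0 i * (H i j * b 0 j)).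
    by apply: J2_eq (J2_M (FJ' i) (J2_Z (H i j) (FJ' j))); ring.
  have := J2_sum (fun i => J2_sum (Q i)).
  move=> QQ; apply: (@J2_eq _ _ _ _ _ _ _ _ _ _ _ (J2_ext _ QQ)).
  - by rewrite big1 // => i _; rewrite big1.
  - by rewrite big1 // => i _; rewrite big1.
  - by apply: eq_bigr => i _; rewrite -big_distrr; congr (_ * _); apply: eq_bigr => j _; rewrite mxE.
  - near=> t; apply: eq_bigr => i _; rewrite -big_distrr /= !mxE; congr (_ * _).
    by apply: eq_bigr => j _; rewrite !mxE.
have tot := J2_D (J2_D (J2_cst (P y)) lin) (J2_Z 2^-1 qd).
apply: osmall_ext (osmallD (r1 _) tot).
by near=> t => /=; field.
Unshelve. all: by end_near. Qed.

(** * The linearized operator in its frame *)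

Section Mjet.
Context {R : realType} {n : nat}.
Variables (x : 'rV[R]_n) (xi : 'I_n -> 'rV[R]_n) (w : 'rV[R]_n).
Implicit Types (f g : 'rV[R]_n -> R) (b : 'rV[R]_n).

(* The value, the gradient in the frame [xi], and the value at [x] of the
   operator [sum_k D^2(xi_k, xi_k) - w . grad]. *)
Definition Mjet f (c : R) b (m : R) := exists2 a : 'I_n -> R,
  forall k, J2 (fun t => f (x + t *: xi k)) c (b 0 k) (a k) &
  m = 2 * \sum_k a k - dotp w b.

Lemma Mjet_eq f c b m c' b' m' : Mjet f c b m -> c = c' -> b = b' -> m = m' -> Mjet f c' b' m'.
Proof. by move=> + <- <- <-. Qed.

Lemma line_cvg v : (fun t : R => x + t *: v) @ (0 : R) --> x.
Proof.
have : (fun t : R => x + t *: v) @ (0 : R) --> x + 0 *: v.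
  by apply: cvgD; [exact: cvg_cst|apply: cvgZr_tmp; exact: cvg_id].
by rewrite scale0r addr0.
Qed.

Lemma Mjet_ext f g c b m : (\forall y \near x, f y = g y) -> Mjet f c b m -> Mjet g c b m.
Proof.
move=> fg [a H ->]; exists a => // k; apply: J2_ext (H k).
exact: (line_cvg (xi k) fg).
Qed.

Lemma Mjet_cst c : Mjet (fun=> c) c 0 0.
Proof.
exists (fun=> 0) => [k|]; first by rewrite mxE; exact: J2_cst.
by rewrite dotp0r big1 // mulr0 subr0.
Qed.

Lemma Mjet_D f g c b m c' b' m' : Mjet f c b m -> Mjet g c' b' m' ->
  Mjet (fun y => f y + g y) (c + c') (b + b') (m + m').
Proof.
move=> [a H ->] [a' H' ->]; exists (fun k => a k + a' k) => [k|].
  by rewrite mxE; exact: J2_D.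
by rewrite big_split dotpDr /=; ring.
Qed.

Lemma Mjet_Z k f c b m : Mjet f c b m -> Mjet (fun y => k * f y) (k * c) (k *: b) (k * m).
Proof.
move=> [a H ->]; exists (fun i => k * a i) => [i|].
  by rewrite mxE; exact: J2_Z.
by rewrite -big_distrr dotpZr /=; ring.
Qed.

Lemma Mjet_B f g c b m c' b' m' : Mjet f c b m -> Mjet g c' b' m' ->
  Mjet (fun y => f y - g y) (c - c') (b - b') (m - m').
Proof.
move=> H H'; have := Mjet_D H (Mjet_Z (-1) H').
rewrite !mulN1r scaleN1r => K.
by apply: Mjet_ext K; apply: filterE => y; rewrite mulN1r.
Qed.

Lemma Mjet_M f g c b m c' b' m' : Mjet f c b m -> Mjet g c' b' m' ->
  Mjet (fun y => f y * g y) (c * c') (c *: b' + c' *: b) (c * m' + c' * m + 2 * dotp b b').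
Proof.
move=> [a H ->] [a' H' ->]; exists (fun k => c * a' k + c' * a k + b 0 k * b' 0 k) => [k|].
  by rewrite !mxE; exact: J2_M.
by rewrite !big_split -!big_distrr dotpDr !dotpZr /= -/(dotp b b'); ring.
Qed.

Lemma Mjet_comp h f c b m h0 h1 h2 : J2 (fun s => h (c + s)) h0 h1 h2 -> Mjet f c b m ->
  Mjet (fun y => h (f y)) h0 (h1 *: b) (h1 * m + 2 * h2 * dotp b b).
Proof.
move=> hj [a H ->]; exists (fun k => h1 * a k + h2 * b 0 k ^+ 2) => [k|].
  by rewrite mxE; exact: J2_comp hj (H k).
rewrite big_split -!big_distrr dotpZr /=.
have -> : \sum_k b 0 k ^+ 2 = dotp b b by apply: eq_bigr => k _; rewrite expr2.
by ring.
Qed.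

Lemma Mjet_sum (N : nat) (f : 'I_N -> 'rV[R]_n -> R) (c : 'I_N -> R) (b : 'I_N -> 'rV[R]_n) (m : 'I_N -> R) :
  (forall i, Mjet (f i) (c i) (b i) (m i)) ->
  Mjet (fun y => \sum_i f i y) (\sum_i c i) (\sum_i b i) (\sum_i m i).
Proof.
move=> H; suff L (s : seq 'I_N) : Mjet (fun y => \sum_(i <- s) f i y)
    (\sum_(i <- s) c i) (\sum_(i <- s) b i) (\sum_(i <- s) m i) by exact: L.
elim: s => [|i s ih].
  rewrite !big_nil; apply: Mjet_ext (Mjet_cst 0).
  by apply: filterE => y; rewrite big_nil.
rewrite !big_cons; apply: Mjet_ext (Mjet_D (H i) ih).
by apply: filterE => y; rewrite big_cons.
Qed.

Lemma Mjet_jet2 f (g : 'rV[R]_n) H : jet2 f x g H ->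
  Mjet f (f x) (\row_k dotp g (xi k))
    (\sum_k quad H (xi k) - dotp w (\row_k dotp g (xi k))).
Proof.
move=> fj; exists (fun k => quad H (xi k) / 2) => [k|].
  by rewrite mxE; exact: jet2_line.
by rewrite -mulr_suml; field.
Qed.

Lemma Mjet_mcomp (N : nat) (P : 'rV[R]_N -> R) (F : 'rV[R]_n -> 'rV[R]_N) (g : 'rV[R]_N) H
    (b : 'I_N -> 'rV[R]_n) (m : 'I_N -> R) :
  jet2 P (F x) g H -> (forall i, Mjet (fun y => F y 0 i) (F x 0 i) (b i) (m i)) ->
  Mjet (fun y => P (F y)) (P (F x)) (\sum_i g 0 i *: b i)
    (\sum_i g 0 i * m i + \sum_i \sum_j H i j * dotp (b i) (b j)).
Proof.
move=> PJ FJ; have [a aJ am] : exists2 a : 'I_N -> 'I_n -> R,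
   (forall i k, J2 (fun t => F (x + t *: xi k) 0 i) (F x 0 i) (b i 0 k) (a i k)) &
   forall i, m i = 2 * \sum_k a i k - dotp w (b i).
  have /choice[a aP] : forall i, exists a : 'I_n -> R,
     (forall k, J2 (fun t => F (x + t *: xi k) 0 i) (F x 0 i) (b i 0 k) (a k)) /\
      m i = 2 * \sum_k a k - dotp w (b i).
    by move=> i; have [a H1 H2] := FJ i; exists a.
  by exists a => i; have [] := aP i.
exists (fun k => dotp g (\row_i a i k) + quad H (\row_i b i 0 k) / 2) => [k|].
  have := @J2_mcomp R N P (fun t => F (x + t *: xi k)) (F x) (\row_i b i 0 k) (\row_i a i k) g H PJ.
  have -> : (\sum_i g 0 i *: b i) 0 k = dotp g (\row_i b i 0 k).
    by rewrite summxE; apply: eq_bigr => i _; rewrite !mxE.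
  by apply => i; rewrite !mxE; exact: aJ.
have -> : \sum_i g 0 i * m i = 2 * (\sum_k dotp g (\row_i a i k)) - dotp w (\sum_i g 0 i *: b i).
  rewrite /dotp exchange_big /= [\sum_i w 0 i * _](_ : _ = \sum_i g 0 i * dotp w (b i)); last first.
    by rewrite -[LHS]/(dotp w (\sum_i g 0 i *: b i)) dotp_sumr; apply: eq_bigr => i _; rewrite dotpZr.
  rewrite big_distrr -sumrB /=; apply: eq_bigr => i _.
  rewrite am mulrBr mulrCA; congr (2 * _ - _).
  by rewrite big_distrr; apply: eq_bigr => k _; rewrite mxE.
rewrite big_split /= -mulr_suml.
have -> : \sum_k quad H (\row_i b i 0 k) = \sum_i \sum_j H i j * dotp (b i) (b j).
  rewrite /quad exchange_big; apply: eq_bigr => i _.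
  rewrite /dotp; under eq_bigr do rewrite mxE big_distrr /=.
  rewrite exchange_big; apply: eq_bigr => j _ /=.
  by rewrite big_distrr; apply: eq_bigr => k _; rewrite !mxE /=; ring.
by field.
Qed.

Lemma Mjet_max f c b m : Mjet f c b m -> (\forall y \near x, f y <= f x) -> b = 0 /\ m <= 0.
Proof.
move=> [a H ->] fmax.
have K k : b 0 k = 0 /\ a k <= 0.
  apply: J2_max (H k) _; rewrite scale0r addr0.
  exact: (line_cvg (xi k) fmax).
have b0 : b = 0 by apply/rowP => k; rewrite mxE; have [] := K k.
split=> //; rewrite b0 dotp0r subr0 pmulr_rle0 //.
by apply: sumr_le0 => k _; have [] := K k.
Qed.

End Mjet.

Section Frame.
Context {R : realType} {n : nat}.
Variable p : 'rV[R]_n.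

Definition slope2 : R := 1 + dotp p p.
Definition slope : R := Num.sqrt slope2.

(* The rows of [(I - p^T p / q)^(1/2)] with [q = 1 + |p|^2]. *)
Definition frame (k : 'I_n) : 'rV[R]_n := delta_mx 0 k - (p 0 k / (slope2 + slope)) *: p.

Lemma slope2_ge1 : 1 <= slope2. Proof. by rewrite lerDl dotp_ge0. Qed.
Lemma slope2_gt0 : 0 < slope2. Proof. exact: lt_le_trans slope2_ge1. Qed.
Lemma slope_sqr : slope ^+ 2 = slope2. Proof. by rewrite sqr_sqrtr // ltW // slope2_gt0. Qed.
Lemma slope_gt0 : 0 < slope. Proof. by rewrite sqrtr_gt0 slope2_gt0. Qed.
Lemma slope_ge1 : 1 <= slope.
Proof. by rewrite -(@ler_pXn2r _ 2) ?nnegrE ?(ltW slope_gt0) // slope_sqr expr1n slope2_ge1. Qed.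

Lemma dotp_slope : dotp p p = slope ^+ 2 - 1.
Proof. by rewrite slope_sqr /slope2; ring. Qed.

Lemma enorm_slope : enorm p <= slope.
Proof. by rewrite ler_sqrt ?lerDr // ltW // slope2_gt0. Qed.

Lemma frame_dotp k y : dotp y (frame k) = y 0 k - p 0 k * dotp p y / (slope2 + slope).
Proof. by rewrite dotpBr dotp_delta dotpZr (dotpC y); ring. Qed.

(** This exhibits the coefficient matrix of L as a Gram matrix. With v the slope, |p|^2 = v^2 - 1
    and k = 1 / (v^2 + v), the coefficients -2 k + k^2 (v^2 - 1) of the product (p . y)(p . z) add
    up to -1 / v^2. *)
Lemma frame_gram y z : \sum_k dotp y (frame k) * dotp z (frame k) =
  dotp y z - dotp p y * dotp p z / slope2.
Proof.
have v0 := slope_gt0; rewrite -slope_sqr.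
under eq_bigr do rewrite !frame_dotp -slope_sqr.
set a := dotp p y; set b := dotp p z.
pose k := (slope ^+ 2 + slope)^-1.
transitivity (\sum_i (y 0 i * z 0 i - (b * k) * (p 0 i * y 0 i) - (a * k) * (p 0 i * z 0 i) + a * b * k ^+ 2 * (p 0 i * p 0 i))).
  by apply: eq_bigr => i _; rewrite /k; ring.
rewrite !big_split /= !sumrN -!big_distrr /= -/(dotp y z) -/(dotp p y) -/(dotp p z) -/(dotp p p) -/a -/b dotp_slope /k.
field; rewrite gt_eqF // gt_eqF //.
by rewrite addr_gt0 // exprn_gt0.
Qed.

Lemma frame_p k : dotp p (frame k) = p 0 k / slope.
Proof.
have v0 := slope_gt0; rewrite frame_dotp dotp_slope -slope_sqr; field.
by rewrite (gt_eqF v0) gt_eqF // addr_gt0 // exprn_gt0.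
Qed.

(** The square root has [p] as an eigenvector with eigenvalue 1 / [slope]. Hence the drift
    [phi *: p] in frame coordinates is phi times nu . D. *)
Lemma frame_dot_p y : dotp p (\row_k dotp y (frame k)) = dotp p y / slope.
Proof.
have v0 := slope_gt0.
transitivity (slope * (\sum_k dotp p (frame k) * dotp y (frame k))).
  by rewrite big_distrr; apply: eq_bigr => k _; rewrite frame_p mxE /=; field; rewrite gt_eqF.
rewrite frame_gram dotp_slope -slope_sqr; field; rewrite gt_eqF //.
Qed.

Lemma frame_sqr y : dotp (\row_k dotp y (frame k)) (\row_k dotp y (frame k)) <= dotp y y.
Proof.
have -> : dotp (\row_k dotp y (frame k)) (\row_k dotp y (frame k)) = dotp y y - dotp p y * dotp p y / slope2.
  by rewrite -frame_gram; apply: eq_bigr => k _; rewrite !mxE.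
by rewrite lerBlDr lerDl divr_ge0 ?(ltW slope2_gt0) // -expr2 sqr_ge0.
Qed.

(** The bound does not depend on [p]. It accounts for the constant 2 in [nice], whose expansions are
    used along this frame. *)
Lemma frame_le2 k : `|frame k| <= 2.
Proof.
apply: norm_le_coord => // i; rewrite !mxE /=.
have q0 := slope2_gt0; have v0 := slope_gt0.
rewrite (le_trans (ler_normB _ _)) // [leRHS](_ : 2 = 1 + 1); last by ring.
apply: lerD; first by case: (i == k); rewrite ?normr1 ?normr0.
have s0 := addr_gt0 q0 v0.
rewrite mulrAC normrM normfV (gtr0_norm s0) (ler_pdivrMr _ _ s0) mul1r.
have pk j : `|p 0 j| <= slope by apply: le_trans enorm_slope; exact: coord_le_enorm.
rewrite normrM (le_trans (ler_pM _ _ (pk k) (pk i))) // -expr2 slope_sqr lerDl ltW //.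
Qed.

Lemma frame_quad (H : 'M[R]_n) : \sum_k quad H (frame k) = \tr H - quad H p / slope2.
Proof.
rewrite /quad exchange_big /=.
transitivity (\sum_i (H i i - p 0 i * dotp (row i H) p / slope2)).
  apply: eq_bigr => i _.
  transitivity (\sum_k dotp (delta_mx 0 i) (frame k) * dotp (row i H) (frame k)).
    by apply: eq_bigr => k _; rewrite [dotp (delta_mx _ _) _]dotpC dotp_delta.
  by rewrite frame_gram dotp_delta [dotp (delta_mx _ _) _]dotpC dotp_delta mxE [dotp p (row i H)]dotpC.
by rewrite sumrB -mulr_suml.
Qed.

End Frame.

(** * Differentiating the equation *)

Section Entries.
Context {R : realType} {n : nat}.
Implicit Types x y : 'rV[R]_n.

Lemma vaddE x y i : (x + y) 0 i = x 0 i + y 0 i. Proof. by rewrite mxE. Qed.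
Lemma vsubE x y i : (x - y) 0 i = x 0 i - y 0 i. Proof. by rewrite !mxE. Qed.
Lemma vsclE k x i : (k *: x) 0 i = k * x 0 i. Proof. by rewrite mxE. Qed.
Lemma vrowE (A : 'M[R]_n) i j : (row i A) 0 j = A i j. Proof. by rewrite mxE. Qed.
Lemma vrowkE (f : 'I_n -> R) j : (\row_k f k) 0 j = f j. Proof. by rewrite mxE. Qed.

End Entries.

Lemma near_line {R : realType} {n : nat} (x v : 'rV[R]_n) (P : set 'rV[R]_n) :
  (\forall y \near x, P y) -> \forall t \near (0 : R), P (x + t *: v).
Proof. by move=> H; exact: (line_cvg v H). Qed.

(** * Expansions of elementary functions *)

Section Scalar.
Context {R : realType}.

Lemma is_derive_J1 (h : R -> R) (c d : R) : is_derive c 1 h d -> J1 (fun s => h (c + s)) (h c) d.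
Proof.
move=> [hd hE]; have := derivable_J1 hd; rewrite hE.
by apply: J1_ext; apply: filterE => s; rewrite [s *: 1]mulr1 addrC.
Qed.

Lemma peano1 (h h' : R -> R) (c h2 : R) : (\forall t \near c, is_derive (t : R) (1 : R) h (h' t)) ->
  J1 (fun s => h' (c + s)) (h' c) h2 -> J2 (fun s => h (c + s)) (h c) (h' c) (h2 / 2).
Proof.
move=> hd hj.
pose f (y : 'rV[R]_1) := h (y 0 0).
pose G (y : 'rV[R]_1) : 'rV[R]_1 := \row__ h' (y 0 0).
pose x : 'rV[R]_1 := \row__ c.
have x0 : x 0 0 = c by rewrite mxE.
have fG : \forall y \near x, jet1 setT f y (G y).
  have cx : (fun y : 'rV[R]_1 => y 0 0) @ x --> c by rewrite -x0; exact: coord_continuous.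
  have : \forall y \near x, is_derive ((y : 'rV[R]_1) 0 0 : R) (1 : R) h (h' (y 0 0)) by exact: (cx _ hd).
  apply: filterS => y hy.
  have := jet1_comp (is_derive_J1 hy) (jet1_coord setT 0 y).
  by apply: jet1_eq; apply/rowP => i; rewrite !mxE !ord1 mulr1.
have GH i : jet1 setT (fun y => G y 0 i) x (row i (const_mx h2 : 'M[R]_1)).
  rewrite -x0 in hj.
  have := jet1_comp hj (jet1_coord setT 0 x).
  move=> H; apply: jet1_eq (jet1_ext_near _ H); first by apply/rowP => j; rewrite !mxE !ord1 mulr1.
  by apply: filterE => y; rewrite mxE.
have := jet2_line (delta_mx 0 0) (peano2 fG GH).
rewrite /f /quad big_ord1 !dotp_delta !mxE /= mul1r => H.
by apply: J2_ext H; apply: filterE => s; rewrite !mxE /= mulr1.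
Qed.

Lemma J1_inv (c : R) : c != 0 -> J1 (fun s => (c + s)^-1) c^-1 (- c ^- 2).
Proof.
move=> c0; apply: (@is_derive_J1 (fun t => t^-1)).
have := @is_deriveV _ _ _ _ _ c0 (is_derive_id c 1).
by rewrite /= [_ *: 1]mulr1.
Qed.

Lemma J2_ln (c : R) : 0 < c -> J2 (fun s => ln (c + s)) (ln c) c^-1 (- c ^- 2 / 2).
Proof.
move=> c0; apply: (@peano1 (@ln R) (fun t => t^-1)); last exact: J1_inv (lt0r_neq0 c0).
have : \forall t \near c, 0 < t by exact: lt_nbhsr.
by apply: filterS => t t0; exact: is_derive1_ln.
Qed.

Lemma J2_expR (c : R) : J2 (fun s => expR (c + s)) (expR c) (expR c) (expR c / 2).
Proof.
apply: (@peano1 (@expR R) (@expR R)); last by apply: is_derive_J1; exact: is_derive_expR.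
by apply: filterE => t; exact: is_derive_expR.
Qed.

Lemma J1_sqrt (c : R) : 0 < c -> J1 (fun s => Num.sqrt (c + s)) (Num.sqrt c) (2 * Num.sqrt c)^-1.
Proof. by move=> c0; apply: is_derive_J1; exact: is_derive1_sqrt. Qed.

Lemma J1_cst (c : R) : J1 (fun=> c) c 0.
Proof. exact: J2_J1 (J2_cst c). Qed.

Lemma J1_D (p q : R -> R) (c b c' b' : R) : J1 p c b -> J1 q c' b' ->
  J1 (fun t => p t + q t) (c + c') (b + b').
Proof.
move=> H H'; apply: osmall_ext (osmallD H H').
by near=> t; ring.
Unshelve. all: by end_near. Qed.

Lemma J1_sum (N : nat) (p : 'I_N -> R -> R) (c b : 'I_N -> R) :
  (forall i, J1 (p i) (c i) (b i)) -> J1 (fun t => \sum_i p i t) (\sum_i c i) (\sum_i b i).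
Proof.
move=> H; suff K (s : seq 'I_N) : J1 (fun t => \sum_(i <- s) p i t)
   (\sum_(i <- s) c i) (\sum_(i <- s) b i) by exact: K.
elim: s => [|i s ih].
  rewrite !big_nil; apply: J1_ext (J1_cst 0).
  by near=> t; rewrite big_nil.
rewrite !big_cons; apply: J1_ext (J1_D (H i) ih).
by near=> t; rewrite big_cons.
Unshelve. all: by end_near. Qed.

Lemma J1_M (p q : R -> R) (c b c' b' : R) : J1 p c b -> J1 q c' b' ->
  J1 (fun t => p t * q t) (c * c') (c * b' + c' * b).
Proof.
move=> H H'.
have r1 : osmall (nbhs (0 : R)) (fun t => `|t|) (fun t => (p t - (c + b * t)) * (q t - c')).
  have q0 : obig (nbhs (0 : R)) (fun=> 1) (fun t => q t - c').
    exists 1 => //; near=> t; rewrite mulr1 distrC; near: t.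
    by have /cvgrPdist_le/(_ 1 ltr01) := J1_cvg H'.
  have L := osmallM H q0.
  by move=> e e0; near=> t; rewrite -[X in e * X]mulr1; near: t; exact: L.
have r2 : osmall (nbhs (0 : R)) (fun t => `|t|) (fun t => t * (b * (q t - c'))).
  move=> e e0; have b0 : 0 < `|b| + 1 by rewrite ltr_wpDl.
  have eb : 0 < e / (`|b| + 1) by rewrite divr_gt0.
  near=> t; rewrite normrM mulrC ler_wpM2r // normrM.
  have L : `|q t - c'| <= e / (`|b| + 1).
    by rewrite distrC; near: t; have /cvgrPdist_le/(_ _ eb) := J1_cvg H'.
  apply: (@le_trans _ _ ((`|b| + 1) * `|q t - c'|)); first by rewrite ler_wpM2r // lerDl.
  by rewrite mulrC -ler_pdivlMr.
apply: osmall_ext (osmallD (osmallD r1 r2) (osmallD (osmallZ c' H) (osmallZ c H'))).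
by near=> t; ring.
Unshelve. all: by end_near. Qed.

End Scalar.

Lemma equation_diff_ring {R : realFieldType} (q v U T D P f d : R) : v != 0 -> v ^+ 2 = q ->
  q * T + U * (2 * P) - D = q * (v * d + f * (v^-1 * P)) + v * f * (2 * P) ->
  2 * P * U + q * T - D = 3 * v * P * f + q * v * d.
Proof.
move=> v0 <- E; have -> : 2 * P * U + v ^+ 2 * T - D = v ^+ 2 * T + U * (2 * P) - D by ring.
by rewrite E; field.
Qed.

Section Solution.
Context {R : realType} {n : nat}.
Variables (O : set 'rV[R]_n) (u phi : 'rV[R]_n -> R).
Hypotheses (oO : open O) (uC : Ck 3 O u).

Lemma jet1_partial (f : 'rV[R]_n -> R) x g i : jet1 setT f x g -> partial i f x = g 0 i.
Proof.
move=> /(jet1_line (delta_mx 0 i)) H; rewrite dotp_delta in H.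
have H0 : J1 (fun s => f (x + (0 + s) *: delta_mx 0 i)) (f (x + 0 *: delta_mx 0 i)) (g 0 i).
  by rewrite scale0r addr0; apply: J1_ext H; apply: filterE => s; rewrite add0r.
have [_] := @J1_is_derive R (fun s => f (x + s *: delta_mx 0 i)) 0 (g 0 i) H0.
rewrite /partial /derive /= scale0r addr0 => <-.
have -> // : (fun h : R => h^-1 *: ((f \o shift x) (h *: delta_mx 0 i) - f x)) =
  (fun h : R => h^-1 *: (((fun s => f (x + s *: delta_mx 0 i)) \o shift 0) (h *: 1) - f x)).
by apply/funext => h; rewrite /= /shift /= addr0 [h *: 1]mulr1 [_ + x]addrC.
Qed.

Definition hess (x : 'rV[R]_n) : 'M[R]_n := \matrix_(i, j) partials [:: j; i] u x.

Definition hess_grad (x : 'rV[R]_n) (m : 'I_n) : 'M[R]_n :=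
  \matrix_(i, j) partials [:: j; i; m] u x.

Lemma jet1_u x : O x -> jet1 setT u x (grad u x).
Proof. by move=> Ox; exact: (Ck_jet1 (s := [::]) uC oO Ox). Qed.

Lemma jet2_u x : O x -> jet2 u x (grad u x) (hess x).
Proof. by move=> Ox; exact: (Ck_jet2 (s := [::]) uC oO Ox). Qed.

Lemma jet1_grad x m : O x -> jet1 setT (fun y => grad u y 0 m) x (row m (hess x)).
Proof. by move=> Ox; exact: (Ck_hess (s := [::]) m uC oO Ox). Qed.

Lemma jet2_grad x m : O x ->
  jet2 (fun y => grad u y 0 m) x (row m (hess x)) (hess_grad x m).
Proof.
move=> Ox; have := Ck_jet2 (s := [:: m]) uC oO Ox (ltnSn _).
have -> : (fun y => grad u y 0 m) = partials [:: m] u by apply/funext => y; rewrite mxE.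
have -> // : row m (hess x) = \row_i partials [:: i; m] u x.
by apply/rowP => i; rewrite !mxE.
Qed.

Lemma hess_sym x i j : O x -> hess x i j = hess x j i.
Proof. by move=> Ox; rewrite !mxE; exact: (Ck_sym (s := [::]) _ _ uC oO Ox). Qed.

(** L is applied to the D_m u, which involves their Hessians, while differentiating the equation
    produces derivatives of Hessian entries. The two agree by symmetry of third derivatives: the
    outer two indices are exchanged by Schwarz for D_i u at [x], the inner two by differentiating
    the symmetry of the Hessian near [x]. *)
Lemma jet1_hess x i j : O x ->
  jet1 setT (fun y => hess y i j) x (\row_m hess_grad x m i j).
Proof.
move=> Ox; have := Ck_jet1 (s := [:: j; i]) uC oO Ox (ltnSn _).
have -> : (fun y => hess y i j) = partials [:: j; i] u by apply/funext => y; rewrite mxE.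
apply: jet1_eq; apply/rowP => m; rewrite [LHS]mxE [RHS]mxE [RHS]mxE.
rewrite (Ck_sym (s := [:: i]) m j uC oO Ox (ltnSn _)).
have J1' := Ck_jet1 (s := [:: m; i]) uC oO Ox (ltnSn _).
have J2' := Ck_jet1 (s := [:: i; m]) uC oO Ox (ltnSn _).
have J1'' : jet1 setT (partials [:: i; m] u) x (\row_k partials [:: k; m; i] u x).
  apply: jet1_ext_near J1'; have := open_nbhs_nbhs (conj oO Ox).
  by apply: filterS => y Oy; exact: (Ck_sym (s := [::]) _ _ uC oO Oy).
by have /rowP/(_ j) := jet1_unique J1'' J2'; rewrite [LHS]mxE [RHS]mxE.
Qed.

(** This is D^2u Du, half the gradient of q = 1 + |Du|^2. *)
Definition uu (x : 'rV[R]_n) : 'rV[R]_n := \sum_m grad u x 0 m *: row m (hess x).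

Lemma jet1_slope2 x : O x -> jet1 setT (fun y => slope2 (grad u y)) x (2 *: uu x).
Proof.
move=> Ox.
have H := jet1_D (jet1_cst setT 1 x) (jet1_sum (fun m => jet1_M (jet1_grad m Ox) (jet1_grad m Ox))).
apply: jet1_eq H; rewrite add0r /uu scaler_sumr; apply: eq_bigr => m _.
by rewrite -scalerDl scalerA; congr (_ *: _); ring.
Qed.

Lemma jet1_slope x : O x -> jet1 setT (fun y => slope (grad u y)) x ((slope (grad u x))^-1 *: uu x).
Proof.
move=> Ox; have := jet1_comp (f := fun y => slope2 (grad u y)) (J1_sqrt (slope2_gt0 _)) (jet1_slope2 Ox).
apply: jet1_eq; rewrite scalerA; congr (_ *: _).
by rewrite -/(slope _); field; rewrite gt_eqF // slope_gt0.
Qed.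

Lemma uu_sym x m : O x -> dotp (grad u x) (row m (hess x)) = uu x 0 m.
Proof.
move=> Ox; rewrite summxE; apply: eq_bigr => i _; rewrite !mxE.
by have := hess_sym m i Ox; rewrite !mxE => ->.
Qed.

Lemma quad_hess x : quad (hess x) (grad u x) = dotp (grad u x) (uu x).
Proof.
rewrite /uu dotp_sumr; apply: eq_bigr => i _.
by rewrite dotpZr [dotp (row _ _) _]dotpC.
Qed.

Lemma mean_curvature_opE x : O x -> mean_curvature_op u x =
  (\tr (hess x) - quad (hess x) (grad u x) / slope2 (grad u x)) / slope (grad u x).
Proof.
move=> Ox; have v0 := slope_gt0 (grad u x); have q0 := slope2_gt0 (grad u x).
have Eq : (fun y => (Num.sqrt (1 + enorm (grad u y) ^+ 2))^-1) = (fun y => (slope (grad u y))^-1).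
  by apply/funext => y; rewrite enorm_sqr.
have D i : partial i (fun y => ((Num.sqrt (1 + enorm (grad u y) ^+ 2))^-1 *: grad u y) 0 i) x =
    (hess x i i - grad u x 0 i * uu x 0 i / slope2 (grad u x)) / slope (grad u x).
  have H1 := jet1_comp (f := fun y => slope (grad u y)) (J1_inv (lt0r_neq0 v0)) (jet1_slope Ox).
  have := jet1_M H1 (jet1_grad i Ox).
  have -> : (fun y => (slope (grad u y))^-1 * grad u y 0 i) =
      (fun y => ((Num.sqrt (1 + enorm (grad u y) ^+ 2))^-1 *: grad u y) 0 i).
    by apply/funext => y; rewrite enorm_sqr !mxE.
  move=> /jet1_partial ->; rewrite vaddE !vsclE vrowE -(slope_sqr (grad u x)).
  by field; rewrite gt_eqF.
rewrite /mean_curvature_op /divergence (eq_bigr _ (fun i _ => D i)).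
rewrite -mulr_suml sumrB quad_hess; congr ((_ - _) / _).
by rewrite -mulr_suml.
Qed.

Hypothesis eqn : forall x, O x -> mean_curvature_op u x = phi x.

Lemma equation x : O x ->
  \tr (hess x) - quad (hess x) (grad u x) / slope2 (grad u x) = slope (grad u x) * phi x.
Proof.
move=> Ox; rewrite -eqn // mean_curvature_opE // mulrCA divff ?mulr1 //.
by rewrite gt_eqF // slope_gt0.
Qed.

(** The equation is first multiplied by q, so that no quotient is differentiated: q tr D^2u -
    D^2u(p, p) = q v phi. Both sides are expanded along the m-th axis and their linear coefficients
    compared. *)
Lemma equation_diff x d m : O x -> jet1 setT phi x d ->
  2 * uu x 0 m * \tr (hess x) + slope2 (grad u x) * \tr (hess_grad x m)
   - (2 * dotp (row m (hess x)) (uu x) + quad (hess_grad x m) (grad u x))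
  = 3 * slope (grad u x) * uu x 0 m * phi x
    + slope2 (grad u x) * slope (grad u x) * d 0 m.
Proof.
move=> Ox phid; set p := grad u x; set q := slope2 p; set v := slope p.
have v0 : 0 < v := slope_gt0 p.
have line (f : 'rV[R]_n -> R) g : jet1 setT f x g -> J1 (fun t => f (x + t *: delta_mx 0 m)) (f x) (g 0 m).
  by move=> /(jet1_line (delta_mx 0 m)); rewrite dotp_delta.
have jU i j : J1 (fun t => hess (x + t *: delta_mx 0 m) i j) (hess x i j) (hess_grad x m i j).
  by have := line _ _ (jet1_hess i j Ox); rewrite vrowkE.
have jP i : J1 (fun t => grad u (x + t *: delta_mx 0 m) 0 i) (p 0 i) (hess x i m).
  by have := line _ _ (jet1_grad i Ox); rewrite vrowE.
have jQ : J1 (fun t => slope2 (grad u (x + t *: delta_mx 0 m))) q (2 * uu x 0 m).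
  by have := line _ _ (jet1_slope2 Ox); rewrite vsclE.
have jV : J1 (fun t => slope (grad u (x + t *: delta_mx 0 m))) v (v^-1 * uu x 0 m).
  by have := line _ _ (jet1_slope Ox); rewrite vsclE.
have jF := line _ _ phid.
have jT : J1 (fun t => \tr (hess (x + t *: delta_mx 0 m))) (\tr (hess x)) (\tr (hess_grad x m)).
  exact: (J1_sum (fun i => jU i i)).
have jL := J1_B (J1_M jQ jT)
  (J1_sum (fun i => J1_M (jP i) (J1_sum (fun j => J1_M (jU i j) (jP j))))).
have jR := J1_M jQ (J1_M jV jF).
have LR : \forall t \near (0 : R), let y := x + t *: delta_mx 0 m in
    slope2 (grad u y) * \tr (hess y) -
    \sum_i grad u y 0 i * (\sum_j hess y i j * grad u y 0 j) =
    slope2 (grad u y) * (slope (grad u y) * phi y).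
  have : \forall t \near (0 : R), O (x + t *: delta_mx 0 m).
    by apply: near_line; exact: (open_nbhs_nbhs (conj oO Ox)).
  apply: filterS => t Oy; move: (x + _) Oy => {t} y Oy.
  rewrite /= -equation // mulrBr [_ * (_ / _)]mulrC divfK ?gt_eqF ?slope2_gt0 //.
  congr (_ - _); apply: eq_bigr => i _; congr (_ * _); apply: eq_bigr => j _.
  by rewrite vrowE.
have [_] := J1_unique (J1_ext LR jL) jR.
have E1 i : \sum_j hess x i j * p 0 j = uu x 0 i.
  by rewrite -uu_sym // dotpC; apply: eq_bigr => j _; rewrite vrowE.
have -> : \sum_i (p 0 i * \sum_j (hess x i j * hess x j m + p 0 j * hess_grad x m i j) +
    (\sum_j hess x i j * p 0 j) * hess x i m) =
    2 * dotp (row m (hess x)) (uu x) + quad (hess_grad x m) p.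
  have -> : quad (hess_grad x m) p = \sum_i p 0 i * \sum_j p 0 j * hess_grad x m i j.
    apply: eq_bigr => i _; congr (_ * _); apply: eq_bigr => j _.
    by rewrite vrowE mulrC.
  have E2 : \sum_i (\sum_j hess x i j * p 0 j) * hess x i m = dotp (row m (hess x)) (uu x).
    by apply: eq_bigr => i _; rewrite E1 vrowE (hess_sym i m Ox) mulrC.
  have E3 : \sum_i p 0 i * \sum_j hess x i j * hess x j m = dotp (row m (hess x)) (uu x).
    transitivity (\sum_i \sum_j p 0 i * (hess x i j * hess x j m)).
      by apply: eq_bigr => i _; rewrite big_distrr.
    rewrite exchange_big; apply: eq_bigr => j _ /=.
    rewrite vrowE -E1 big_distrr /=; apply: eq_bigr => i _.
    by rewrite (hess_sym j m Ox) (hess_sym i j Ox); ring.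
  rewrite big_split /= E2; under eq_bigr do rewrite big_split mulrDr.
  rewrite big_split /= E3; ring.
apply: equation_diff_ring; [by rewrite gt_eqF|by rewrite slope_sqr].
Qed.

End Solution.

(** * The Bernstein inequality *)

Lemma grad_Mjet_ring {R : realFieldType} (q v U T D P f d E X : R) : v != 0 -> v ^+ 2 = q ->
  U - X / q = v * f ->
  2 * P * U + q * T - (2 * E + D) = 3 * v * P * f + q * v * d ->
  T - D / q - f * (P / v) = 2 / q * (E - P * X / q) + v * d.
Proof.
move=> v0 <- HU H.
have HT : v ^+ 2 * T = 3 * v * P * f + v ^+ 2 * v * d + (2 * E + D) - 2 * P * U by rewrite -H; ring.
have EU : U = v * f + X / v ^+ 2 by rewrite -HU subrK.
have -> : T = (3 * v * P * f + v ^+ 2 * v * d + (2 * E + D) - 2 * P * (v * f + X / v ^+ 2)) / v ^+ 2.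
  by rewrite -EU -HT mulrAC divff ?mul1r // expf_neq0.
by field.
Qed.

Section Jets.
Context {R : realType} {n : nat}.
Variables (O : set 'rV[R]_n) (u phi : 'rV[R]_n -> R).
Hypotheses (oO : open O) (uC : Ck 3 O u).
Hypothesis eqn : forall x, O x -> mean_curvature_op u x = phi x.
Variables (x d : 'rV[R]_n).
Hypotheses (Ox : O x) (phid : jet1 setT phi x d).

Let p := grad u x.
Let q := slope2 p.
Let v := slope p.
Let Mj := Mjet x (frame p) (phi x *: p).

(** The gradient of D_m u in the frame, so that products of the [beta m] are taken in the metric of
    L. Accordingly [betap] is half the gradient of q in the frame. *)
Definition beta (m : 'I_n) : 'rV[R]_n := \row_k dotp (row m (hess u x)) (frame (grad u x) k).
Definition betap : 'rV[R]_n := \sum_m grad u x 0 m *: beta m.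

(** The equation contributes v phi and the drift subtracts phi (v^2 - 1) / v. What remains is
    bounded when phi is, however large the slope, so [u] can enter barriers. *)
Lemma u_Mjet : Mj u (u x) (v^-1 *: p) (phi x / v).
Proof.
have v0 : 0 < v := slope_gt0 p.
have := Mjet_jet2 (frame p) (phi x *: p) (jet2_u oO uC Ox).
have -> : (\row_k dotp (grad u x) (frame p k)) = v^-1 *: p.
  by apply/rowP => k; rewrite vrowkE vsclE frame_p mulrC.
move=> H; apply: Mjet_eq H _ _ _ => //.
rewrite frame_quad (equation oO uC eqn Ox) dotpZl dotpZr dotp_slope -/v.
by field; rewrite gt_eqF.
Qed.

Lemma betapE : betap = \row_k dotp (uu u x) (frame p k).
Proof.
apply/rowP => k; rewrite vrowkE /betap summxE /uu dotp_suml; apply: eq_bigr => m _.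
by rewrite vsclE /beta vrowkE dotpZl.
Qed.

Lemma beta_betap m : dotp (beta m) betap =
  dotp (row m (hess u x)) (uu u x) - uu u x 0 m * quad (hess u x) p / q.
Proof.
rewrite betapE quad_hess -(uu_sym oO uC) // -frame_gram.
by apply: eq_bigr => k _; rewrite !vrowkE.
Qed.

(** The undifferentiated equation eliminates the trace of D^2u from the differentiated one. The
    undifferentiated phi then occurs only as phi (D^2u p)_m / v, which is exactly the drift. *)
Lemma grad_Mjet m : Mj (fun y => grad u y 0 m) (p 0 m) (beta m)
  (2 / q * dotp (beta m) betap + v * d 0 m).
Proof.
have v0 : 0 < v := slope_gt0 p.
have H := Mjet_jet2 (frame p) (phi x *: p) (jet2_grad oO uC m Ox).
apply: Mjet_eq H _ _ _ => //.
rewrite frame_quad dotpZl frame_dot_p (uu_sym oO uC) // beta_betap.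
apply: grad_Mjet_ring (equation oO uC eqn Ox) (equation_diff oO uC eqn m Ox phid).
- by rewrite gt_eqF.
- exact: slope_sqr.
Qed.

Lemma coord_Mjet i : Mj (fun y => y 0 i) (x 0 i)
  (\row_k dotp (delta_mx 0 i) (frame p k)) (- (phi x * (p 0 i / v))).
Proof.
exists (fun=> 0) => [k|].
  rewrite vrowkE [dotp (delta_mx _ _) _]dotpC dotp_delta.
  apply: J2_ext (J2_lin (x 0 i) (frame p k 0 i)).
  by apply: filterE => t; rewrite [(x + _) 0 i]vaddE vsclE mulrC.
by rewrite big1 // mulr0 sub0r dotpZl frame_dot_p dotp_delta.
Qed.

Definition beta_sqr : R := \sum_m dotp (beta m) (beta m).

Lemma beta_sqr_ge0 : 0 <= beta_sqr.
Proof. by apply: sumr_ge0 => m _; exact: dotp_ge0. Qed.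

Lemma lincomb_CS (a : 'rV[R]_n) (b : 'I_n -> 'rV[R]_n) :
  dotp (\sum_m a 0 m *: b m) (\sum_m a 0 m *: b m) <= dotp a a * \sum_m dotp (b m) (b m).
Proof.
have -> : \sum_m dotp (b m) (b m) = \sum_k dotp (\row_m b m 0 k) (\row_m b m 0 k).
  rewrite /dotp exchange_big; apply: eq_bigr => k _; apply: eq_bigr => m _.
  by rewrite vrowkE.
rewrite big_distrr; apply: ler_sum => k _ /=.
have -> : (\sum_m a 0 m *: b m) 0 k = dotp a (\row_m b m 0 k).
  by rewrite summxE; apply: eq_bigr => m _; rewrite vsclE vrowkE.
by rewrite -expr2 dotp_CS.
Qed.

Lemma betap_le : dotp betap betap <= q * beta_sqr.
Proof.
apply: (le_trans (lincomb_CS p beta)).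
by rewrite ler_wpM2r ?beta_sqr_ge0 // /q /slope2 lerDr.
Qed.

Lemma slope2_Mjet : Mj (fun y => slope2 (grad u y)) q (2 *: betap)
  (2 * (2 / q * dotp betap betap + v * dotp p d + beta_sqr)).
Proof.
have H := Mjet_D (Mjet_cst x (frame p) (phi x *: p) 1)
  (Mjet_sum (fun m => Mjet_M (grad_Mjet m) (grad_Mjet m))).
apply: Mjet_eq H _ _ _ => //.
- rewrite add0r /betap scaler_sumr; apply: eq_bigr => m _.
  by rewrite scalerA -scalerDl; congr (_ *: _); rewrite /p; ring.
rewrite add0r.
have -> : dotp betap betap = \sum_m p 0 m * dotp (beta m) betap.
  by rewrite {1}/betap dotp_suml; apply: eq_bigr => m _; rewrite dotpZl.
rewrite /beta_sqr [dotp p d]/dotp !big_distrr -!big_split /= big_distrr /=.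
by apply: eq_bigr => m _; ring.
Qed.

(** The concavity of the logarithm cancels the term in |betap|^2 that L produces on q. The sum of
    squares [beta_sqr] is left, together with the derivative of the right-hand side of the
    equation. *)
Lemma ln_slope_Mjet : Mj (fun y => ln (slope2 (grad u y)) / 2) (ln q / 2)
  (q^-1 *: betap) ((beta_sqr + v * dotp p d) / q).
Proof.
have q0 : 0 < q := slope2_gt0 p.
have H := Mjet_Z 2^-1 (Mjet_comp (J2_ln q0) slope2_Mjet).
apply: Mjet_eq (Mjet_ext _ H) _ _ _.
- by apply: filterE => y; rewrite mulrC.
- by rewrite mulrC.
- by rewrite !scalerA; congr (_ *: _); field; rewrite gt_eqF.
- by rewrite dotpZl dotpZr; field; rewrite gt_eqF.
Qed.

End Jets.

(** With q' = q - 2 p . g in place of q the cancellation of |P|^2 is only approximate. Each defect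
    is a small multiple of S^2, or linear in S, or of order q; the term S^2 of the Bernstein
    inequality absorbs the first two kinds. Here S^2 is [beta_sqr], [a] is |P|^2, and [c] and [e]
    are P . W and |W|^2 with W the frame gradient of the correction. *)
Lemma bernstein_real {R : realFieldType} (q v q' C L S a PQ c e pm bb fx pg : R) :
  1 <= C -> 0 <= L -> 0 <= S -> 80 * C <= v -> q = v ^+ 2 -> q' = q - 2 * pg ->
  `|pg| <= C * v -> 0 <= a <= q * S ^+ 2 -> `|PQ| <= C * v * S ^+ 2 ->
  `|c| <= C * v * S ^+ 2 + C * q * S -> 0 <= e <= 2 * C ^+ 2 * S ^+ 2 + 2 * C ^+ 2 * q ->
  `|pm| <= C * v -> `|bb| <= C * S -> `|fx| <= 2 * v * L ->
  q / 2 <= q' /\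
  - (2 + 2 * L) * q <= 2 / q * (a - PQ) - 2 / q' * (a - 2 * c + e)
     + S ^+ 2 - pm - 2 * bb + v * fx.
Proof.
move=> C1 L0 S0 vC qE q'E pgC /andP[a0 aS] PQb cb /andP[e0 eb] pmb bbb fxb.
have C0 : 0 < C by lra.
have v0 : 0 < v by lra.
have q0 : 0 < q by rewrite qE exprn_gt0.
have vq : 80 * C * v <= q by rewrite qE expr2 ler_pM2r.
have qq' : q / 2 <= q'.
  rewrite q'E; have := le_trans (ler_norm _) pgC; lra.
split=> //.
have q'0 : 0 < q' by lra.
have iq0 : 0 < q^-1 by rewrite invr_gt0.
have iq'0 : 0 < q'^-1 by rewrite invr_gt0.
have iq' : q'^-1 <= 2 * q^-1.
  by rewrite -[leRHS]invrK invfM invrK lef_pV2 ?posrE ?mulr_gt0 ?invr_gt0 // mulrC.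
have qiq : q * q^-1 = 1 by rewrite divff // gt_eqF.
pose s := S ^+ 2; have s0 : 0 <= s by rewrite sqr_ge0.
rewrite -/s in aS PQb cb eb *.
(* The ratios [k] and [l] measure the correction relative to q; v >= 80 C makes both at most
   1/80. *)
pose k := C * v * q^-1.
have k1 : k <= 1 / 80.
  by rewrite /k ler_pdivrMr //; lra.
have k0 : 0 < k by rewrite /k !mulr_gt0.
pose l := C ^+ 2 * q^-1.
have CC : 80 * C ^+ 2 <= q.
  apply: le_trans vq; rewrite expr2 -[80 * C * v]mulrA ler_pM2l // ler_pM2l //.
  by apply: le_trans vC; rewrite ler_peMl ?ltW //; lra.
have l1 : l <= 1 / 80 by rewrite /l ler_pdivrMr //; lra.
have l0 : 0 < l by rewrite /l mulr_gt0 // exprn_gt0.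
have T1 : - (8 * k * s) <= 2 * a * (q^-1 - q'^-1).
  have -> : q^-1 - q'^-1 = - (2 * pg) * q^-1 * q'^-1.
    have -> : - (2 * pg) = q' - q by rewrite q'E; ring.
    by field; rewrite (gt_eqF q0) (gt_eqF q'0).
  have aq : a * q^-1 <= s by rewrite ler_pdivrMr // mulrC.
  have aq0 : 0 <= a * q^-1 by rewrite mulr_ge0 // ltW.
  have pq : `|pg| * q'^-1 <= 2 * k.
    have := ler_pM (normr_ge0 pg) (ltW iq'0) pgC iq'.
    by rewrite /k; lra.
  have H : (a * q^-1) * (`|pg| * q'^-1) <= s * (2 * k).
    by apply: ler_pM => //; rewrite mulr_ge0 // ltW.
  have H2 : (a * q^-1) * (pg * q'^-1) <= (a * q^-1) * (`|pg| * q'^-1).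
    by rewrite ler_wpM2l // ler_pM2r // ler_norm.
  have -> : 2 * a * (- (2 * pg) * q^-1 * q'^-1) = - (4 * ((a * q^-1) * (pg * q'^-1))) by ring.
  lra.
have T2 : 2 * q^-1 * PQ <= 2 * k * s.
  have := le_trans (ler_norm _) PQb => /(ler_wpM2r (ltW iq0)).
  by rewrite /k; lra.
have T3 : - (8 * k * s + 8 * C * S) <= 4 * q'^-1 * c.
  have := ler_pM (normr_ge0 c) (ltW iq'0) cb iq' => H.
  have H2 : (C * v * s + C * q * S) * (2 * q^-1) = 2 * k * s + 2 * C * S.
    have -> : (C * v * s + C * q * S) * (2 * q^-1) = 2 * k * s + 2 * C * S * (q * q^-1) by rewrite /k; ring.
    by rewrite qiq; ring.
  rewrite H2 in H.
  have := lerNnormlW (lexx `|c * q'^-1|); have : `|c * q'^-1| = `|c| * q'^-1 by rewrite normrM (gtr0_norm iq'0).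
  by move=> ->; lra.
have T4 : 2 * q'^-1 * e <= 8 * l * s + 8 * C ^+ 2.
  have := ler_pM e0 (ltW iq'0) eb iq' => H.
  have H2 : (2 * C ^+ 2 * s + 2 * C ^+ 2 * q) * (2 * q^-1) = 4 * l * s + 4 * C ^+ 2.
    have -> : (2 * C ^+ 2 * s + 2 * C ^+ 2 * q) * (2 * q^-1) = 4 * l * s + 4 * C ^+ 2 * (q * q^-1) by rewrite /l; ring.
    by rewrite qiq; ring.
  rewrite H2 in H; lra.
have T5 : - (2 * q * L) <= v * fx.
  have := ler_wpM2l (ltW v0) (lerNnormlW fxb); rewrite qE expr2; lra.
have T6 := le_trans (ler_norm _) pmb; have T7 := le_trans (ler_norm _) bbb.
have ks : k * s <= s / 80 by have := ler_wpM2r s0 k1; lra.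
have ls : l * s <= s / 80 by have := ler_wpM2r s0 l1; lra.
(* Half of this square absorbs the total linear term -10 C S; the remainder -58 C^2 - C v is at
   least -q because 80 C^2 and 80 C v are at most q. *)
have sq : 0 <= s - 20 * C * S + 100 * C ^+ 2.
  have -> : s - 20 * C * S + 100 * C ^+ 2 = (S - 10 * C) ^+ 2 by rewrite /s; ring.
  exact: sqr_ge0.
have -> : 2 / q * (a - PQ) - 2 / q' * (a - 2 * c + e) + s - pm - 2 * bb + v * fx =
   2 * a * (q^-1 - q'^-1) - 2 * q^-1 * PQ + 4 * q'^-1 * c - 2 * q'^-1 * e + s - pm - 2 * bb + v * fx by ring.
lra.
Qed.

Lemma bernstein_z_real {R : realFieldType} (q v C t : R) : 1 <= C -> 80 * C <= v -> q = v ^+ 2 ->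
  t <= C * v -> 0 <= q - 1 - t.
Proof.
move=> C1 vC -> tC; have v0 : 0 < v by lra.
have h1 : 80 * C * v <= v * v by rewrite ler_pM2r.
have h2 : 1 <= C * v by rewrite -[leLHS]mulr1 ler_pM //; lra.
rewrite expr2; lra.
Qed.

Lemma bernstein_final_real {R : realFieldType} (q q' L : R) : 0 <= L -> q / 2 <= q' ->
  - (4 + 4 * L) * q' <= - (2 + 2 * L) * q.
Proof.
move=> L0 h; have L2 : 0 <= 2 + 2 * L by lra.
have := ler_wpM2l L2 h; lra.
Qed.

Section Bernstein.
Context {R : realType} {n : nat}.
Variables (O : set 'rV[R]_n) (u phi : 'rV[R]_n -> R).
Hypotheses (oO : open O) (uC : Ck 3 O u).
Hypothesis eqn : forall x, O x -> mean_curvature_op u x = phi x.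
Variables (x d : 'rV[R]_n).
Hypotheses (Ox : O x) (phid : jet1 setT phi x d).

Let p := grad u x.
Let q := slope2 p.
Let v := slope p.
Let Mj := Mjet x (frame p) (phi x *: p).

(** The functions [gf] stand for the components of psi g. The derivative f_z enters only through v
    f_z (q - 1 - p . g), which is nonnegative once the slope is large compared with [C]; it is
    discarded, so no upper bound on f_z appears. *)
Lemma bernstein (gf : 'I_n -> 'rV[R]_n -> R) (g m fx : 'rV[R]_n) (b : 'I_n -> 'rV[R]_n)
    (C L fz : R) :
  (forall i, Mj (gf i) (g 0 i) (b i) (m 0 i)) ->
  d = fx + fz *: p -> 0 <= fz -> enorm fx <= L -> 1 <= C -> 0 <= L ->
  enorm g <= C -> \sum_i dotp (b i) (b i) <= C ^+ 2 -> enorm m <= C -> 80 * C <= v ->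
  q / 2 <= q - 2 * dotp p g /\
  exists b' M, Mj (fun y => ln (slope2 (grad u y) - 2 * \sum_i grad u y 0 i * gf i y) / 2)
     (ln (q - 2 * dotp p g) / 2) b' M /\ - (4 + 4 * L) <= M.
Proof.
move=> gJ dE fz0 fxL C1 L0 gC bC mC vC.
have C0 : 0 < C := lt_le_trans ltr01 C1.
have v0 : 0 < v := slope_gt0 p.
have q0 : 0 < q := slope2_gt0 p.
have qv : q = v ^+ 2 by rewrite /q -slope_sqr.
have pv : enorm p <= v := enorm_slope p.
pose P := betap u x; pose S2 := beta_sqr u x; pose S := Num.sqrt S2.
have S20 : 0 <= S2 := beta_sqr_ge0 u x.
have SE : S ^+ 2 = S2 by rewrite sqr_sqrtr.
have S0 : 0 <= S := sqrtr_ge0 _.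
(* The frame gradient of Du . gf is [Q] plus [Z]: the former comes from differentiating Du, the
   latter from differentiating [gf]. *)
pose Z := \sum_i p 0 i *: b i; pose Q := \sum_i g 0 i *: beta u x i.
have PS : enorm P <= v * S.
  rewrite -(@ler_pXn2r _ 2) ?nnegrE ?enorm_ge0 ?mulr_ge0 ?(ltW v0) //.
  by rewrite enorm_sqr exprMn SE -qv; exact: betap_le.
have QS : enorm Q <= C * S.
  rewrite -(@ler_pXn2r _ 2) ?nnegrE ?enorm_ge0 ?mulr_ge0 ?(ltW C0) //.
  rewrite enorm_sqr exprMn SE; apply: (le_trans (lincomb_CS _ _)).
  by rewrite ler_wpM2r // -enorm_sqr lerXn2r ?nnegrE ?enorm_ge0 // ltW.
have ZC : enorm Z <= C * v.
  rewrite -(@ler_pXn2r _ 2) ?nnegrE ?enorm_ge0 ?mulr_ge0 ?(ltW C0) ?(ltW v0) //.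
  rewrite enorm_sqr exprMn; apply: (le_trans (lincomb_CS _ _)).
  rewrite mulrC ler_pM ?dotp_ge0 ?sumr_ge0 // => [i _|]; first exact: dotp_ge0.
  by rewrite -enorm_sqr lerXn2r ?nnegrE ?enorm_ge0 // ltW.
pose W := Q + Z.
have WC : enorm W <= C * S + C * v by rewrite (le_trans (enormD _ _)) // lerD.
pose bb := \sum_i dotp (beta u x i) (b i).
have bbC : `|bb| <= C * S.
  have H : forall i, dotp (beta u x i) (b i) = \sum_k (beta u x i 0 k * b i 0 k) by [].
  pose A := \matrix_(i < n, k < n) beta u x i 0 k.
  rewrite -(@ler_pXn2r _ 2) ?nnegrE ?mulr_ge0 ?(ltW C0) // real_normK ?num_real //.
  (* Cauchy-Schwarz for families of vectors, regarded as one long vector. *)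
  have E (e f : 'I_n -> 'rV[R]_n) : \sum_i dotp (e i) (f i) =
      dotp (mxvec (\matrix_i e i)) (mxvec (\matrix_i f i)).
    rewrite /dotp (reindex _ (curry_mxvec_bij _ _)) /= pair_bigA /=.
    by apply: eq_bigr => -[i k] _ /=; rewrite !mxvecE !mxE.
  rewrite /bb E; apply: (le_trans (dotp_CS _ _)); rewrite -!E mulrC exprMn SE.
  by rewrite ler_wpM2r.
have pgC : `|dotp p g| <= C * v.
  by rewrite (le_trans (dotp_le_enorm _ _)) // mulrC ler_pM ?enorm_ge0.
have pmC : `|dotp p m| <= C * v.
  by rewrite (le_trans (dotp_le_enorm _ _)) // mulrC ler_pM ?enorm_ge0.
have Cv : C <= v by apply: le_trans vC; rewrite ler_peMl ?(ltW C0) // ler1n.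
have fxb : `|dotp (p - g) fx| <= 2 * v * L.
  rewrite (le_trans (dotp_le_enorm _ _)) // ler_pM ?enorm_ge0 //.
  by rewrite (le_trans (enormD _ _)) // enormN mulr_natl mulr2n lerD // (le_trans gC).
have a0 : 0 <= dotp P P <= q * S ^+ 2.
  by rewrite dotp_ge0 -enorm_sqr qv -exprMn lerXn2r ?nnegrE ?enorm_ge0 // mulr_ge0 // ltW.
have PQ : `|dotp P Q| <= C * v * S ^+ 2.
  rewrite (le_trans (dotp_le_enorm _ _)) // (_ : C * v * S ^+ 2 = (v * S) * (C * S)); last by ring.
  by rewrite ler_pM ?enorm_ge0.
have cb : `|dotp P W| <= C * v * S ^+ 2 + C * q * S.
  rewrite (le_trans (dotp_le_enorm _ _)) // (_ : _ + _ = (v * S) * (C * S + C * v)); last by rewrite qv; ring.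
  by rewrite ler_pM ?enorm_ge0.
have eb : 0 <= dotp W W <= 2 * C ^+ 2 * S ^+ 2 + 2 * C ^+ 2 * q.
  rewrite dotp_ge0 -enorm_sqr; apply: (@le_trans _ _ ((C * S + C * v) ^+ 2)).
    by rewrite lerXn2r ?nnegrE ?enorm_ge0 ?addr_ge0 ?mulr_ge0 ?(ltW C0) ?(ltW v0).
  rewrite -subr_ge0 (_ : _ - _ = (C * S - C * v) ^+ 2) ?sqr_ge0 // qv; ring.
have [qq' key] := bernstein_real C1 L0 S0 vC qv erefl pgC a0 PQ cb eb pmC bbC fxb.
split=> //.
set q' := q - 2 * dotp p g in qq' key *.
have q'0 : 0 < q' by apply: lt_le_trans qq'; rewrite divr_gt0.
have H1 := slope2_Mjet oO uC eqn Ox phid.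
have H2 := Mjet_sum (fun i => Mjet_M (grad_Mjet oO uC eqn Ox phid i) (gJ i)).
have H3 := Mjet_B H1 (Mjet_Z 2 H2).
have H4 := Mjet_Z 2^-1 (Mjet_comp (J2_ln q'0) H3).
exists (2^-1 *: (q'^-1 *: (2 *: P - 2 *: W))).
pose M := (2 / q * (dotp P P - dotp P Q) - 2 / q' * (dotp P P - 2 * dotp P W + dotp W W)
   + S ^+ 2 - dotp p m - 2 * bb + v * dotp (p - g) fx + v * (fz * (q - 1 - dotp p g))) / q'.
exists M; split.
  have bE : \sum_i (p 0 i *: b i + g 0 i *: beta u x i) = W.
    by rewrite big_split /= addrC.
  have mE : \sum_i (p 0 i * m 0 i + g 0 i * (2 / q * dotp (beta u x i) P + v * d 0 i) +
      2 * dotp (beta u x i) (b i)) = dotp p m + 2 / q * dotp P Q + v * dotp g d + 2 * bb.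
    have -> : dotp P Q = \sum_i g 0 i * dotp (beta u x i) P.
      by rewrite dotpC /Q dotp_suml; apply: eq_bigr => i _; rewrite dotpZl.
    rewrite /bb [dotp p m]/dotp [dotp g d]/dotp !big_distrr -!big_split /=.
    by apply: eq_bigr => i _; ring.
  rewrite bE mE in H4.
  apply: Mjet_eq (Mjet_ext _ H4) _ _ _ => //.
  - by apply: filterE => y; rewrite mulrC.
  - by rewrite mulrC.
  - rewrite -/P -/S2 -SE /M -[q - 1](_ : dotp p p = _); last by rewrite dotp_slope qv.
    have -> : dotp (2 *: P - 2 *: W) (2 *: P - 2 *: W) =
        4 * (dotp P P - 2 * dotp P W + dotp W W).
      by rewrite !(dotpBl, dotpBr, dotpZl, dotpZr) (dotpC W P); ring.
    have -> : dotp (grad u x) d = dotp p fx + fz * dotp p p by rewrite dE dotpDr dotpZr.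
    have -> : dotp g d = dotp g fx + fz * dotp p g by rewrite dE dotpDr dotpZr (dotpC g p).
    rewrite dotpBl -/p -/q -/v.
    by field; rewrite (gt_eqF q0) (gt_eqF q'0).
have fzt : 0 <= v * (fz * (q - 1 - dotp p g)).
  rewrite mulr_ge0 ?(ltW v0) // mulr_ge0 //.
  exact: bernstein_z_real C1 vC qv (le_trans (ler_norm _) pgC).
rewrite /M ler_pdivlMr //.
apply: (@le_trans _ _ (- (2 + 2 * L) * q)); last by rewrite -[leLHS]addr0 lerD.
exact: bernstein_final_real L0 qq'.
Qed.

End Bernstein.

(** * The interior gradient estimate *)

Section Ext.
Context {R : realType} {n : nat}.
Implicit Types (A : set 'rV[R]_n) (g : 'rV[R]_n -> R).

Lemma ext_lim A g x l : closure A x -> g @ within A (nbhs x) --> l -> ext A g x = l.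
Proof.
move=> Ax gl; have PF : ProperFilter (within A (nbhs x)) by exact: within_nbhs_proper.
by apply: cvg_lim gl; exact: norm_hausdorff.
Qed.

Lemma ext_in A g x : A x -> {for x, continuous g} -> ext A g x = g x.
Proof.
by move=> Ax cg; apply: ext_lim; [exact: subset_closure|apply: cvg_within_filter].
Qed.

Lemma ext_closure A g h x : closure A x -> {within closure A, continuous h} ->
  {in A, h =1 g} -> ext A g x = h x.
Proof.
move=> Ax /subspace_continuousP ch hg; apply: ext_lim => //.
have H : h @ within A (nbhs x) --> h x.
  apply: cvg_trans (ch x Ax); apply: cvg_app.
  by apply: within_subset; exact: subset_closure.
apply: cvg_trans H; apply: near_eq_cvg; apply/withinP; near=> y => Ay.
by rewrite hg // inE.
Unshelve. all: by end_near. Qed.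

End Ext.

Section Cyl.
Context {R : realType} {n : nat}.
Implicit Types (O : set 'rV[R]_n) (x : 'rV[R]_n) (z : R) (f : 'rV[R]_n -> R -> R).

Lemma pt_l x z i : pt x z 0 (lshift 1 i) = x 0 i.
Proof. by rewrite row_mxEl. Qed.

Lemma pt_r x z : pt x z 0 (rshift n ord0) = z.
Proof. by rewrite row_mxEr mxE eqxx mulr1n. Qed.

Lemma lsubmx_pt x z : lsubmx (pt x z) = x. Proof. exact: row_mxKl. Qed.

Lemma rsubmx_pt x z : rsubmx (pt x z) 0 0 = z.
Proof. by rewrite row_mxKr mxE eqxx mulr1n. Qed.

Lemma joint_pt f x z : joint f (pt x z) = f x z.
Proof. by rewrite /joint lsubmx_pt rsubmx_pt. Qed.

Lemma cyl_pt O M0 x z : cyl O M0 (pt x z) <-> O x /\ - M0 < z < M0.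
Proof. by rewrite /cyl /= lsubmx_pt rsubmx_pt. Qed.

Lemma lsubmx_norm (p : 'rV[R]_(n + 1)) : `|lsubmx p| <= `|p|.
Proof. by apply: norm_le_coord => // i; rewrite mxE coord_le_norm. Qed.

Lemma rsubmx_norm (p : 'rV[R]_(n + 1)) : `|rsubmx p 0 0| <= `|p|.
Proof. by rewrite mxE coord_le_norm. Qed.

Lemma pt_norm x z : `|pt x z| <= Num.max `|x| `|z|.
Proof.
apply: norm_le_coord => [|i]; first by rewrite le_max normr_ge0.
case: (split_ordP i) => j ->; first by rewrite pt_l le_max coord_le_norm.
by rewrite (ord1 j) pt_r le_max lexx orbT.
Qed.

Lemma ptB x z x' z' : pt x z - pt x' z' = pt (x - x') (z - z').
Proof.
apply/rowP => i; rewrite mxE [X in _ + X]mxE; case: (split_ordP i) => j ->.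
  by rewrite !pt_l !mxE.
by rewrite (ord1 j) !pt_r.
Qed.

Lemma cyl_open O M0 : open O -> open (cyl O M0).
Proof.
move=> oO; rewrite openE => p [Op /andP[p1 p2]].
have [e e0 H] := open_normP oO Op.
pose z := rsubmx p 0 0.
pose d := Num.min e (Num.min (z + M0) (M0 - z)).
apply/near_normP; exists d; first by rewrite !lt_min e0 subr_gt0 p2 -(opprK M0) subr_gt0 p1.
move=> y yp; split.
  apply: H; rewrite -linearB /=; apply: le_lt_trans (lsubmx_norm _) _.
  by apply: lt_le_trans yp _; rewrite ge_min lexx.
have : `|rsubmx y 0 0 - z| < d.
  apply: le_lt_trans yp; apply: le_trans (rsubmx_norm (y - p)).
  by rewrite /z !mxE.
rewrite !lt_min => /andP[_ /andP[]]; rewrite !ltr_norml => /andP[H1 _] /andP[_ H3].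
move: H1 H3; rewrite -/z; have := p1; have := p2; rewrite -/z => *.
by apply/andP; split; lra.
Qed.

End Cyl.

Section Fjet.
Context {R : realType} {n : nat}.
Implicit Types (O : set 'rV[R]_n) (f : 'rV[R]_n -> R -> R).

Lemma J1_max (p : R -> R) (c b : R) : J1 p c b -> (\forall t \near (0 : R), p t <= c) -> b = 0.
Proof.
move=> pj pm; apply/eqP/negPn/negP => b0.
have e0 : 0 < `|b| / 2 by rewrite divr_gt0 // normr_gt0.
have /nbhs_norm0P[d /= d0 H] : \forall t \near (0 : R),
    `|p t - (c + b * t)| <= `|b| / 2 * `|t| /\ p t <= c.
  by near=> t; split; near: t => //; exact: pj.
have d20 : 0 < d / 2 by rewrite divr_gt0.
pose t := Num.sg b * (d / 2).
have tn : `|t| = d / 2 by rewrite normrM normr_sg b0 mul1r gtr0_norm.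
have td : `|t| < d by rewrite tn; lra.
have [] := H t td; rewrite tn.
have -> : b * t = `|b| * (d / 2) by rewrite mulrA [b * _]mulrC -normrEsg.
rewrite ler_norml => /andP[H1 _] H2.
have : 0 < `|b| * (d / 2) by rewrite mulr_gt0 // normr_gt0.
lra.
Unshelve. all: by end_near. Qed.

Lemma jet1_max (f : 'rV[R]_n -> R) x g : jet1 setT f x g ->
  (\forall y \near x, f y <= f x) -> g = 0.
Proof.
move=> fj fm; apply/rowP => i; rewrite mxE -(dotp_delta g i).
exact: J1_max (jet1_line (delta_mx 0 i) fj) (@near_line R n x (delta_mx 0 i) (fun y => f y <= f x) fm).
Qed.

(** Where u = M0 or u = -M0 inside the domain, u is extremal and its gradient vanishes. Points with
    nonzero gradient therefore lie over the open cylinder, where [f] and [psi] have honest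
    derivatives. *)
Lemma grad_neq0_bound O (u : 'rV[R]_n -> R) x (M0 : R) : open O -> Ck 1 O u ->
  (forall y, O y -> `|u y| <= M0) -> O x -> grad u x != 0 -> - M0 < u x < M0.
Proof.
move=> oO uC uM Ox g0.
have uj := Ck_jet1 (s := [::]) uC oO Ox (ltnSn _).
have On := open_nbhs_nbhs (conj oO Ox).
have := uM x Ox; rewrite ler_norml !le_eqVlt => /andP[/predU1P[E|->] /predU1P[E'|->]] //; exfalso.
all: move/negP: g0; apply; apply/eqP.
- have := jet1_max uj; apply.
  by apply: filterS On => y Oy; rewrite /= E'; exact: le_trans (ler_norm _) (uM y Oy).
- have /jet1_max : jet1 setT (fun y => -1 * u y) x (-1 *: grad u x) by exact: jet1_Z uj.
  rewrite scaleN1r => H; apply/eqP; rewrite -oppr_eq0; apply/eqP/H.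
  apply: filterS On => y Oy; rewrite !mulN1r lerN2 -E.
  by exact: lerNnormlW (uM y Oy).
- have := jet1_max uj; apply.
  by apply: filterS On => y Oy; rewrite /= E'; exact: le_trans (ler_norm _) (uM y Oy).
Qed.

Lemma pt_jet1 K (u : 'rV[R]_n -> R) x p i : jet1 K u x p ->
  jet1 K (fun y => pt y (u y) 0 i) x
    (match fintype.split i with inl j => delta_mx 0 j | inr _ => p end).
Proof.
move=> uj; case: (split_ordP i) => j ->.
  apply: jet1_ext (jet1_coord K j x); last by rewrite pt_l.
  by near=> y; rewrite pt_l.
rewrite (ord1 j); apply: jet1_ext uj; last by rewrite pt_r.
by near=> y; rewrite pt_r.
Unshelve. all: by end_near. Qed.

Lemma sum_pt (G : 'rV[R]_(n + 1)) (p : 'rV[R]_n) :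
  \sum_i G 0 i *: (match fintype.split i with inl j => delta_mx 0 j | inr _ => p end) =
  lsubmx G + rsubmx G 0 0 *: p.
Proof.
rewrite big_split_ord /= big_ord1 (unsplitK (inr _)) mxE; congr (_ + _).
transitivity (\sum_i G 0 (lshift 1 i) *: (delta_mx 0 i : 'rV[R]_n)).
  by apply: eq_bigr => i _; rewrite (unsplitK (inl i)).
by rewrite [RHS]row_sum_delta; apply: eq_bigr => i _; rewrite mxE.
Qed.

Lemma joint_jet1 K L (P : 'rV[R]_(n + 1) -> R) (u : 'rV[R]_n -> R) x p G :
  jet1 L P (pt x (u x)) G -> jet1 K u x p ->
  (\forall y \near within K (nbhs x), L (pt y (u y))) ->
  jet1 K (fun y => P (pt y (u y))) x (lsubmx G + rsubmx G 0 0 *: p).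
Proof.
move=> PG uj KL; rewrite -sum_pt.
exact: (@jet1_mcomp R n (n + 1) K L (fun y => pt y (u y))) PG (fun i => pt_jet1 i uj) KL.
Qed.

(** The composition with the graph of [u] takes place in the open cylinder, so the extensions [f_x]
    and [f_z] are ordinary partial derivatives there. *)
Lemma f_jet O M0 L1 f (u : 'rV[R]_n -> R) x p : open O -> f_conditions O M0 L1 f ->
  O x -> - M0 < u x < M0 -> jet1 setT u x p ->
  jet1 setT (fun y => f y (u y)) x (f_x O M0 f x (u x) + f_z O M0 f x (u x) *: p).
Proof.
move=> oO [[fC _ _] _ _] Ox uM uj.
have cO := cyl_open (M0 := M0) oO.
have cx : cyl O M0 (pt x (u x)) by apply/cyl_pt.
have fj := Ck_jet1 (s := [::]) fC cO cx (ltnSn _).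
apply: jet1_eq (jet1_ext_near _ (joint_jet1 fj uj _)); last exact: filterE.
  have ce i : ext (cyl O M0) (partial i (joint f)) (pt x (u x)) = partial i (joint f) (pt x (u x)).
    by apply: ext_in => //; case: fC => _ C; exact: (C [:: i]).
  congr (_ + _ *: _); last by rewrite !mxE /f_z ce.
  by apply/rowP => i; rewrite !mxE ce.
by apply: filterE => y; rewrite /= joint_pt.
Qed.

Lemma f_at O M0 L1 f x z : f_conditions O M0 L1 f -> O x -> - M0 <= z <= M0 ->
  [/\ 0 <= f_z O M0 f x z, enorm (f_x O M0 f x z) <= L1 & `|f x z| <= L1].
Proof.
move=> [_ fz fb] Ox zM; have Oc := subset_closure Ox.
have := fb x z Oc zM; have := enorm_ge0 (f_x O M0 f x z); have := normr_ge0 (f x z) => *.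
by split; [exact: fz|lra|lra].
Qed.

End Fjet.

Section Interior.
Context {R : realType} {n : nat}.

Lemma jet1_continuous (f : 'rV[R]_n -> R) x g : jet1 setT f x g -> {for x, continuous f}.
Proof.
move=> /jet1_cvg; apply: cvg_trans; apply: cvg_app => P.
by move=> /withinP; apply: filterS => y; apply.
Qed.

Lemma J2_expR_scaled (k c : R) : J2 (fun s => expR (k * (c + s)) - 1) (expR (k * c) - 1)
  (k * expR (k * c)) (k ^+ 2 * expR (k * c) / 2).
Proof.
have H1 : J2 (fun s => k * (c + s)) (k * c) k 0.
  by apply: J2_ext (J2_lin (k * c) k); apply: filterE => s; ring.
have := J2_D (J2_comp (J2_expR (k * c)) H1) (J2_cst (-1)).
by apply: J2_eq; ring.
Qed.

Lemma closed_enorm_ball (x0 : 'rV[R]_n) (r : R) : closed [set y | dotp (y - x0) (y - x0) <= r].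
Proof.
have c : continuous (fun y : 'rV[R]_n => dotp (y - x0) (y - x0)).
  move=> y; rewrite /dotp; have H i : jet1 setT (fun y : 'rV[R]_n => (y - x0) 0 i) y (delta_mx 0 i - 0).
    apply: jet1_ext_near (jet1_B (jet1_coord setT i y) (jet1_cst setT (x0 0 i) y)).
    by apply: filterE => z; rewrite vsubE.
  exact: (jet1_continuous (jet1_sum (fun i => jet1_M (H i) (H i)))).
apply: (@closed_comp _ _ _ [set t : R | t <= r]); last exact: closed_le.
by move=> y _; exact: c.
Qed.

Lemma compact_enorm_ball (x0 : 'rV[R]_n) (r : R) : 0 <= r ->
  compact [set y | dotp (y - x0) (y - x0) <= r ^+ 2].
Proof.
move=> r0; apply: bounded_closed_compact; last exact: closed_enorm_ball.
exists (`|x0| + r); split; first exact: num_real.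
move=> M MM y /= H; apply/ltW; apply: le_lt_trans MM.
rewrite -[y](subrK x0) addrC (le_trans (ler_normD _ _)) // lerD //.
apply: (le_trans (norm_le_enorm _)).
by rewrite -(@ler_pXn2r _ 2) ?nnegrE ?enorm_ge0 // enorm_sqr.
Qed.

End Interior.

(** The squared length of c p - a X, where X is x - x0 in the frame. The vertical part contributes
    at least 3 / (64 M0^2), since v >= 2; the cross term costs at most 1 / (64 M0^2), since v >= 128
    M0 / D. *)
Lemma barrier_real {R : realFieldType} (D M0 v XX ph a c : R) : 0 < D -> 0 < M0 ->
  2 <= v -> 128 * M0 / D <= v -> 0 <= XX -> `|ph| <= v * D ->
  a = 4 / D ^+ 2 -> c = (4 * M0 * v)^-1 ->
  (32 * M0 ^+ 2)^-1 <= a ^+ 2 * XX - 2 * (a * c * (ph / v)) + c ^+ 2 * (v ^+ 2 - 1).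
Proof.
move=> D0 M00 v2 vD XX0 phb aE cE.
have v0 : 0 < v by lra.
have a0 : 0 < a by rewrite aE divr_gt0 // exprn_gt0.
have c0 : 0 < c by rewrite cE invr_gt0 !mulr_gt0.
have t1 : 0 <= a ^+ 2 * XX by rewrite mulr_ge0 // sqr_ge0.
have N0 : 0 < (64 * M0 ^+ 2)^-1 by rewrite invr_gt0 mulr_gt0 // exprn_gt0.
have t2 : 2 * (a * c * (ph / v)) <= (64 * M0 ^+ 2)^-1.
  have H : ph / v <= D by rewrite ler_pdivrMr // mulrC; exact: le_trans (ler_norm _) phb.
  have ac0 : 0 <= 2 * (a * c) by rewrite mulr_ge0 // mulr_ge0 // ltW.
  have := ler_wpM2l ac0 H.
  have -> : 2 * (a * c) * D = 2 / (D * M0 * v) by rewrite aE cE; field; rewrite !gt_eqF.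
  have : 2 / (D * M0 * v) <= (64 * M0 ^+ 2)^-1.
    have -> : 2 / (D * M0 * v) = (64 * M0 ^+ 2)^-1 * (128 * M0 / D / v) by field; rewrite !gt_eqF.
    by rewrite ler_piMr ?(ltW N0) // ler_pdivrMr // mul1r.
  lra.
have t3 : (64 * M0 ^+ 2)^-1 * 3 <= c ^+ 2 * (v ^+ 2 - 1).
  have -> : c ^+ 2 * (v ^+ 2 - 1) = (64 * M0 ^+ 2)^-1 * (4 * (1 - v ^- 2)).
    by rewrite cE; field; rewrite !gt_eqF.
  rewrite ler_wpM2l ?(ltW N0) //.
  have iv : v ^- 2 <= 4^-1.
    rewrite lef_pV2 ?posrE ?exprn_gt0 // expr2.
    have := ler_pM (ler0n R 2) (ler0n R 2) v2 v2; lra.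
  lra.
have -> : (32 * M0 ^+ 2)^-1 = 2 * (64 * M0 ^+ 2)^-1 by field; rewrite gt_eqF.
lra.
Qed.

Section Barrier.
Context {R : realType} {n : nat}.
Variables (O : set 'rV[R]_n) (u phi : 'rV[R]_n -> R).
Hypotheses (oO : open O) (uC : Ck 3 O u).
Hypothesis eqn : forall x, O x -> mean_curvature_op u x = phi x.
Variables (x d : 'rV[R]_n).
Hypotheses (Ox : O x) (phid : jet1 setT phi x d).

Let p := grad u x.
Let q := slope2 p.
Let v := slope p.
Let Mj := Mjet x (frame p) (phi x *: p).

Lemma sqdist_Mjet (x0 : 'rV[R]_n) :
  exists2 m : R, Mj (fun y => dotp (y - x0) (y - x0)) (dotp (x - x0) (x - x0))
    (2 *: \row_k dotp (x - x0) (frame p k)) m &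
  `|m| <= 2 * `|phi x| * enorm (x - x0) + 2 * n%:R.
Proof.
have v0 : 0 < v := slope_gt0 p.
pose B i : 'rV[R]_n := \row_k dotp (delta_mx 0 i) (frame p k).
pose h := x - x0.
have cJ i : Mj (fun y => (y - x0) 0 i) (h 0 i) (B i) (- (phi x * (p 0 i / v))).
  have := Mjet_B (coord_Mjet u phi x i) (Mjet_cst x (frame p) (phi x *: p) (x0 0 i)).
  move=> H; apply: Mjet_eq (Mjet_ext _ H) _ _ _; rewrite ?subr0 //.
    by apply: filterE => y; rewrite vsubE.
  by rewrite vsubE.
have H := Mjet_sum (fun i => Mjet_M (cJ i) (cJ i)).
exists (- (2 * phi x * (dotp p h / v)) + 2 * \sum_i dotp (B i) (B i)).
  apply: Mjet_eq H _ _ _ => //.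
    apply/rowP => k; rewrite summxE vsclE vrowkE /dotp big_distrr; apply: eq_bigr => i _ /=.
    rewrite vaddE !vsclE vrowkE [dotp _ _]dotpC dotp_delta.
    by rewrite -/h; ring.
  rewrite big_distrr /= [dotp p h]/dotp mulr_suml big_distrr -sumrN -big_split /=.
  by apply: eq_bigr => i _; ring.
rewrite (le_trans (ler_normD _ _)) //; apply: lerD.
  rewrite normrN !normrM normfV (gtr0_norm v0) ger0_norm // ler_wpM2l ?mulr_ge0 //.
  rewrite ler_pdivrMr // (le_trans (dotp_le_enorm _ _)) // mulrC ler_wpM2l ?enorm_ge0 //.
  exact: enorm_slope.
rewrite normrM ger0_norm // ler_pM2l // ger0_norm; last by apply: sumr_ge0 => i _; exact: dotp_ge0.
rewrite -[n%:R]mulr1 mulr_natl -[X in _ *+ X](card_ord n) -sumr_const; apply: ler_sum => i _.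
by apply: (le_trans (frame_sqr _ _)); rewrite dotp_delta mxE !eqxx.
Qed.

(* Where the slope is large, the graph of [u] is nearly vertical, so that the
   vertical part of the gradient of the barrier survives on the graph. *)
Lemma barrier_Mjet (x0 : 'rV[R]_n) (D M0 L1 : R) : 0 < D -> 0 < M0 -> `|phi x| <= L1 ->
  enorm (x - x0) <= D -> 2 <= v -> 128 * M0 / D <= v ->
  exists b m, [/\ Mj (fun y => 1 - 2 / D ^+ 2 * dotp (y - x0) (y - x0) + (4 * M0)^-1 * (u y - u x0))
      (1 - 2 / D ^+ 2 * dotp (x - x0) (x - x0) + (4 * M0)^-1 * (u x - u x0)) b m,
    (32 * M0 ^+ 2)^-1 <= dotp b b &
    - (2 / D ^+ 2 * (2 * L1 * D + 2 * n%:R) + L1 / (4 * M0)) <= m].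
Proof.
move=> D0 M00 fL xD v2 vD.
have v0 : 0 < v := slope_gt0 p.
have qv : q = v ^+ 2 by rewrite /q -slope_sqr.
have L10 : 0 <= L1 := le_trans (normr_ge0 _) fL.
have [m H1 mb] := sqdist_Mjet x0.
have H2 := u_Mjet oO uC eqn Ox.
have cst c := Mjet_cst x (frame p) (phi x *: p) c.
have H := Mjet_D (Mjet_B (cst 1) (Mjet_Z (2 / D ^+ 2) H1)) (Mjet_Z (4 * M0)^-1 (Mjet_B H2 (cst (u x0)))).
pose h := x - x0; pose X : 'rV[R]_n := \row_k dotp h (frame p k).
exists (0 - (2 / D ^+ 2) *: (2 *: X) + (4 * M0)^-1 *: (v^-1 *: p - 0)).
exists (0 - 2 / D ^+ 2 * m + (4 * M0)^-1 * (phi x / v - 0)); split=> //.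
- pose a := 4 / D ^+ 2; pose c := (4 * M0 * v)^-1.
  have -> : 0 - (2 / D ^+ 2) *: (2 *: X) + (4 * M0)^-1 *: (v^-1 *: p - 0) = c *: p - a *: X.
    rewrite sub0r subr0 addrC !scalerA; congr (_ *: _ - _ *: _); rewrite /a /c ?invfM //; ring.
  rewrite !(dotpBl, dotpBr, dotpZl, dotpZr) [dotp X p]dotpC.
  have pX : dotp p X = dotp p h / v by rewrite /X frame_dot_p.
  rewrite pX dotp_slope -/v.
  have ph : `|dotp p h| <= v * D.
    rewrite (le_trans (dotp_le_enorm _ _)) // ler_pM ?enorm_ge0 //; exact: enorm_slope.
  have := barrier_real D0 M00 v2 vD (dotp_ge0 X) ph (erefl a) (erefl c).
  by congr (_ <= _); ring.
- have mb' : `|m| <= 2 * L1 * D + 2 * n%:R.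
    apply: (le_trans mb); rewrite lerD // ler_pM ?enorm_ge0 // ?mulr_ge0 //.
    by rewrite ler_pM2l.
  have t1 : 2 / D ^+ 2 * m <= 2 / D ^+ 2 * (2 * L1 * D + 2 * n%:R).
    by apply: ler_wpM2l; [rewrite divr_ge0 // exprn_ge0 // ltW|exact: le_trans (ler_norm _) mb'].
  have t2 : - (L1 / (4 * M0)) <= (4 * M0)^-1 * (phi x / v).
    have -> : - (L1 / (4 * M0)) = (4 * M0)^-1 * - L1 by ring.
    apply: ler_wpM2l; first by rewrite invr_ge0 mulr_ge0 // ltW.
    apply: lerNnormlW; rewrite normrM normfV (gtr0_norm v0) ler_pdivrMr //.
    by rewrite (le_trans fL) // ler_peMr //; lra.
  by lra.
Qed.

End Barrier.

Lemma dotp_sqr_prop {R : realType} {n : nat} (g P : 'rV[R]_n) (z q : R) : z != 0 -> q != 0 ->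
  z^-1 *: g + q^-1 *: P = 0 -> dotp g g * z ^- 2 = dotp P P / q ^+ 2.
Proof.
move=> z0 q0 /eqP; rewrite addr_eq0 => /eqP E.
have -> : g = - (z / q) *: P.
  by rewrite scaleNr -scalerA -scalerN -E scalerA divff // scale1r.
by rewrite dotpZl dotpZr; field; rewrite z0 q0.
Qed.

(** The sign of f_z permits dropping v f_z |p|^2, a term of order v^3 that nothing else could
    compensate. *)
Lemma slope_drift_ge {R : realType} {n : nat} (p fx : 'rV[R]_n) (fz L : R) : 0 <= fz -> enorm fx <= L ->
  - L * slope2 p <= slope p * dotp p (fx + fz *: p).
Proof.
move=> fz0 fxL; have v0 := slope_gt0 p.
have H : `|dotp p fx| <= slope p * L.
  by rewrite (le_trans (dotp_le_enorm _ _)) // ler_pM ?enorm_ge0 ?enorm_slope.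
have t1 : 0 <= slope p * (fz * dotp p p).
  by rewrite mulr_ge0 ?(ltW v0) // mulr_ge0 // dotp_ge0.
have t2 := ler_wpM2l (ltW v0) (lerNnormlW H).
rewrite dotpDr dotpZr [leRHS]mulrDr -(slope_sqr p) expr2; lra.
Qed.

(** Since z = e - 1 < e, the cut-off term is at least K (m + K B) >= L1 + 1, more than the loss L1
    from f_x. The square of the gradient of ln z, [T], is covered by the Bernstein term [S]. *)
Lemma interior_real {R : realFieldType} (L1 e z K c1 c2 B m T S W : R) : 0 < L1 -> 0 < e ->
  z = e - 1 -> 0 < z -> 1 <= K -> L1 + 1 <= K * c2 - c1 -> c2 <= B -> - c1 <= m ->
  T <= S -> - L1 <= W ->
  z^-1 * (K * e * m + 2 * (K ^+ 2 * e / 2) * B) + - T + (S + W) <= 0 -> False.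
Proof.
move=> L10 e0 zE z0 K1 Kc cB cm TS LW.
have K0 : 0 < K by lra.
have -> : K * e * m + 2 * (K ^+ 2 * e / 2) * B = (K * (m + K * B)) * e by field.
have H1 := ler_wpM2l (ltW K0) cB.
have H2 : L1 + 1 <= K * (m + K * B).
  have H3 : L1 + 1 <= m + K * B by lra.
  by apply: (le_trans H3); rewrite ler_peMl //; lra.
have H4 : L1 + 1 <= z^-1 * (K * (m + K * B) * e).
  rewrite mulrC ler_pdivlMr //; apply: ler_pM => //; lra.
lra.
Qed.

Section InteriorEstimate.
Context {R : realType}.

(** The barrier [bar] equals 1 at [x0] and is negative on the sphere of radius [D], so the product
    of z = exp(K bar) - 1 with the slope has its positive maximum over the ball at an inner point.
    There the slope is at most [V0], by contradiction, and comparing the maximum with the value at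
    [x0] gives the bound. *)
Lemma interior_estimate (n : nat) (del M0 L1 : R) : 0 < del -> 0 < M0 -> 0 < L1 ->
  exists2 V : R, 0 < V & forall (O : set 'rV[R]_n) (f : 'rV[R]_n -> R -> R) (u : 'rV[R]_n -> R) x0,
    open O -> f_conditions O M0 L1 f -> Ck 3 O u -> (forall x, O x -> `|u x| <= M0) ->
    (forall x, O x -> mean_curvature_op u x = f x (u x)) ->
    (forall y, enorm (y - x0) < del -> O y) -> enorm (grad u x0) <= V.
Proof.
move=> del0 M00 L10.
pose D := del / 2; have D0 : 0 < D by rewrite divr_gt0.
(* From [barrier_Mjet]: L bar >= -c1, and the squared length of the frame gradient of [bar] is at
   least c2. *)
pose c1 := 2 / D ^+ 2 * (2 * L1 * D + 2 * n%:R) + L1 / (4 * M0).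
pose c2 := (32 * M0 ^+ 2)^-1.
have c20 : 0 < c2 by rewrite invr_gt0 mulr_gt0 // exprn_gt0.
have c10 : 0 <= c1.
  apply: addr_ge0; last by rewrite divr_ge0 ?mulr_ge0 // ltW.
  apply: mulr_ge0; first by rewrite divr_ge0 // exprn_ge0 // ltW.
  by apply: addr_ge0; rewrite mulr_ge0 // ?(ltW D0) // mulr_ge0 // ltW.
(* The gradient term grows like K^2 and the loss from L bar like K; [K] makes the balance exceed L1
   by one. *)
have [K [K1 Kc]] : exists K, 1 <= K /\ L1 + 1 <= K * c2 - c1.
  exists ((c1 + L1 + 1) / c2 + 1); split.
    by rewrite lerDr divr_ge0 ?(ltW c20) //; lra.
  have -> : ((c1 + L1 + 1) / c2 + 1) * c2 - c1 = L1 + 1 + c2 by field; rewrite gt_eqF.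
  by rewrite lerDl ltW.
have [V0 [V02 V0D]] : exists V0, 2 <= V0 /\ 128 * M0 / D <= V0.
  exists (2 + 128 * M0 / D); rewrite lerDl lerDr; split=> //.
  by apply: divr_ge0 (ltW D0); rewrite mulr_ge0 // ltW.
have V00 : 0 < V0 by apply: lt_le_trans V02.
have K0 : 0 < K by apply: lt_le_trans K1.
have eK : 1 < expR K by rewrite expR_gt1.
have eK0 : 0 < expR K - 1 by lra.
(* The quotient of an upper bound for z, from bar <= 2, by z x0 = exp K - 1. *)
exists (expR (2 * K) * V0 / (expR K - 1)).
  by rewrite divr_gt0 // mulr_gt0 // expR_gt0.
move=> O f u x0 oO fc uC uM ueq ballO.
pose phi (y : 'rV[R]_n) := f y (u y).
pose bar (y : 'rV[R]_n) := 1 - 2 / D ^+ 2 * dotp (y - x0) (y - x0) + (4 * M0)^-1 * (u y - u x0).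
pose z (y : 'rV[R]_n) := expR (K * bar y) - 1.
pose F (y : 'rV[R]_n) := z y * slope (grad u y).
pose B : set 'rV[R]_n := [set y | dotp (y - x0) (y - x0) <= D ^+ 2].
have BO y : B y -> O y.
  move=> By; apply: ballO; apply: (@le_lt_trans _ _ D); last by rewrite /D; lra.
  by rewrite -(@ler_pXn2r _ 2) ?nnegrE ?enorm_ge0 ?(ltW D0) // enorm_sqr.
have Bx0 : B x0 by rewrite /B /= subrr dotp0l sqr_ge0.
have Ox0 := BO _ Bx0.
have du y : O y -> `|(4 * M0)^-1 * (u y - u x0)| <= 1 / 2.
  move=> Oy; rewrite normrM gtr0_norm ?invr_gt0 ?mulr_gt0 // mulrC ler_pdivrMr ?mulr_gt0 //.
  rewrite (le_trans (ler_normB _ _)) //; have := uM y Oy; have := uM x0 Ox0; lra.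
have barx0 : bar x0 = 1 by rewrite /bar !subrr dotp0l !mulr0 subr0 addr0.
have bar2 y : O y -> bar y <= 2.
  move=> Oy; rewrite /bar; have := le_trans (ler_norm _) (du y Oy).
  have : 0 <= 2 / D ^+ 2 * dotp (y - x0) (y - x0) by rewrite mulr_ge0 ?dotp_ge0 // divr_ge0 // sqr_ge0.
  by lra.
(* On the sphere bar <= 1 - 2 + 1/2 < 0, because the term in [u] is at most 1/2 in absolute
   value. *)
have barin y : O y -> B y -> 0 < bar y -> dotp (y - x0) (y - x0) < D ^+ 2.
  move=> Oy By b0; rewrite lt_neqAle By andbT; apply/negP => /eqP E; move: b0.
  rewrite /bar E divfK ?expf_neq0 ?gt_eqF //; have := le_trans (ler_norm _) (du y Oy).
  by rewrite ltNge => H; apply/negP; rewrite negbK; lra.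
have ucont y : O y -> {for y, continuous u}.
  by move=> Oy; exact: jet1_continuous (jet1_u oO uC Oy).
have Hj (y : 'rV[R]_n) i : jet1 setT (fun y : 'rV[R]_n => (y - x0) 0 i) y (delta_mx 0 i - 0).
  apply: jet1_ext_near (jet1_B (jet1_coord setT i y) (jet1_cst setT (x0 0 i) y)).
  by apply: filterE => w; rewrite vsubE.
have dj y := jet1_sum (fun i => jet1_M (Hj y i) (Hj y i)).
have dcont y : {for y, continuous (fun y : 'rV[R]_n => dotp (y - x0) (y - x0))}.
  exact: (jet1_continuous (dj y)).
have barj y : O y -> exists g, jet1 setT bar y g.
  move=> Oy; eexists; exact: (jet1_D (jet1_B (jet1_cst setT 1 y) (jet1_Z (2 / D ^+ 2) (dj y)))
    (jet1_Z (4 * M0)^-1 (jet1_B (jet1_u oO uC Oy) (jet1_cst setT (u x0) y)))).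
have zj y : O y -> exists g, jet1 setT z y g.
  move=> Oy; have [g gj] := barj y Oy; eexists.
  exact: (jet1_comp (f := bar) (h := fun s => expR (K * s) - 1) (J2_J1 (J2_expR_scaled K (bar y))) gj).
have zcont y : O y -> {for y, continuous z}.
  by move=> Oy; have [g gj] := zj y Oy; exact: jet1_continuous gj.
have Fcont y : O y -> {for y, continuous F}.
  move=> Oy; have [g gj] := zj y Oy.
  exact: (jet1_continuous (jet1_M gj (jet1_slope oO uC Oy))).
have [x] : exists2 c, c \in B & forall t, t \in B -> F t <= F c.
  apply: EVT_max_rV; first by exists x0.
    by apply: compact_enorm_ball; exact: ltW.
  apply/subspace_continuousP => y By; apply: cvg_within_filter; exact: Fcont (BO _ By).
rewrite inE => Bx Fmax.
have Ox := BO _ Bx.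
have Fx0 : F x0 <= F x by apply: Fmax; rewrite inE.
have z0E : z x0 = expR K - 1 by rewrite /z barx0 mulr1.
have zx0 : 0 < z x.
  have : 0 < F x by apply: lt_le_trans Fx0; rewrite /F z0E mulr_gt0 // slope_gt0.
  by rewrite /F pmulr_lgt0 // slope_gt0.
have barx : 0 < bar x.
  by move: zx0; rewrite /z subr_gt0 expR_gt1 pmulr_rgt0.
have zx2 : z x <= expR (2 * K).
  rewrite /z; apply: (@le_trans _ _ (expR (K * bar x))); first by rewrite gerBl.
  by rewrite ler_expR mulrC ler_pM2r // bar2.
have lnF y : 0 < z y -> ln (z y) + ln (slope2 (grad u y)) / 2 = ln (F y).
  move=> zy; have s0 := slope_gt0 (grad u y).
  rewrite /F lnM ?posrE // -slope_sqr lnXn // mulr2n; congr (_ + _); by field.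
have lnmax : \forall y \near x, ln (z y) + ln (slope2 (grad u y)) / 2 <= ln (z x) + ln (slope2 (grad u x)) / 2.
  have zpos : \forall y \near x, 0 < z y.
    by have /cvgr_gt/(_ _ zx0) := zcont x Ox.
  have Bn : \forall y \near x, B y.
    have := dcont x; move=> /cvgr_lt/(_ _ (barin x Ox Bx barx)).
    by apply: filterS => y; exact: ltW.
  apply: filterS2 zpos Bn => y zy By; rewrite (lnF _ zy) (lnF _ zx0).
  rewrite ler_ln; first by apply: Fmax; apply: mem_set.
    exact: mulr_gt0 zy (slope_gt0 _).
  exact: mulr_gt0 zx0 (slope_gt0 _).
suff vV0 : slope (grad u x) <= V0.
  rewrite ler_pdivlMr // mulrC -z0E; apply: (le_trans _ (le_trans Fx0 _)).
    rewrite /F ler_wpM2l ?z0E ?(ltW eK0) //; exact: enorm_slope.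
  by apply: ler_pM => //; [exact: ltW|rewrite ltW // slope_gt0].
rewrite leNgt; apply/negP => vV0.
set p := grad u x in vV0; set v := slope p in vV0; set q := slope2 p.
have v0 : 0 < v := slope_gt0 p.
have q0 : 0 < q := slope2_gt0 p.
have qv : v ^+ 2 = q := slope_sqr p.
have p0 : p != 0.
  apply/negP => /eqP p0; move: vV0.
  rewrite /v /slope /slope2 p0 dotp0l addr0 sqrtr1 ltNge => /negP; apply.
  by apply: le_trans V02; rewrite ler1n.
have uC1 : Ck 1 O u.
  case: uC => h1 h2; split=> s sk; [apply: h1|apply: h2]; exact: leq_trans sk _.
have uMx := grad_neq0_bound oO uC1 uM Ox p0.
have uMx' : - M0 <= u x <= M0 by case/andP: uMx => ? ?; rewrite !ltW.
have phid := f_jet oO fc Ox uMx (jet1_u oO uC Ox).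
have [fz0 fxL fL] := f_at fc Ox uMx'.
have xD : enorm (x - x0) <= D.
  by rewrite -(@ler_pXn2r _ 2) ?nnegrE ?enorm_ge0 ?(ltW D0) // enorm_sqr.
have v2 : 2 <= v := le_trans V02 (ltW vV0).
have vD : 128 * M0 / D <= v := le_trans V0D (ltW vV0).
have [b [m [bJ bb mb]]] := barrier_Mjet oO uC ueq Ox D0 M00 fL xD v2 vD.
have zJ := Mjet_comp (h := fun s => expR (K * s) - 1) (f := bar) (J2_expR_scaled K (bar x)) bJ.
have lnJ := Mjet_D (Mjet_comp (J2_ln zx0) zJ) (ln_slope_Mjet oO uC ueq Ox phid).
have [bE mE] := Mjet_max lnJ lnmax.
set e := expR (K * bar x) in bE mE.
have e0 : 0 < e by exact: expR_gt0.
have zxe : z x = e - 1 by [].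
set P := betap u x in bE mE; set S2 := beta_sqr u x in mE.
have PS : dotp P P <= q * S2 := betap_le u x.
(* At the maximum the frame gradients of ln z and of ln q / 2 are opposite, so the negative square
   produced by ln z equals |P|^2 / q^2. This is at most S2 / q, the Bernstein term. *)
have grE : dotp ((K * e) *: b) ((K * e) *: b) * (z x) ^- 2 = dotp P P / q ^+ 2.
  by apply: dotp_sqr_prop bE; rewrite gt_eqF.
have fxv : - L1 * q <= v * dotp p (f_x O M0 f x (u x) + f_z O M0 f x (u x) *: p).
  exact: slope_drift_ge.
have grS : dotp P P / q ^+ 2 <= S2 / q.
  rewrite ler_pdivrMr ?exprn_gt0 // (le_trans PS) // le_eqVlt; apply/orP; left; apply/eqP.
  by field; rewrite gt_eqF.
have t1 : - L1 <= v * dotp p (f_x O M0 f x (u x) + f_z O M0 f x (u x) *: p) / q.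
  by rewrite ler_pdivlMr.
move: mE; rewrite -/p -/q -/v -/S2 [(S2 + _) / q]mulrDl.
have -> : 2 * (- (z x) ^- 2 / 2) * dotp ((K * e) *: b) ((K * e) *: b) = - (dotp P P / q ^+ 2).
  by rewrite -grE; field; rewrite gt_eqF.
exact: (interior_real L10 e0 zxe zx0 K1 Kc bb mb grS t1).
Qed.

End InteriorEstimate.

(** * The domain near a boundary point *)

Section Boundary.
Context {R : realType} {n : nat}.
Implicit Types (A V : set 'rV[R]_n) (rho : 'rV[R]_n -> R) (x y e g : 'rV[R]_n).

Lemma Ck_le k k' A f : (k <= k')%N -> Ck k' A f -> Ck (R := R) (n := n) k A f.
Proof. by move=> kk [h1 h2]; split=> s sk; [apply: h1|apply: h2]; exact: leq_trans sk kk. Qed.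

Lemma local_defining_le k k' A V rho : (k <= k')%N -> local_defining k' A V rho ->
  local_defining k A V rho.
Proof. by move=> kk [oV C g0 h1 h2]; split=> //; exact: Ck_le kk C. Qed.

(** Strict differentiability at [x]: both points move. This is needed because the cone condition and
    the search for boundary points compare values of [rho] at points other than [x]. *)
Lemma strict_diff V rho x : open V -> Ck 1 V rho -> V x -> forall c : R, 0 < c ->
  exists2 d : R, 0 < d & forall y z, `|y - x| < d -> `|z - x| < d ->
    V y /\ `|rho z - rho y - dotp (grad rho x) (z - y)| <= c * `|z - y|.
Proof.
move=> oV C Vx c c0.
have k0 : 0 < n%:R + 1 :> R by rewrite ltr_wpDl.
have e0 : 0 < c / (n%:R + 1) by rewrite divr_gt0.
have cont : \forall y \near x, `|grad rho y - grad rho x| <= c / (n%:R + 1).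
  have : \forall y \near x, forall i, `|partial i rho x - partial i rho y| <= c / (n%:R + 1).
    apply: (@near_ord _ (nbhs x) _ n (fun i y => `|partial i rho x - partial i rho y| <= _)) => i.
    have ci : {for x, continuous (partial i rho)} by case: C => _ h; exact: (h [:: i]).
    by have /cvgrPdist_le := ci; apply.
  apply: filterS => y H; apply: norm_le_coord => [|i]; first exact: ltW.
  by rewrite !mxE distrC.
have [d1 d10 H1] := open_normP oV Vx.
have /near_normP[d2 d20 H2] := cont.
exists (Num.min d1 d2); first by rewrite lt_min d10.
move=> y z; rewrite !lt_min => /andP[y1 y2] /andP[z1 z2]; split; first exact: H1.
have seg (d t : R) : `|y - x| < d -> `|z - x| < d -> 0 <= t <= 1 -> `|y + t *: (z - y) - x| < d.
  move=> yd zd /andP[t0 t1].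
  have -> : y + t *: (z - y) - x = (1 - t) *: (y - x) + t *: (z - x).
    by apply/rowP => i; rewrite !mxE; ring.
  rewrite (le_lt_trans (ler_normD _ _)) // !normrZ (ger0_norm t0) ger0_norm ?subr_ge0 //.
  have [t1'|t1'] := eqVneq t 1; first by rewrite t1' subrr mul0r add0r mul1r.
  have : (1 - t) * `|y - x| < (1 - t) * d by rewrite ltr_pM2l // subr_gt0 lt_neqAle t1'.
  by have := ler_wpM2l t0 (ltW zd); lra.
have jet w : V w -> jet1 setT rho w (grad rho w).
  by move=> Vw; exact: (Ck_jet1 (s := [::]) C oV Vw (ltnSn _)).
have := @segment_bound R n V rho (grad rho) y z (grad rho x) (c / (n%:R + 1)) jet.
have cfin : n%:R * (c / (n%:R + 1)) * `|z - y| <= c * `|z - y|.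
  rewrite ler_wpM2r // mulrA ler_pdivrMr // mulrC ler_wpM2l ?(ltW c0) // lerDl //.
move=> H; apply: le_trans cfin; apply: H.
- by move=> t /andP[t0 t1]; apply: H1; apply: seg => //; rewrite !ltW.
- apply: within01_continuous => t t01.
  have Vt : V (y + t *: (z - y)) by apply: H1; exact: seg.
  have := jet1_line (z - y) (jet _ Vt); move=> L.
  apply: (@J1_continuous R (fun t => rho (y + t *: (z - y))) t (dotp (grad rho (y + t *: (z - y))) (z - y))).
  by apply: J1_ext L; apply: filterE => s; rewrite -addrA -scalerDl.
- by move=> t /andP[t0 t1]; apply: H2; apply: seg => //; rewrite !ltW.
Qed.

Lemma closure_open A y : open A -> closure A y -> A y \/ boundary A y.
Proof.
move=> oA Ay; have [Ay'|nAy] := pselect (A y); [by left|right; split=> //].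
by move/interior_subset.
Qed.

Lemma defining_ge0 A V rho y : open A -> local_defining 1 A V rho -> V y -> closure A y -> 0 <= rho y.
Proof.
move=> oA [_ _ _ E1 E2] Vy /(closure_open oA)[Ay|By].
  have : (V `&` A) y by []. by rewrite E1 => -[_ /ltW].
have : (V `&` boundary A) y by []. by rewrite E2 => -[_ /= ->].
Qed.

Lemma defining_in A V rho y : local_defining 1 A V rho -> V y -> 0 < rho y -> A y.
Proof.
move=> [_ _ _ E1 _] Vy ry; have : (V `&` [set y | 0 < rho y]) y by [].
by rewrite -E1 => -[].
Qed.

Lemma defining_bd A V rho y : local_defining 1 A V rho -> V y -> rho y = 0 -> boundary A y.
Proof.
move=> [_ _ _ _ E2] Vy ry; have : (V `&` [set y | rho y = 0]) y by [].
by rewrite -E2 => -[].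
Qed.

Lemma defining_at_bd A V rho x : local_defining 1 A V rho -> V x -> boundary A x -> rho x = 0.
Proof.
move=> [_ _ _ _ E2] Vx Bx; have : (V `&` boundary A) x by [].
by rewrite E2 => -[].
Qed.

(** On the closure rho >= 0. A step s e raises [rho] by about s a with a = D rho . e > 0, while
    strict differentiability and the perturbation z each cost at most s a / 4; the constants [c] and
    [r] are chosen for this. *)
Lemma defining_cone A V rho x e : open A -> local_defining 1 A V rho -> V x ->
  0 < dotp (grad rho x) e -> cone A x e.
Proof.
move=> oA LD Vx ge0; have [oV C g0 _ _] := LD.
set g := grad rho x in ge0 *; set a := dotp g e in ge0 *.
have N0 : 0 < `|e| + 1 by rewrite ltr_wpDl.
have c0 : 0 < a / (4 * (`|e| + 1)) by rewrite divr_gt0 // mulr_gt0.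
have [d d0 H] := strict_diff oV C Vx c0.
have G0 : 0 < n%:R * `|g| + 1 by rewrite ltr_wpDl // mulr_ge0.
pose c := Num.min 1 (a / (4 * (n%:R * `|g| + 1))).
have cpos : 0 < c by rewrite lt_min ltr01 divr_gt0 // mulr_gt0.
pose r := d / (2 * (`|e| + 2)).
have e20 : 0 < `|e| + 2 by lra.
have rpos : 0 < r by rewrite divr_gt0 // mulr_gt0.
have rd : r * (2 * (`|e| + 2)) = d by rewrite divfK // gt_eqF // mulr_gt0.
exists c, r; split=> // y s z Ay yx /andP[s0 sr] zs.
have c1 : c <= 1 by rewrite ge_min lexx.
have zs1 : `|z| <= s by apply: (le_trans zs); rewrite ler_piMl // ltW.
have yd : `|y - x| < d.
  apply: (lt_trans yx); rewrite -rd ltr_pMr //; have := normr_ge0 e; lra.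
have wN : `|s *: e + z| <= s * (`|e| + 1).
  rewrite (le_trans (ler_normD _ _)) // normrZ gtr0_norm // mulrDr mulr1 lerD //.
have wd : `|y + s *: e + z - x| < d.
  have -> : y + s *: e + z - x = (y - x) + (s *: e + z) by apply/rowP => i; rewrite !mxE; ring.
  rewrite (le_lt_trans (ler_normD _ _)) //; apply: (@lt_le_trans _ _ (r + r * (`|e| + 1))).
    by apply: ltr_leD => //; apply: (le_trans wN); rewrite ler_wpM2r ?(ltW N0) ?(ltW sr).
  rewrite -rd; have := ltW rpos; have := normr_ge0 e; nra.
have [Vy _] := H y y yd yd; have [Vw _] := H _ _ wd wd.
apply: (defining_in LD Vw).
have ry := defining_ge0 oA LD Vy Ay.
have [_] := H _ _ yd wd.
have -> : y + s *: e + z - y = s *: e + z by apply/rowP => i; rewrite !mxE; ring.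
rewrite ler_norml dotpDr dotpZr -/g -/a => /andP[K _].
have t1 : a / (4 * (`|e| + 1)) * `|s *: e + z| <= s * a / 4.
  apply: (le_trans (ler_wpM2l (ltW c0) wN)); rewrite le_eqVlt; apply/orP; left; apply/eqP.
  by field; rewrite gt_eqF.
have t2 : - (s * a / 4) <= dotp g z.
  apply: lerNnormlW; apply: (le_trans (dotp_le_norm _ _)).
  apply: (@le_trans _ _ ((n%:R * `|g| + 1) * (c * s))).
    by apply: ler_pM => //; rewrite ?mulr_ge0 // lerDl.
  have cc : c <= a / (4 * (n%:R * `|g| + 1)) by rewrite ge_min lexx orbT.
  have := ler_wpM2l (ltW (mulr_gt0 G0 s0)) cc.
  have -> : (n%:R * `|g| + 1) * s * (a / (4 * (n%:R * `|g| + 1))) = s * a / 4 by field; rewrite gt_eqF.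
  by lra.
have sa : 0 < s * a by rewrite mulr_gt0.
lra.
Qed.

(** The comparison points only have to follow the ray x + t v up to o(t). Curved sets such as the
    boundary can thus be used without a parametrization. *)
Lemma jet1_dir_le0 K f x G v : jet1 K f x G ->
  (forall c : R, 0 < c -> \forall t \near (0 : R), 0 < t ->
     exists y, [/\ K y, `|y - (x + t *: v)| <= c * t & f y <= f x]) ->
  dotp G v <= 0.
Proof.
move=> fj H; rewrite leNgt; apply/negP => Gv.
pose N := n%:R * `|G| + `|v| + 2.
have N0 : 0 < N by rewrite /N ltr_wpDl // addr_ge0 // mulr_ge0.
pose c := Num.min 1 (dotp G v / (4 * N)).
have c0 : 0 < c by rewrite lt_min ltr01 divr_gt0 // mulr_gt0.
have c1 : c <= 1 by rewrite ge_min lexx.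
have cN : c * (4 * N) <= dotp G v by rewrite -ler_pdivlMr ?mulr_gt0 // ge_min lexx orbT.
have /withinP/near_normP[d d0 L] := fj c c0.
have v20 : 0 < `|v| + 2 by rewrite ltr_wpDl.
have dv0 : 0 < d / (`|v| + 2) by rewrite divr_gt0.
have /nbhs_norm0P[r /= r0 M] : \forall t \near (0 : R), (0 < t ->
     exists y, [/\ K y, `|y - (x + t *: v)| <= c * t & f y <= f x]) /\ `|t| < d / (`|v| + 2).
  near=> t; split; near: t; [exact: H|exact: (@nbhs0_lt _ R)].
have r20 : 0 < r / 2 by rewrite divr_gt0.
have r2r : `|r / 2| < r by rewrite gtr0_norm //; lra.
have [/(_ r20)[y [Ky yt fy]]] := M (r / 2) r2r.
rewrite (gtr0_norm r20); set t := r / 2 in r20 yt *; rewrite ltr_pdivlMr // => td.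
have yx : `|y - x| <= t * (`|v| + 1).
  have -> : y - x = (y - (x + t *: v)) + t *: v by apply/rowP => i; rewrite !mxE; ring.
  rewrite (le_trans (ler_normD _ _)) // normrZ (gtr0_norm r20).
  have : c * t <= t by rewrite ler_piMl // ltW.
  lra.
have yd : `|y - x| < d by apply: (le_lt_trans yx); apply: le_lt_trans td; rewrite ler_pM2l //; lra.
have := L y yd Ky; rewrite ler_norml => /andP[K1 _].
have K2 : dotp G (y - x) = t * dotp G v + dotp G (y - (x + t *: v)).
  by rewrite -dotpZr -dotpDr; congr dotp; apply/rowP => i; rewrite !mxE; ring.
have K3 : - (n%:R * `|G| * (c * t)) <= dotp G (y - (x + t *: v)).
  apply: lerNnormlW; apply: (le_trans (dotp_le_norm _ _)); rewrite ler_wpM2l // mulr_ge0 //.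
have K4 : c * `|y - x| <= c * (t * (`|v| + 1)) by rewrite ler_pM2l.
have K5 : t * (c * (4 * N)) <= t * dotp G v by rewrite ler_pM2l.
have K6 : c * t * N = n%:R * `|G| * (c * t) + c * (t * (`|v| + 1)) + c * t by rewrite /N; ring.
have ct : 0 < c * t by rewrite mulr_gt0.
have ctN : 0 < c * t * N by rewrite mulr_gt0.
lra.
Unshelve. all: by end_near. Qed.

Lemma boundary_closure A x : boundary A x -> closure A x.
Proof. by case. Qed.

(** A substitute for the implicit function theorem. For tangential [v] the function [rho] at x + t v
    + s g equals s |g|^2 up to half of b t |g|^2, so it changes sign between s = -b t and s = b t.
    The intermediate value theorem gives a boundary point within c t of the ray. *)
Lemma tangential_max A V rho f x G v : open A -> local_defining 1 A V rho -> V x -> boundary A x ->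
  jet1 (closure A) f x G -> (\forall y \near x, boundary A y -> f y <= f x) ->
  dotp (grad rho x) v = 0 -> dotp G v <= 0.
Proof.
move=> oA LD Vx Bx fj fm gv; have [oV C g0 _ _] := LD.
set g := grad rho x in gv *.
have gg : 0 < dotp g g by apply: dotp_gt0; exact: g0.
apply: (jet1_dir_le0 fj) => c c0.
have G0 : 0 < `|g| + 1 by rewrite ltr_wpDl.
have V0 : 0 < `|v| + 1 by rewrite ltr_wpDl.
pose b := Num.min 1 (c / (`|g| + 1)).
have b0 : 0 < b by rewrite lt_min ltr01 divr_gt0.
have b1 : b <= 1 by rewrite ge_min lexx.
have bc : b * `|g| <= c.
  apply: (@le_trans _ _ (b * (`|g| + 1))); first by rewrite ler_pM2l // lerDl.
  by rewrite -ler_pdivlMr // ge_min lexx orbT.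
have N0 : 0 < `|v| + `|g| + 1 by rewrite ltr_wpDl // addr_ge0.
have k0 : 0 < b * dotp g g / (2 * (`|v| + `|g| + 1)) by rewrite divr_gt0 ?mulr_gt0.
have [d d0 H] := strict_diff oV C Vx k0.
have /near_normP[d1 d10 H1] := fm.
have D0 : 0 < Num.min d d1 / (`|v| + `|g| + 1) by rewrite divr_gt0 // lt_min d0.
near=> t => t0.
have tD : t * (`|v| + `|g| + 1) < Num.min d d1.
  rewrite -ltr_pdivlMr //; apply: (le_lt_trans (ler_norm _)); near: t; exact: (@nbhs0_lt _ R).
pose w (s : R) := x + t *: v + s *: g.
have wx (s : R) : - (b * t) <= s <= b * t -> `|w s - x| <= t * (`|v| + `|g|).
  have btt : b * t <= t by rewrite ler_piMl // ltW.
  move=> sb; have {}sb : `|s| <= t by rewrite ler_norml; case/andP: sb => *; apply/andP; split; lra.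
  have -> : w s - x = t *: v + s *: g by apply/rowP => i; rewrite !mxE; ring.
  rewrite (le_trans (ler_normD _ _)) // !normrZ (gtr0_norm t0) mulrDr lerD2l ler_wpM2r //.
have wd (s : R) : - (b * t) <= s <= b * t -> `|w s - x| < Num.min d d1.
  move=> sb; apply: (le_lt_trans (wx s sb)); apply: le_lt_trans tD; rewrite ler_pM2l //; lra.
have xx : `|x - x| < d by rewrite subrr normr0.
have wV s : - (b * t) <= s <= b * t -> V (w s) /\ `|rho (w s) - s * dotp g g| <= b * t * dotp g g / 2.
  move=> sb; have := wd s sb; rewrite lt_min => /andP[ws _].
  have [Vw _] := H _ _ ws ws; split=> //.
  have [_] := H _ _ xx ws; rewrite (defining_at_bd LD Vx Bx) subr0 -/g.
  have -> : dotp g (w s - x) = s * dotp g g.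
    have -> : w s - x = t *: v + s *: g by apply/rowP => i; rewrite !mxE; ring.
    by rewrite dotpDr !dotpZr gv mulr0 add0r.
  move=> K; apply: (le_trans K); apply: (@le_trans _ _ (b * dotp g g / (2 * (`|v| + `|g| + 1)) * (t * (`|v| + `|g| + 1)))).
    rewrite ler_pM2l // (le_trans (wx s sb)) // ler_pM2l //; lra.
  by rewrite le_eqVlt; apply/orP; left; apply/eqP; field; rewrite gt_eqF.
have bt0 : 0 < b * t by rewrite mulr_gt0.
have [s sb rs] : exists2 s, - (b * t) <= s <= b * t & rho (w s) = 0.
  have cont : {within `[- (b * t), b * t], continuous (rho \o w)}.
    apply/subspace_continuousP => s; rewrite /= in_itv /= => sb.
    apply: cvg_within_filter.
    have [Vw _] := wV s sb.
    have := jet1_line g (Ck_jet1 (s := [::]) C oV Vw (ltnSn _)) => L.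
    apply: (@J1_continuous R (rho \o w) s (dotp (\row_i partials [:: i] rho (w s)) g)).
    by apply: J1_ext L; apply: filterE => r; rewrite /= /w -[in RHS]addrA [in RHS]scalerDl !addrA.
  have lo : rho (w (- (b * t))) <= 0.
    have I : - (b * t) <= - (b * t) <= b * t by rewrite lexx; lra.
    have [_] := wV _ I.
    by rewrite ler_norml => /andP[_]; have := mulr_gt0 bt0 gg; lra.
  have hi : 0 <= rho (w (b * t)).
    have I : - (b * t) <= b * t <= b * t by rewrite lexx andbT; lra.
    have [_] := wV _ I.
    by rewrite ler_norml => /andP[+ _]; have := mulr_gt0 bt0 gg; lra.
  have ab : - (b * t) <= b * t by lra.
  have mm : Num.min ((rho \o w) (- (b * t))) ((rho \o w) (b * t)) <= 0 <=
            Num.max ((rho \o w) (- (b * t))) ((rho \o w) (b * t)).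
    by rewrite /= ge_min le_max lo hi orbT.
  by have [s] := IVT ab cont mm; rewrite in_itv /= => sb rs; exists s.
have [Vw _] := wV s sb.
have Bw := defining_bd LD Vw rs.
exists (w s); split.
- exact: boundary_closure.
- have -> : w s - (x + t *: v) = s *: g by apply/rowP => i; rewrite !mxE; ring.
  rewrite normrZ; apply: (@le_trans _ _ (b * t * `|g|)).
    by rewrite ler_wpM2r // ler_norml.
  by rewrite mulrAC ler_wpM2r // ltW.
- by apply: H1 => //; have := wd s sb; rewrite lt_min => /andP[].
Unshelve. all: by end_near. Qed.

Lemma tangential_eq A V rho f x G v : open A -> local_defining 1 A V rho -> V x -> boundary A x ->
  jet1 (closure A) f x G -> (\forall y \near x, boundary A y -> f y <= f x) ->
  dotp (grad rho x) v = 0 -> dotp G v = 0.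
Proof.
move=> oA LD Vx Bx fj fm gv; apply/eqP; rewrite eq_le (tangential_max oA LD Vx Bx fj fm gv) /=.
have gv' : dotp (grad rho x) (- v) = 0 by rewrite dotpNr gv oppr0.
by have := tangential_max oA LD Vx Bx fj fm gv'; rewrite dotpNr oppr_le0.
Qed.

Lemma cone_near A x e : closure A x -> cone A x e -> \forall t \near (0 : R), 0 < t -> A (x + t *: e).
Proof.
move=> Ax [c [r [c0 r0 H]]]; near=> t => t0.
have tr : `|t| < r by near: t; exact: (@nbhs0_lt _ R).
rewrite -[_ + _]addr0; apply: H => //; rewrite ?subrr ?normr0 ?mulr_ge0 ?(ltW c0) ?(ltW t0) //.
by rewrite t0 /= (le_lt_trans (ler_norm _)).
Unshelve. all: by end_near. Qed.

Lemma cone_max_le0 A f x G e : closure A x -> cone A x e -> jet1 (closure A) f x G ->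
  (\forall y \near x, A y -> f y <= f x) -> dotp G e <= 0.
Proof.
move=> Ax Ce fj fm; apply: (jet1_dir_le0 fj) => c c0.
have h1 := cone_near Ax Ce; have h2 := @near_line R n x e (fun y => A y -> f y <= f x) fm.
near=> t => t0; have At : A (x + t *: e) by move: t0; near: t.
exists (x + t *: e); split; [exact: subset_closure| |].
  by rewrite subrr normr0 mulr_ge0 // ltW.
by move: At; near: t.
Unshelve. all: by end_near. Qed.

Lemma dotp_unit_lt1 (a b : 'rV[R]_n) : dotp a a = 1 -> dotp b b = 1 -> a != b -> dotp a b < 1.
Proof.
move=> aa bb; rewrite -subr_eq0 => /dotp_gt0.
by rewrite dotpBl !dotpBr aa bb (dotpC b a) => h; clear -h; lra.
Qed.

Lemma unit_direction (g : 'rV[R]_n) : g != 0 -> exists a, [/\ (enorm g)^-1 *: g = a,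
  dotp a a = 1, 0 < enorm g & g = enorm g *: a].
Proof.
move=> /enorm_gt0 g0; exists ((enorm g)^-1 *: g); split=> //.
  by rewrite dotpZl dotpZr -enorm_sqr expr2 mulKf ?mulVf // gt_eqF.
by rewrite scalerA divff ?scale1r // gt_eqF.
Qed.

(** If the unit gradients a and b differed, the direction a - b would point into the domain by the
    cone condition for [rho], while rho' would decrease along it since b . (a - b) < 0. But rho' is
    nonnegative in the domain and vanishes at [x]. *)
Lemma normal_unique A V rho V' rho' x : open A -> boundary A x ->
  local_defining 1 A V rho -> V x -> local_defining 1 A V' rho' -> V' x ->
  (enorm (grad rho x))^-1 *: grad rho x = (enorm (grad rho' x))^-1 *: grad rho' x.
Proof.
move=> oA Bx LD Vx LD' V'x; have [oV C g0 _ _] := LD; have [oV' C' g0' _ _] := LD'.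
have [a [-> aa n0 ga]] := unit_direction (g0 x Vx).
have [b [-> bb n0' gb]] := unit_direction (g0' x V'x).
apply/eqP/negPn/negP => /(dotp_unit_lt1 aa bb) ab1.
have ge : 0 < dotp (grad rho x) (a - b).
  by rewrite ga dotpZl pmulr_rgt0 // dotpBr aa subr_gt0.
have Ce := defining_cone oA LD Vx ge.
have j' : jet1 setT (fun y => -1 * rho' y) x (-1 *: grad rho' x).
  by apply: jet1_Z; exact: (Ck_jet1 (s := [::]) C' oV' V'x (ltnSn _)).
have := cone_max_le0 (boundary_closure Bx) Ce (jet1T (closure A) j').
have fm : \forall y \near x, A y -> -1 * rho' y <= -1 * rho' x.
  have := open_nbhs_nbhs (conj oV' V'x); apply: filterS => y V'y Ay.
  rewrite (defining_at_bd LD' V'x Bx) mulr0 mulN1r oppr_le0.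
  by apply: (defining_ge0 oA LD' V'y); exact: subset_closure.
move=> /(_ fm); rewrite gb dotpZl dotpZl dotpBr bb (dotpC b a).
by rewrite mulN1r oppr_le0 pmulr_rge0 // subr_ge0 leNgt ab1.
Qed.

(** The strict bounds on [z] matter: the cone direction has no z-component, so on the top or bottom
    of the cylinder it would not lead inside. *)
Lemma cyl_cone A x z M0 e : cone A x e -> - M0 < z < M0 -> cone (cyl A M0) (pt x z) (pt e 0).
Proof.
move=> [c [r [c0 r0 H]]] /andP[z1 z2].
pose m := Num.min (z + M0) (M0 - z).
have m0 : 0 < m by rewrite lt_min subr_gt0 z2 -(opprK M0) subr_gt0 z1.
pose c' := Num.min c 1; pose r' := Num.min r (m / 2).
have c'0 : 0 < c' by rewrite lt_min c0 ltr01.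
have r'0 : 0 < r' by rewrite lt_min r0 divr_gt0.
exists c', r'; split=> // y s w Cy yx /andP[s0 sr] ws.
have lcl : closure A (lsubmx y).
  move=> B /near_normP[d d0 HB].
  have [p [[Ap _] Bp]] : cyl A M0 `&` [set p | `|p - y| < d] !=set0.
    by apply: Cy; apply/near_normP; exists d.
  exists (lsubmx p); split=> //; apply: HB; rewrite -linearB /=.
  exact: le_lt_trans (lsubmx_norm _) Bp.
have yE : y = pt (lsubmx y) (rsubmx y 0 0).
  rewrite -[LHS]hsubmxK /pt; congr row_mx; apply/matrixP => i j.
  by rewrite !ord1 [RHS]mxE eqxx mulr1n.
have yx' : `|lsubmx y - x| < r /\ `|rsubmx y 0 0 - z| < m / 2.
  move: yx; rewrite lt_min => /andP[h1 h2]; split.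
    apply: le_lt_trans h1; have := lsubmx_norm (y - pt x z).
    by rewrite linearB /= lsubmx_pt.
  apply: le_lt_trans h2; have := rsubmx_norm (y - pt x z).
  by rewrite {1}yE ptB rsubmx_pt.
have [yx1 yx2] := yx'.
move: sr; rewrite lt_min => /andP[sr1 sr2].
split.
  rewrite !linearD /= linearZ /= lsubmx_pt; apply: H => //; first by rewrite s0.
  apply: (le_trans (lsubmx_norm _)); apply: (le_trans ws); rewrite ler_wpM2r ?(ltW s0) //.
  by rewrite ge_min lexx.
have -> : rsubmx (y + s *: pt e 0 + w) 0 0 = rsubmx y 0 0 + rsubmx w 0 0.
  have e0 : rsubmx (pt e (0 : R)) 0 0 = 0 by rewrite rsubmx_pt.
  by move: e0; rewrite !mxE => ->; rewrite mulr0 addr0.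
have wz : `|rsubmx w 0 0| < m / 2.
  apply: (le_lt_trans (rsubmx_norm _)); apply: (le_lt_trans ws); apply: le_lt_trans sr2.
  by rewrite ler_piMl ?(ltW s0) // ge_min lexx orbT.
have : m <= z + M0 by rewrite ge_min lexx. have : m <= M0 - z by rewrite ge_min lexx orbT.
move: yx2 wz; rewrite !ltr_norml => /andP[? ?] /andP[? ?] *.
by apply/andP; split; lra.
Qed.

End Boundary.

(** * The distance to the boundary *)

Section Distance.
Context {R : realType} {n : nat}.
Implicit Types (A B K : set 'rV[R]_n) (x y z e : 'rV[R]_n).

Lemma compact_bound K (f : 'rV[R]_n -> R) : compact K -> (forall x, K x -> {for x, continuous f}) ->
  exists2 C : R, 0 < C & forall x, K x -> `|f x| <= C.
Proof.
move=> cK cf; have [K0|/set0P/negP/negPn/eqP K0] := pselect (K !=set0); last first.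
  by exists 1 => // x; rewrite K0.
have [|c _ H] := @EVT_max_rV R n (fun x => `|f x|) K K0 cK.
  apply/subspace_continuousP => y Ky; apply: cvg_within_filter.
  by apply: cvg_norm; exact: cf.
exists (`|f c| + 1); first by rewrite ltr_wpDl.
by move=> x Kx; apply: ler_wpDr => //; apply: H; rewrite inE.
Qed.

Lemma dist_le A B x y : A x -> B y -> dist A B <= enorm (x - y).
Proof.
move=> Ax By; apply: ge_inf; last by exists (x, y).
by exists 0 => _ [p _ <-]; exact: enorm_ge0.
Qed.

Lemma le_dist A B (c : R) : A !=set0 -> B !=set0 ->
  (forall x y, A x -> B y -> c <= enorm (x - y)) -> c <= dist A B.
Proof.
move=> [a Aa] [b Bb] H; apply: lb_le_inf; first by exists (enorm (a - b)), (a, b).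
by move=> _ [p [Ap Bp] <-]; exact: H.
Qed.

(** The first exit point, at the supremum of the parameters up to which the segment stays in [A]; it
    is outside the open set [A] but a limit of points of [A]. *)
Lemma segment_boundary A x y : open A -> A x -> ~ A y ->
  exists2 t : R, 0 <= t <= 1 & boundary A (x + t *: (y - x)).
Proof.
move=> oA Ax nAy; pose p (t : R) := x + t *: (y - x).
pose E := [set t : R | 0 <= t <= 1 /\ forall r, 0 <= r <= t -> A (p r)].
have E0 : E 0.
  split; first by rewrite lexx ler01.
  by move=> r /le_anti <-; rewrite /p scale0r addr0.
have Eub : has_ubound E by exists 1 => t [/andP[]].
have Esup : has_sup E by split=> //; exists 0.
have s0 : 0 <= sup E by exact: ub_le_sup.
have s1 : sup E <= 1 by apply: ge_sup; [exists 0|move=> t [/andP[]]].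
have below r : 0 <= r < sup E -> A (p r).
  move=> /andP[r0 rs]; have d0 : 0 < sup E - r by rewrite subr_gt0.
  have [t [_ H]] := sup_adherent d0 Esup; rewrite subKr => rt.
  by apply: H; rewrite r0 ltW.
have nAs : ~ A (p (sup E)).
  move=> As; have [e e0 H] := open_normP oA As.
  have N0 : 0 < `|y - x| + 1 by rewrite ltr_wpDl.
  pose d := e / (`|y - x| + 1).
  have d0 : 0 < d by rewrite divr_gt0.
  have near_s r : `|r - sup E| < d -> A (p r).
    move=> rs; apply: H; have -> : p r - p (sup E) = (r - sup E) *: (y - x).
      by rewrite /p opprD addrACA subrr add0r scalerBl.
    rewrite normrZ; apply: (@le_lt_trans _ _ (`|r - sup E| * (`|y - x| + 1))).
      by rewrite ler_wpM2l // lerDl.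
    by rewrite -ltr_pdivlMr.
  pose t := Num.min 1 (sup E + d / 2).
  have d20 : 0 < d / 2 by rewrite divr_gt0.
  have dd : d / 2 < d by rewrite ltr_pdivrMr // ltr_pMr // ltr1n.
  have Et : E t.
    split; first by rewrite le_min ler01 addr_ge0 ?(ltW d20) //= ge_min lexx.
    move=> r /andP[r0]; rewrite le_min => /andP[r1 rs].
    have [rs'|rs'] := ltP r (sup E); first by apply: below; rewrite r0.
    by apply: near_s; rewrite ger0_norm ?subr_ge0 //; lra.
  have : t <= sup E by exact: ub_le_sup.
  rewrite ge_min => /orP[h|]; last by rewrite gerDl leNgt d20.
  have sE : sup E = 1 by apply/le_anti; rewrite s1.
  by apply: nAy; move: As; rewrite sE /p scale1r addrC subrK.
exists (sup E); first by rewrite s0.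
split; last by move=> /interior_subset.
move=> U /near_normP[d d0 HU].
have N0 : 0 < `|y - x| + 1 by rewrite ltr_wpDl.
pose d' := d / (`|y - x| + 1).
have d'0 : 0 < d' by rewrite divr_gt0.
have [t [t01 Ht]] := sup_adherent d'0 Esup; rewrite ltrBlDl => ts.
have tle : t <= sup E by apply: ub_le_sup.
exists (p t); split; first by apply: Ht; case/andP: t01 => -> _; rewrite lexx.
apply: HU; have -> : p t - p (sup E) = (t - sup E) *: (y - x).
  by rewrite /p opprD addrACA subrr add0r scalerBl.
rewrite normrZ distrC ger0_norm ?subr_ge0 //.
apply: (@le_lt_trans _ _ ((sup E - t) * (`|y - x| + 1))).
  by rewrite ler_wpM2l ?subr_ge0 // lerDl.
by rewrite -ltr_pdivlMr // -/d'; lra.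
Qed.

Lemma bounded_setP A : bounded_set A -> exists2 B : R, 0 < B & forall x, A x -> `|x| <= B.
Proof.
move=> [M [_ H]]; exists (`|M| + 1); first by rewrite ltr_wpDl.
by move=> x Ax; apply: (H (`|M| + 1)) => //; rewrite (le_lt_trans (ler_norm _)) // ltrDl.
Qed.

(** A nonempty boundary keeps the infimum in [dist] from taking its default value on the empty
    set. *)
Lemma boundary_nonempty A : (0 < n)%N -> open A -> A !=set0 -> bounded_set A -> boundary A !=set0.
Proof.
move=> n0 oA [x Ax] /bounded_setP[B B0 HB].
pose e := delta_mx 0 (Ordinal n0) : 'rV[R]_n.
pose y := (B + 1) *: e.
have nAy : ~ A y.
  move=> /HB; have := coord_le_norm y (Ordinal n0).
  rewrite !mxE !eqxx mulr1 gtr0_norm; last by rewrite ltr_wpDl // ltW.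
  by lra.
by have [t _ H] := segment_boundary oA Ax nAy; exists (x + t *: (y - x)).
Qed.

Lemma bounded_closure A : bounded_set A -> exists2 B : R, 0 < B & forall x, closure A x -> `|x| <= B.
Proof.
move=> /bounded_setP[B B0 HB]; exists (B + 1); first by rewrite ltr_wpDl // ltW.
move=> x Ax; have : \forall y \near x, `|y - x| < 1.
  by apply/near_normP; exists 1.
move=> /Ax[y [/HB yB yx]].
rewrite -[x](subrK y) addrC (le_trans (ler_normD _ _)) // lerD // distrC.
exact: ltW.
Qed.

Lemma compact_closure A : bounded_set A -> compact (closure A).
Proof.
move=> /bounded_closure[B B0 HB]; apply: bounded_closed_compact; last exact: closed_closure.
exists B; split; first exact: num_real.
by move=> M BM x /HB xB; exact: le_trans xB (ltW BM).
Qed.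

Lemma compact_boundary A : open A -> bounded_set A -> compact (boundary A).
Proof.
move=> oA /compact_closure cA; apply: (subclosed_compact _ cA) => [|x []//].
apply: closedI; first exact: closed_closure.
by apply: open_closedC; exact: open_interior.
Qed.

Lemma bdist_le A x y : boundary A y -> bdist A x <= enorm (x - y).
Proof. by move=> By; apply: dist_le. Qed.

Lemma bdist_lt A x (m : R) : boundary A !=set0 -> bdist A x < m ->
  exists2 y, boundary A y & enorm (x - y) < m.
Proof.
move=> [b Bb] /inf_lt[|_ [[p1 p2] /= [-> Bp] <-] H]; last by exists p2.
by exists (enorm (x - b)), (x, b).
Qed.

Lemma le_bdist A x (c : R) : boundary A !=set0 -> (forall y, boundary A y -> c <= enorm (x - y)) ->
  c <= bdist A x.
Proof. by move=> B0 H; apply: le_dist => //; [exists x|move=> _ y -> /H]. Qed.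

Lemma bdist_ball A x y : open A -> A x -> enorm (y - x) < bdist A x -> A y.
Proof.
move=> oA Ax yx; apply/not_notP => nAy.
have [t /andP[t0 t1] B] := segment_boundary oA Ax nAy.
have := bdist_le x B; rewrite leNgt => /negP; apply; apply: le_lt_trans yx.
by rewrite opprD addrA subrr add0r enormN enormZ ger0_norm // ler_piMl // enorm_ge0.
Qed.

Lemma bdist_lip A x y : boundary A !=set0 -> bdist A x <= bdist A y + enorm (x - y).
Proof.
move=> B0; rewrite -lerBlDr; apply: le_bdist => // z Bz.
rewrite lerBlDr (le_trans (bdist_le x Bz)) // [leRHS]addrC.
have -> : x - z = (x - y) + (y - z) by rewrite addrA subrK.
exact: enormD.
Qed.

Lemma bdist_continuous A x : boundary A !=set0 -> {for x, continuous (bdist A)}.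
Proof.
move=> B0; apply/(@cvgrPdist_le _ _ _ (nbhs x)) => e e0.
have N0 : 0 < n%:R + 1 :> R by rewrite ltr_wpDl.
apply/near_normP; exists (e / (n%:R + 1)); first by rewrite divr_gt0.
move=> y; rewrite ltr_pdivlMr // => yx.
have exy : enorm (x - y) <= e.
  apply: (le_trans (enorm_le_norm _)); apply: le_trans (ltW yx).
  by rewrite distrC mulrC ler_wpM2l // lerDl.
have := bdist_lip x y B0; have := bdist_lip y x B0.
rewrite -[y - x]opprB enormN => h1 h2; rewrite ler_norml; apply/andP; split; lra.
Qed.

End Distance.

(** * Extending the normal to a collar *)

(** The cube is the least integer power of the positive part that has second-order expansions
    everywhere; the remainder is uniformly cubic, also across the kink. *)
Lemma cube_pos_ineq {R : realDomainType} (c s : R) :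
  `|Num.max 0 (c + s) ^+ 3 - (Num.max 0 c ^+ 3 + 3 * Num.max 0 c ^+ 2 * s + 3 * Num.max 0 c * s ^+ 2)|
    <= `|s| ^+ 3.
Proof.
have [c0|c0] := lerP 0 c; have [cs|cs] := lerP 0 (c + s).
- by rewrite -normrX (_ : _ - _ = s ^+ 3) //; ring.
- have -> : 0 ^+ 3 - (c ^+ 3 + 3 * c ^+ 2 * s + 3 * c * s ^+ 2) = s ^+ 3 - (c + s) ^+ 3 by ring.
  have s0 : s < 0 by lra.
  have h1 : (c + s) ^+ 3 <= 0 by rewrite exprS mulr_le0_ge0 ?sqr_ge0 // ltW.
  have h2 : s ^+ 3 <= (c + s) ^+ 3.
    have : 0 <= c * (3 * s ^+ 2 + 3 * s * c + c ^+ 2) by rewrite mulr_ge0 //; nra.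
    lra.
  rewrite (ltr0_norm s0) ler0_norm ?subr_le0 // exprNn -signr_odd /= expr1 mulN1r; lra.
- have h1 : 0 <= (c + s) ^+ 3 by rewrite exprn_ge0.
  have s0 : 0 < s by lra.
  have h2 : (c + s) ^+ 3 <= s ^+ 3 by rewrite lerXn2r ?nnegrE ?(ltW s0) //; lra.
  rewrite (gtr0_norm s0) ger0_norm; lra.
- by rewrite !(expr0n, mulr0, mul0r, addr0, subr0) /= normr0 exprn_ge0.
Qed.

Lemma J2_cube_pos {R : realType} (c : R) :
  J2 (fun s => Num.max 0 (c + s) ^+ 3) (Num.max 0 c ^+ 3) (3 * Num.max 0 c ^+ 2) (3 * Num.max 0 c).
Proof.
move=> e e0; have := osmall_t3 e0; apply: filterS => s; rewrite normrX => H.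
exact: le_trans (cube_pos_ineq c s) H.
Qed.

Section Nice.
Context {R : realType} {n : nat}.
Implicit Types (D : set 'rV[R]_n) (f h : 'rV[R]_n -> R) (x y z e : 'rV[R]_n).

(* A substitute for a C^2 bound at [x] that asks for second-order expansions
   only along lines. *)
Definition nice (C : R) f x := exists g, [/\ jet1 setT f x g, `|f x| <= C, `|g| <= C &
  forall e, `|e| <= 2 -> exists2 a : R, `|a| <= C & J2 (fun t => f (x + t *: e)) (f x) (dotp g e) a].

Definition ubd D f := exists2 C : R, 0 <= C & forall x, D x -> nice C f x.

Lemma nice_le C C' f x : C <= C' -> nice C f x -> nice C' f x.
Proof.
move=> CC [g [h1 h2 h3 h4]]; exists g; split=> //; rewrite ?(le_trans _ CC) //.
by move=> e /h4[a aC aJ]; exists a => //; exact: le_trans aC CC.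
Qed.

Lemma nice_ext C f h x : (\forall y \near x, f y = h y) -> nice C f x -> nice C h x.
Proof.
move=> fh [g [h1 h2 h3 h4]]; have fhx : f x = h x := nbhs_singleton fh.
exists g; split=> //; rewrite -?fhx //; first exact: jet1_ext_near h1.
move=> e /h4[a aC aJ]; exists a => //; apply: J2_ext aJ.
exact: (near_line e fh).
Qed.

Lemma ubd_ext D f h : f =1 h -> ubd D f -> ubd D h.
Proof. by move=> /funext ->. Qed.

Lemma ubd_sub D D' f : D `<=` D' -> ubd D' f -> ubd D f.
Proof. by move=> DD [C C0 H]; exists C => // x /DD /H. Qed.

Lemma ubd_setU D D' f : ubd D f -> ubd D' f -> ubd (D `|` D') f.
Proof.
move=> [C C0 H] [C' C'0 H']; exists (Num.max C C'); first by rewrite le_max C0.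
move=> x [/H|/H']; apply: nice_le; first by rewrite le_max lexx.
by rewrite le_max lexx orbT.
Qed.

Lemma ubd_cst D (c : R) : ubd D (fun=> c).
Proof.
exists `|c| => // x _; exists 0; split=> //; first exact: jet1_cst.
  by rewrite normr0.
by move=> e _; exists 0; [rewrite normr0|rewrite dotp0l; exact: J2_cst].
Qed.

Lemma ubd_common D f h : ubd D f -> ubd D h ->
  exists2 C : R, 0 <= C & forall x, D x -> nice C f x /\ nice C h x.
Proof.
move=> [C C0 H] [C' C'0 H']; exists (Num.max C C'); first by rewrite le_max C0.
move=> x Dx; split; [have := H x Dx|have := H' x Dx]; apply: nice_le.
  by rewrite le_max lexx.
by rewrite le_max lexx orbT.
Qed.

Lemma ubd_D D f h : ubd D f -> ubd D h -> ubd D (fun x => f x + h x).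
Proof.
move=> uf uh; have [C C0 H] := ubd_common uf uh.
exists (C + C) => [|x /H[[g [h1 h2 h3 h4]] [g' [h1' h2' h3' h4']]]]; first by rewrite addr_ge0.
exists (g + g'); split; first exact: jet1_D.
- by rewrite (le_trans (ler_normD _ _)) // lerD.
- by rewrite (le_trans (ler_normD _ _)) // lerD.
move=> e e2; have [a aC aJ] := h4 e e2; have [a' aC' aJ'] := h4' e e2.
exists (a + a'); first by rewrite (le_trans (ler_normD _ _)) // lerD.
by rewrite dotpDl; exact: J2_D.
Qed.

Lemma dotp_le2 (g e : 'rV[R]_n) (C : R) : `|g| <= C -> `|e| <= 2 -> `|dotp g e| <= 2 * n%:R * C.
Proof.
move=> gC e2; apply: (le_trans (dotp_le_norm _ _)); rewrite mulrC mulrA.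
by rewrite -!mulrA ler_pM ?mulr_ge0 // ler_wpM2l.
Qed.

Lemma ubd_M D f h : ubd D f -> ubd D h -> ubd D (fun x => f x * h x).
Proof.
move=> uf uh; have [C C0 H] := ubd_common uf uh.
have K0 : 0 <= 2 * n%:R * C by rewrite !mulr_ge0.
exists (C * C + C * C + (2 * n%:R * C) * (2 * n%:R * C)).
  by rewrite !addr_ge0 ?mulr_ge0.
have CC0 : 0 <= C * C by rewrite mulr_ge0.
have KK0 : 0 <= (2 * n%:R * C) * (2 * n%:R * C) by rewrite mulr_ge0.
move=> x /H[[g [h1 h2 h3 h4]] [g' [h1' h2' h3' h4']]].
exists (f x *: g' + h x *: g); split; first exact: jet1_M.
- rewrite normrM; have : `|f x| * `|h x| <= C * C by rewrite ler_pM.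
  lra.
- rewrite (le_trans (ler_normD _ _)) // !normrZ.
  have : `|f x| * `|g'| <= C * C by rewrite ler_pM.
  have : `|h x| * `|g| <= C * C by rewrite ler_pM.
  lra.
move=> e e2; have [a aC aJ] := h4 e e2; have [a' aC' aJ'] := h4' e e2.
exists (f x * a' + h x * a + dotp g e * dotp g' e); last first.
  by rewrite dotpDl !dotpZl; exact: J2_M.
rewrite (le_trans (ler_normD _ _)) // !normrM.
rewrite lerD //; last by rewrite ler_pM // dotp_le2.
by rewrite (le_trans (ler_normD _ _)) // lerD // normrM ler_pM.
Qed.

Lemma ubd_comp D f (h : R -> R) : ubd D f ->
  (exists2 C : R, 0 <= C & forall x, D x -> exists h1 h2 : R,
     [/\ J2 (fun s => h (f x + s)) (h (f x)) h1 h2, `|h (f x)| <= C, `|h1| <= C & `|h2| <= C]) ->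
  ubd D (fun x => h (f x)).
Proof.
move=> [C C0 H] [C' C'0 H'].
have K0 : 0 <= 2 * n%:R * C by rewrite !mulr_ge0.
have P1 : 0 <= C' * C by rewrite mulr_ge0.
have P2 : 0 <= C' * (2 * n%:R * C) ^+ 2 by rewrite mulr_ge0 // exprn_ge0.
exists (C' + C' * C + C' * (2 * n%:R * C) ^+ 2); first by rewrite !addr_ge0.
move=> x Dx; have [g [h1 h2 h3 h4]] := H x Dx.
have [d1 [d2 [hJ hC d1C d2C]]] := H' x Dx.
exists (d1 *: g); split.
- by apply: (jet1_comp (h := h)) h1; exact: J2_J1 hJ.
- lra.
- rewrite normrZ; have : `|d1| * `|g| <= C' * C by rewrite ler_pM.
  lra.
move=> e e2; have [a aC aJ] := h4 e e2.
exists (d1 * a + d2 * dotp g e ^+ 2); last by rewrite dotpZl; exact: J2_comp hJ aJ.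
rewrite (le_trans (ler_normD _ _)) // normrM normrM normrX.
have : `|d1| * `|a| <= C' * C by rewrite ler_pM.
have : `|d2| * `|dotp g e| ^+ 2 <= C' * (2 * n%:R * C) ^+ 2.
  by rewrite ler_pM ?exprn_ge0 // lerXn2r ?nnegrE // dotp_le2.
lra.
Qed.

Lemma ubd_sum (I : eqType) (s : seq I) D (F : I -> 'rV[R]_n -> R) :
  (forall i, i \in s -> ubd D (F i)) -> ubd D (fun x => \sum_(i <- s) F i x).
Proof.
elim: s => [|i s ih] H.
  by apply: (ubd_ext (f := fun=> 0)); [move=> x; rewrite big_nil|exact: ubd_cst].
apply: (ubd_ext (f := fun x => F i x + \sum_(j <- s) F j x)).
  by move=> x; rewrite big_cons.
apply: ubd_D; first by apply: H; rewrite mem_head.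
by apply: ih => j js; apply: H; rewrite inE js orbT.
Qed.

Lemma ubd_coord D i : (exists B : R, forall x, D x -> `|x| <= B) -> ubd D (fun x => x 0 i).
Proof.
move=> [B HB]; exists (`|B| + 1); first by rewrite addr_ge0.
move=> x Dx; exists (delta_mx 0 i); split; first exact: jet1_coord.
- rewrite (le_trans (coord_le_norm _ _)) // (le_trans (HB x Dx)) //.
  by rewrite (le_trans (ler_norm _)) // lerDl.
- apply: norm_le_coord => [|j]; first by rewrite addr_ge0.
  by rewrite mxE eqxx /=; case: (j == i); rewrite ?normr1 ?normr0 ?lerDr ?addr_ge0.
move=> e _; exists 0; first by rewrite normr0 addr_ge0.
rewrite dotpC dotp_delta; apply: J2_ext (J2_lin (x 0 i) (e 0 i)).
by apply: filterE => t; rewrite !mxE mulrC.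
Qed.

Lemma ubd_bounded D f : ubd D f -> exists2 C : R, 0 <= C & forall x, D x -> `|f x| <= C.
Proof. by move=> [C C0 H]; exists C => // x /H[g []]. Qed.

Lemma ubd_cube_pos D f : ubd D f -> ubd D (fun x => Num.max 0 (f x) ^+ 3).
Proof.
move=> uf; apply: (ubd_comp (h := fun s => Num.max 0 s ^+ 3)) => //.
have [C C0 H] := ubd_bounded uf.
exists (C ^+ 3 + 3 * C ^+ 2 + 3 * C); first by rewrite !addr_ge0 ?mulr_ge0 ?exprn_ge0.
move=> x /H fC; exists (3 * Num.max 0 (f x) ^+ 2), (3 * Num.max 0 (f x)).
split; first exact: J2_cube_pos.
all: have m0 : 0 <= Num.max 0 (f x) by rewrite le_max lexx.
all: have mC : Num.max 0 (f x) <= C by rewrite ge_max C0 (le_trans (ler_norm _)).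
all: have m2 : Num.max 0 (f x) ^+ 2 <= C ^+ 2 by rewrite lerXn2r.
all: have m3 : Num.max 0 (f x) ^+ 3 <= C ^+ 3 by rewrite lerXn2r.
all: have c2 : 0 <= C ^+ 2 by rewrite exprn_ge0.
all: have c3 : 0 <= C ^+ 3 by rewrite exprn_ge0.
all: rewrite ger0_norm ?mulr_ge0 ?exprn_ge0 //; lra.
Qed.

(** The power -1/2 of [f], written through exp and ln. It will normalize a field whose squared
    length is [f]. *)
Lemma ubd_lower_comp D f (c0 : R) : 0 < c0 -> (forall x, D x -> c0 <= f x) -> ubd D f ->
  ubd D (fun x => expR (- (ln (f x) / 2))).
Proof.
move=> c00 fc uf.
have [C C0 H] := ubd_bounded uf.
have ul : ubd D (fun x => ln (f x)).
  apply: (ubd_comp (h := @ln R)) => //.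
  exists (`|ln c0| + `|ln (C + c0)| + c0^-1 + c0 ^- 2).
    by rewrite !addr_ge0 ?invr_ge0 ?exprn_ge0 // ltW.
  move=> x Dx; have fx := fc x Dx; have fx0 := lt_le_trans c00 fx.
  have i0 : 0 < c0^-1 by rewrite invr_gt0.
  have ii : (f x)^-1 <= c0^-1 by rewrite lef_pV2.
  have j0 : 0 < (f x)^-1 by rewrite invr_gt0.
  have k0 : 0 < c0 ^- 2 by rewrite invr_gt0 exprn_gt0.
  have kk : (f x) ^- 2 <= c0 ^- 2 by rewrite -!exprVn lerXn2r // nnegrE ltW.
  have l0 : 0 < (f x) ^- 2 by rewrite invr_gt0 exprn_gt0.
  exists (f x)^-1, (- (f x) ^- 2 / 2); split; first exact: J2_ln.
  - have l1 : ln c0 <= ln (f x) by rewrite ler_ln ?posrE.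
    have l2 : ln (f x) <= ln (C + c0).
      rewrite ler_ln ?posrE //; last by rewrite ltr_wpDl.
      by rewrite (le_trans (ler_norm _)) // (le_trans (H x Dx)) // lerDl ltW.
    have := ler_norm (ln (C + c0)); have := lerNnormlW (lexx `|ln c0|).
    have := normr_ge0 (ln c0); have := normr_ge0 (ln (C + c0)).
    move=> *; rewrite ler_norml; apply/andP; split; lra.
  - rewrite gtr0_norm //; have := normr_ge0 (ln c0); have := normr_ge0 (ln (C + c0)); lra.
  - rewrite mulNr normrN gtr0_norm ?divr_gt0 //; have := normr_ge0 (ln c0).
    have := normr_ge0 (ln (C + c0)); lra.
have ul' : ubd D (fun x => - 2^-1 * ln (f x)) by apply: ubd_M => //; exact: ubd_cst.
have [B B0 HB] := ubd_bounded ul'.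
apply: (ubd_ext (f := fun x => expR (- 2^-1 * ln (f x)))).
  by move=> x; congr expR; rewrite mulNr mulrC.
apply: (ubd_comp (h := @expR R)) => //.
exists (expR B); first exact: expR_ge0.
move=> x Dx; exists (expR (- 2^-1 * ln (f x))), (expR (- 2^-1 * ln (f x)) / 2).
have e0 := expR_gt0 (- 2^-1 * ln (f x)).
have eB : expR (- 2^-1 * ln (f x)) <= expR B.
  by rewrite ler_expR (le_trans (ler_norm _)) // HB.
split; first exact: J2_expR.
- by rewrite gtr0_norm.
- by rewrite gtr0_norm.
- by rewrite gtr0_norm ?divr_gt0 //; lra.
Qed.

(** Two more derivatives than [s] are consumed. For a defining function of class C^3 this covers the
    function and its gradient, which is how the regularity of the boundary enters. *)
Lemma ubd_Ck K V k f s : compact K -> K `<=` V -> open V -> Ck k V f -> ((size s).+1 < k)%N ->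
  ubd K (partials s f).
Proof.
move=> cK KV oV C sk.
have [C0 C00 H0] : exists2 C : R, 0 < C & forall x, K x -> `|partials s f x| <= C.
  apply: compact_bound => // x Kx; case: C => _ h; apply: h; last exact: KV.
  by apply: leq_trans sk; rewrite ltnW // ltnW.
have b1 i : exists2 C : R, 0 < C & forall x, K x -> `|partials (i :: s) f x| <= C.
  apply: compact_bound => // x Kx; case: C => _ h; apply: h; last exact: KV.
  exact: ltnW.
have b2 p : exists2 C : R, 0 < C & forall x, K x -> `|partials [:: p.2, p.1 & s] f x| <= C.
  by apply: compact_bound => // x Kx; case: C => _ h; apply: h; last exact: KV.
have pos (I : finType) (c : I -> R) : (forall i, 0 < c i) -> forall i, c i <= \sum_j c j.
  by move=> c0 i; rewrite (bigD1 i) //= lerDl sumr_ge0 // => j _; exact: ltW.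
have [C1 C10 H1] : exists2 C : R, 0 <= C & forall i x, K x -> `|partials (i :: s) f x| <= C.
  have /choice[c cP] : forall i, exists C : R, 0 < C /\ forall x, K x -> `|partials (i :: s) f x| <= C.
    by move=> i; have [C' ? ?] := b1 i; exists C'.
  exists (\sum_i c i); first by rewrite sumr_ge0 // => i _; have [/ltW] := cP i.
  move=> i x Kx; have [_ h] := cP i; apply: le_trans (h x Kx) _.
  by apply: pos => j; have [] := cP j.
have [C2 C20 H2] : exists2 C : R, 0 <= C & forall p x, K x -> `|partials [:: p.2, p.1 & s] f x| <= C.
  have /choice[c cP] : forall p, exists C : R, 0 < C /\ forall x, K x -> `|partials [:: p.2, p.1 & s] f x| <= C.
    by move=> i; have [C' ? ?] := b2 i; exists C'.
  exists (\sum_i c i); first by rewrite sumr_ge0 // => i _; have [/ltW] := cP i.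
  move=> i x Kx; have [_ h] := cP i; apply: le_trans (h x Kx) _.
  by apply: pos => j; have [] := cP j.
pose M := C0 + C1 + n%:R * (2 * n%:R * C2).
have M1 : 0 <= n%:R * (2 * n%:R * C2) by rewrite !mulr_ge0.
exists (C0 + C1 + n%:R * (2 * n%:R * C2) * 2); first by rewrite !addr_ge0 ?mulr_ge0 // ltW.
move=> x Kx; exists (\row_i partials (i :: s) f x); split.
- by apply: Ck_jet1 C oV (KV _ Kx) _; exact: ltnW.
- have := H0 x Kx; lra.
- apply: norm_le_coord => [|i]; first lra.
  by rewrite vrowkE; have := H1 i x Kx; lra.
move=> e e2; exists (quad (\matrix_(i, j) partials [:: j, i & s] f x) e / 2).
  rewrite normrM [`|2^-1|]gtr0_norm ?invr_gt0 // ler_pdivrMr //.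
  have : `|quad (\matrix_(i, j) partials [:: j, i & s] f x) e| <= n%:R * (2 * (2 * n%:R * C2)).
    rewrite (le_trans (ler_norm_sum _ _ _)) // mulr_natl -[X in _ *+ X](card_ord n) -sumr_const.
    apply: ler_sum => i _; rewrite normrM ler_pM //.
      by rewrite (le_trans (coord_le_norm _ _)).
    apply: dotp_le2 e2; apply: norm_le_coord => // j.
    by rewrite !mxE; exact: (H2 (i, j)).
  lra.
by apply: jet2_line; apply: Ck_jet2 C oV (KV _ Kx) _.
Qed.

End Nice.

Section Collar.
Context {R : realType} {n : nat}.
Implicit Types (A D K V : set 'rV[R]_n) (f rho : 'rV[R]_n -> R) (x y z e nu : 'rV[R]_n).

(** The cubed positive part replaces a smooth cut-off: second-order expansions are all that is
    used. *)
Definition bump y (r : R) x : R := Num.max 0 (r ^+ 2 - dotp (x - y) (x - y)) ^+ 3.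

Lemma bump_ge0 y r x : 0 <= bump y r x.
Proof. by rewrite exprn_ge0 // le_max lexx. Qed.

Lemma bump_gt0 y r x : dotp (x - y) (x - y) < r ^+ 2 -> 0 < bump y r x.
Proof. by move=> H; rewrite exprn_gt0 // lt_max subr_gt0 H orbT. Qed.

Lemma bump_eq0 y r x : r ^+ 2 <= dotp (x - y) (x - y) -> bump y r x = 0.
Proof. by move=> H; rewrite /bump max_l ?expr0n // subr_le0. Qed.

Lemma bump_near0 y r x : r ^+ 2 < dotp (x - y) (x - y) -> \forall z \near x, bump y r z = 0.
Proof.
move=> H; have oB : open [set z | r ^+ 2 < dotp (z - y) (z - y)].
  have -> : [set z | r ^+ 2 < dotp (z - y) (z - y)] = ~` [set z | dotp (z - y) (z - y) <= r ^+ 2].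
    by apply/seteqP; split=> z /=; [rewrite ltNge => /negP|move/negP; rewrite -ltNge].
  by apply: closed_openC; exact: closed_enorm_ball.
have := open_nbhs_nbhs (conj oB H); apply: filterS => z /= zr.
by apply: bump_eq0; exact: ltW.
Qed.

Lemma ubd_bump D y r : (exists B : R, forall x, D x -> `|x| <= B) -> ubd D (bump y r).
Proof.
move=> bD; apply: ubd_cube_pos.
apply: (ubd_ext (f := fun x => r ^+ 2 + -1 * \sum_(i < n) (x 0 i + - y 0 i) * (x 0 i + - y 0 i))).
  by move=> x; rewrite mulN1r; congr (_ - _); apply: eq_bigr => i _; rewrite !mxE.
apply: ubd_D; first exact: ubd_cst.
apply: ubd_M; first exact: ubd_cst.
apply: ubd_sum => i _.
have h : ubd D (fun x => x 0 i + - y 0 i).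
  by apply: ubd_D; [exact: ubd_coord|exact: ubd_cst].
exact: ubd_M.
Qed.

(** Outside the closed ball nothing is known about [rho], but the bump vanishes in a neighbourhood
    of each point there; on the ball, a compact part of [V], the C^3 bounds apply. *)
Lemma ubd_patch D V rho y r s : (exists B : R, forall x, D x -> `|x| <= B) -> open V -> Ck 3 V rho ->
  (size s <= 1)%N -> 0 <= r -> [set x | dotp (x - y) (x - y) <= r ^+ 2] `<=` V ->
  ubd D (fun x => bump y r x * partials s rho x).
Proof.
move=> [B HB] oV C s1 r0 BV; set K := [set x | _] in BV.
have cK : compact K by exact: compact_enorm_ball.
apply: (@ubd_sub _ _ D ((D `&` K) `|` (D `\` K))).
  by move=> x Dx; have [Kx|Kx] := pselect (K x); [left|right].
apply: ubd_setU.
  apply: ubd_M; first by apply: ubd_bump; exists B => x [/HB].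
  apply: (@ubd_sub _ _ _ K); first by move=> x [].
  by apply: ubd_Ck cK BV oV C _.
exists 0 => // x [Dx /negP]; rewrite -ltNge => Kx.
apply: (@nice_ext _ _ _ (fun=> 0)).
  by have := bump_near0 Kx; apply: filterS => z ->; rewrite mul0r.
exists 0; split; rewrite ?normr0 //; first exact: jet1_cst.
by move=> e _; exists 0; [rewrite normr0|rewrite dotp0l; exact: J2_cst].
Qed.

Lemma boundary_patches A : open A -> bounded_set A -> Ck_boundary 3 A ->
  exists (s : seq 'rV[R]_n) (V : 'rV[R]_n -> set 'rV[R]_n) (rho : 'rV[R]_n -> 'rV[R]_n -> R) (r : 'rV[R]_n -> R),
  (forall y, y \in s -> [/\ local_defining 3 A (V y) (rho y), 0 < r y &
     [set x | dotp (x - y) (x - y) <= r y ^+ 2] `<=` V y]) /\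
  (forall x, boundary A x -> exists2 y, y \in s & dotp (x - y) (x - y) < r y ^+ 2).
Proof.
move=> oA bA CA.
have /choice[W WP] : forall y, exists W : set 'rV[R]_n * ('rV[R]_n -> R) * R, boundary A y ->
   [/\ local_defining 3 A W.1.1 W.1.2, 0 < W.2 & [set x | dotp (x - y) (x - y) <= W.2 ^+ 2] `<=` W.1.1].
  move=> y; have [By|nBy] := pselect (boundary A y); last by exists (setT, fun=> 0, 0).
  have [V [rho [Vy LD]]] := CA y By; have oV : open V by case: LD.
  have [e e0 He] := open_normP oV Vy.
  exists (V, rho, e / 2) => _; split=> //=; first by rewrite divr_gt0.
  move=> x /= xy; apply: He; apply: (le_lt_trans (norm_le_enorm _)).
  have : enorm (x - y) <= e / 2.
    by rewrite -(@ler_pXn2r _ 2) ?nnegrE ?enorm_ge0 ?divr_ge0 ?(ltW e0) // enorm_sqr.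
  lra.
have cB := compact_boundary oA bA.
pose U y := [set x | dotp (x - y) (x - y) < (W y).2 ^+ 2].
have oU y : open (U y).
  have -> : U y = ~` [set x | (W y).2 ^+ 2 <= dotp (x - y) (x - y)].
    by apply/seteqP; split=> x /=; [rewrite /U /= ltNge => /negP|move/negP; rewrite -ltNge].
  apply: closed_openC.
  have -> : [set x | (W y).2 ^+ 2 <= dotp (x - y) (x - y)] =
     (fun x => dotp (x - y) (x - y)) @^-1` [set t | (W y).2 ^+ 2 <= t] by [].
  apply: closed_comp; last exact: closed_ge.
  move=> x _; apply: (@jet1_continuous _ _ _ _ (\sum_i ((x - y) 0 i *: delta_mx 0 i + (x - y) 0 i *: delta_mx 0 i))).
  have c1 i : jet1 setT (fun z => (z - y) 0 i) x (delta_mx 0 i).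
    apply: (@jet1_ext_near _ _ (fun z => z 0 i - y 0 i)); first by apply: filterE => z; rewrite !mxE.
    by have := jet1_B (jet1_coord setT i x) (jet1_cst setT (y 0 i) x); rewrite subr0.
  apply: (@jet1_sum _ _ setT n (fun i z => (z - y) 0 i * (z - y) 0 i)) => i.
  exact: jet1_M.
move: cB; rewrite compact_cover => /(_ _ (boundary A) U)[//|x Bx|s sB cov].
  by exists x => //; have [_ r0 _] := WP x Bx; rewrite /U /= subrr dotp0l exprn_gt0.
exists (finmap.enum_fset s), (fun y => (W y).1.1), (fun y => (W y).1.2), (fun y => (W y).2); split.
  by move=> y ys; apply: WP; have := sB y ys; rewrite inE.
by move=> x /cov[y ys Uy]; exists y.
Qed.

Lemma inward_unit_normal_norm A x nu : inward_unit_normal A x nu -> dotp nu nu = 1.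
Proof.
move=> [V [rho [Vx [_ _ g0 _ _] ->]]]; have e0 := enorm_gt0 (g0 x Vx).
rewrite dotpZl dotpZr -enorm_sqr; by field; rewrite gt_eqF.
Qed.

Lemma inward_unit_normal_eq A V rho x nu : open A -> boundary A x -> local_defining 1 A V rho -> V x ->
  inward_unit_normal A x nu -> grad rho x = enorm (grad rho x) *: nu.
Proof.
move=> oA Bx LD Vx [V' [rho' [V'x LD' ->]]].
rewrite (normal_unique oA Bx LD' V'x LD Vx) scalerA divff ?scale1r //.
by have [_ _ g0 _ _] := LD; rewrite gt_eqF // enorm_gt0 // g0.
Qed.

Lemma ubd_lip (B : R) f : ubd [set x | `|x| <= B] f ->
  exists2 L : R, 0 <= L & forall x y, `|x| <= B -> `|y| <= B -> `|f y - f x| <= L * `|y - x|.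
Proof.
move=> [C C0 H]; exists (n%:R * C) => [|x y xB yB]; first by rewrite mulr_ge0.
have /choice[G GP] : forall z, exists g, `|z| <= B -> jet1 setT f z g /\ `|g| <= C.
  move=> z; have [zB|zB] := pselect (`|z| <= B); last by exists 0.
  by have [g [h1 _ h2 _]] := H z zB; exists g.
have seg t : 0 <= t <= 1 -> `|x + t *: (y - x)| <= B.
  move=> /andP[t0 t1]; have -> : x + t *: (y - x) = (1 - t) *: x + t *: y.
    by apply/rowP => i; rewrite !mxE; ring.
  rewrite (le_trans (ler_normD _ _)) // !normrZ (ger0_norm t0) ger0_norm ?subr_ge0 //.
  have h1 : (1 - t) * `|x| <= (1 - t) * B by rewrite ler_wpM2l // subr_ge0.
  have h2 : t * `|y| <= t * B by rewrite ler_wpM2l.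
  lra.
have := @segment_bound _ _ [set x | `|x| <= B] f G x y 0 C (fun z zB => (GP z zB).1).
rewrite dotp0l subr0; apply.
- by move=> t /andP[t0 t1]; apply: seg; rewrite !ltW.
- apply: within01_continuous => t t01.
  have [gj _] := GP _ (seg t t01); have := jet1_line (y - x) gj => L.
  apply: (@J1_continuous R (fun t => f (x + t *: (y - x))) t (dotp (G (x + t *: (y - x))) (y - x))).
  by apply: J1_ext L; apply: filterE => s; rewrite -addrA -scalerDl.
- by move=> t /andP[t0 t1]; rewrite subr0; apply: (GP _ (seg t _)).2; rewrite !ltW.
Qed.

(* [g] extends the inward unit normal and [sigma] is a substitute for the
   distance to the boundary that avoids its regularity theory. *)
Lemma collar_functions A (eps : R) : (0 < n)%N -> open A -> A !=set0 -> bounded_set A ->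
  Ck_boundary 3 A -> 0 < eps ->
  exists (mu : R) (g : 'rV[R]_n -> 'rV[R]_n) (sigma : 'rV[R]_n -> R),
  let D := [set x | closure A x /\ bdist A x <= mu] in
  [/\ 0 < mu, forall i, ubd D (fun x => g x 0 i), ubd D sigma,
      forall x, D x -> `|sigma x| <= eps &
      forall x nu, boundary A x -> inward_unit_normal A x nu ->
        [/\ g x = nu, sigma x = 0 & jet1 setT sigma x nu]].
Proof.
move=> n0 oA A0 bA CA eps0.
have BN := boundary_nonempty n0 oA A0 bA.
have [B B0 HB] := bounded_closure bA.
have [s [V [rho [r [sP sC]]]]] := boundary_patches oA bA CA.
pose D0 := [set x : 'rV[R]_n | `|x| <= B].
have bD0 : exists B : R, forall x, D0 x -> `|x| <= B by exists B.
have patch (t : seq 'I_n) : (size t <= 1)%N ->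
    ubd D0 (fun x => \sum_(y <- s) bump y (r y) x * partials t (rho y) x).
  move=> t1; apply: ubd_sum => y ys; have [[oV C _ _ _] r0 K] := sP y ys.
  by apply: ubd_patch oV C t1 (ltW r0) K.
(* Bump-weighted sums of the gradients of the local defining functions and of these functions
   themselves. The latter vanish on the boundary, so derivatives of the bumps do not contribute
   there and [gt] is the gradient of [st]. *)
pose gt i x := \sum_(y <- s) bump y (r y) x * partials [:: i] (rho y) x.
pose st x := \sum_(y <- s) bump y (r y) x * rho y x.
have ust : ubd D0 st by exact: (patch [::]).
have ugt i : ubd D0 (gt i) by exact: (patch [:: i]).
pose F x := \sum_i gt i x * gt i x.
have uF : ubd D0 F by apply: ubd_sum => i _; exact: ubd_M.
(* At a boundary point the gradients of all defining functions are positive multiples of the same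
   normal, so the weighted sums cannot cancel. *)
have atB x nu : boundary A x -> inward_unit_normal A x nu -> exists S : R,
    [/\ 0 < S, forall i, gt i x = S * nu 0 i, st x = 0 & jet1 setT st x (S *: nu)].
  move=> Bx Nx.
  pose a y := bump y (r y) x * enorm (grad (rho y) x).
  have Vy y : y \in s -> bump y (r y) x != 0 -> V y x.
    move=> ys; have [_ _ K] := sP y ys; move=> b0; apply: K => /=.
    by rewrite leNgt; apply/negP => /ltW /bump_eq0 /eqP; rewrite (negPf b0).
  have LD y : y \in s -> local_defining 1 A (V y) (rho y).
    by move=> ys; have [h _ _] := sP y ys; exact: local_defining_le h.
  have eqg y i : y \in s -> bump y (r y) x * partials [:: i] (rho y) x = a y * nu 0 i.
    move=> ys; have [b0|b0] := eqVneq (bump y (r y) x) 0.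
      by rewrite /a b0 !mul0r.
    have := inward_unit_normal_eq oA Bx (LD y ys) (Vy y ys b0) Nx.
    move/(congr1 (fun z : 'rV[R]_n => z 0 i)); rewrite vrowkE vsclE /= => ->.
    by rewrite /a mulrA.
  have a0 y : 0 <= a y by rewrite mulr_ge0 ?bump_ge0 ?enorm_ge0.
  exists (\sum_(y <- s) a y); split.
  - have [y ys yx] := sC x Bx.
    rewrite (big_rem y ys) /= ltr_pwDl ?sumr_ge0 //.
    have b0 := bump_gt0 yx.
    rewrite /a mulr_gt0 // enorm_gt0 //.
    have [_ _ g0 _ _] := LD y ys; apply: g0; apply: Vy => //; exact: lt0r_neq0.
  - by move=> i; rewrite mulr_suml; apply: eq_big_seq => y ys; exact: eqg.
  - rewrite /st big1_seq // => y /andP[_ ys].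
    have [b0|b0] := eqVneq (bump y (r y) x) 0; first by rewrite b0 mul0r.
    by rewrite (defining_at_bd (LD y ys) (Vy y ys b0) Bx) mulr0.
  have bj y : exists g, jet1 setT (bump y (r y)) x g.
    have bx : exists B : R, forall z, [set x] z -> `|z| <= B by exists `|x| => z ->.
    have [C _ /(_ x erefl)[g [gj _ _ _]]] := ubd_bump y (r y) bx.
    by exists g.
  have term y : y \in s -> jet1 setT (fun z => bump y (r y) z * rho y z) x (a y *: nu).
    move=> ys; have [g gj] := bj y; have [[oV C _ _ _] r0 K] := sP y ys.
    have [xr|xr] := leP (dotp (x - y) (x - y)) (r y ^+ 2); last first.
      rewrite /a (bump_eq0 (ltW xr)) mul0r scale0r.
      apply: jet1_ext_near (jet1_cst setT 0 x).
      by have := bump_near0 xr; apply: filterS => z ->; rewrite mul0r.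
    have Vx : V y x by apply: K.
    have := jet1_M gj (Ck_jet1 (s := [::]) C oV Vx (isT : (0 < 3)%N)).
    apply: jet1_eq; rewrite /= (defining_at_bd (LD y ys) Vx Bx) scale0r addr0.
    by apply/rowP => i; rewrite !vsclE vrowkE; exact: eqg.
  have : forall t, {subset t <= s} -> jet1 setT (fun x => \sum_(y <- t) bump y (r y) x * rho y x) x ((\sum_(y <- t) a y) *: nu).
    elim=> [|y t ih] ts.
      rewrite big_nil scale0r; apply: jet1_ext_near (jet1_cst setT 0 x).
      by apply: filterE => z; rewrite big_nil.
    rewrite big_cons scalerDl.
    apply: (@jet1_ext_near _ _ (fun z => bump y (r y) z * rho y z + \sum_(y <- t) bump y (r y) z * rho y z)).
      by apply: filterE => z; rewrite big_cons.
    apply: jet1_D; first by apply: term; apply: ts; rewrite mem_head.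
    by apply: ih => z zt; apply: ts; rewrite inE zt orbT.
  by apply.
have Fpos x : boundary A x -> 0 < F x.
  move=> Bx; have [V' [rho' [V'x LD']]] := CA x Bx.
  have Nx : inward_unit_normal A x ((enorm (grad rho' x))^-1 *: grad rho' x).
    by exists V', rho'; split=> //; exact: local_defining_le LD'.
  have [S [S0 gS _ _]] := atB x _ Bx Nx.
  rewrite /F (_ : \sum_i _ = S ^+ 2 * dotp ((enorm (grad rho' x))^-1 *: grad rho' x) ((enorm (grad rho' x))^-1 *: grad rho' x)).
    by rewrite (inward_unit_normal_norm Nx) mulr1 exprn_gt0.
  by rewrite /dotp big_distrr /=; apply: eq_bigr => i _; rewrite !gS; ring.
have D0B x : boundary A x -> D0 x by move=> [/HB].
have [c0 c00 Fc0] : exists2 c0 : R, 0 < c0 & forall x, boundary A x -> c0 <= F x.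
  have [|x] := @EVT_max_rV R n (fun x => - F x) (boundary A) BN (compact_boundary oA bA).
    apply/subspace_continuousP => y By; apply: cvg_within_filter.
    have [C _ /(_ y (D0B y By))[g [gj _ _ _]]] := uF.
    by apply: cvgN; exact: jet1_continuous gj.
  rewrite inE => Bx H; exists (F x); first exact: Fpos.
  by move=> y By; rewrite -lerN2; apply: H; rewrite inE.
have [LF LF0 HLF] := ubd_lip uF; have [LS LS0 HLS] := ubd_lip ust.
(* This is F^(-1/2), which makes the field [gt] a unit vector; [k0] is its bound where F >= c0 /
   2. *)
pose k x := expR (- (ln (F x) / 2)).
pose k0 := expR (- (ln (c0 / 2) / 2)).
have k00 : 0 < k0 by exact: expR_gt0.
(* Points of the collar are within 2 mu of a boundary point. The first entry keeps F >= c0 / 2 there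
   by the Lipschitz bound for F; the second makes |sigma| <= eps. *)
pose mu := Num.min (c0 / (4 * (LF + 1))) (eps / (2 * (k0 * LS + 1))).
have LF1 : 0 < LF + 1 by rewrite ltr_wpDl.
have LS1 : 0 < k0 * LS + 1 by rewrite ltr_wpDl // mulr_ge0 // ltW.
have mu0 : 0 < mu by rewrite lt_min !divr_gt0 ?mulr_gt0.
have muF : mu * (4 * (LF + 1)) <= c0 by rewrite -ler_pdivlMr ?mulr_gt0 // ge_min lexx.
have muS : mu * (2 * (k0 * LS + 1)) <= eps by rewrite -ler_pdivlMr ?mulr_gt0 // ge_min lexx orbT.
have nearB x : closure A x -> bdist A x <= mu -> c0 / 2 <= F x /\ `|st x| <= LS * (2 * mu).
  move=> Ax xmu; have [|z Bz xz] := @bdist_lt _ _ A x (2 * mu) BN.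
    by apply: (le_lt_trans xmu); rewrite mulr_natl mulr2n ltrDl.
  have nz : `|x - z| <= 2 * mu by apply: (le_trans (norm_le_enorm _)); exact: ltW.
  have h1 := HLF z x (D0B z Bz) (HB x Ax); have h2 := HLS z x (D0B z Bz) (HB x Ax).
  have h3 : LF * `|x - z| <= LF * (2 * mu) by rewrite ler_wpM2l.
  have h4 : LS * `|x - z| <= LS * (2 * mu) by rewrite ler_wpM2l.
  have [V' [rho' [V'x LD']]] := CA z Bz.
  have Nz : inward_unit_normal A z ((enorm (grad rho' z))^-1 *: grad rho' z).
    by exists V', rho'; split=> //; exact: local_defining_le LD'.
  have [S [_ _ s0 _]] := atB z _ Bz Nz.
  move: h2; rewrite s0 subr0 => h2; split; last lra.
  have h5 := Fc0 z Bz; move: h1; rewrite ler_norml => /andP[h1 _]; lra.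
exists mu, (fun x => \row_i (k x * gt i x)), (fun x => k x * st x) => D.
have DD0 : D `<=` D0 by move=> x [/HB].
have uk : ubd D k.
  apply: (@ubd_lower_comp _ _ D F (c0 / 2)); first by rewrite divr_gt0.
    by move=> x [Ax xm]; have [] := nearB x Ax xm.
  exact: ubd_sub DD0 uF.
have kB x : c0 / 2 <= F x -> k x <= k0.
  move=> cF; rewrite ler_expR lerN2 ler_pM2r // ler_ln ?posrE ?divr_gt0 //.
  by apply: lt_le_trans cF; rewrite divr_gt0.
split=> //.
- move=> i; apply: (ubd_ext (f := fun x => k x * gt i x)); first by move=> x; rewrite mxE.
  by apply: ubd_M => //; exact: ubd_sub (ugt i).
- by apply: ubd_M => //; exact: ubd_sub ust.
- move=> x [Ax xm]; have [h1 h2] := nearB x Ax xm.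
  rewrite normrM gtr0_norm ?expR_gt0 //.
  have h3 : k x * `|st x| <= k0 * (LS * (2 * mu)).
    by apply: ler_pM => //; [exact: expR_ge0|exact: kB].
  lra.
move=> x nu Bx Nx; have [S [S0 gS s0 sj]] := atB x nu Bx Nx.
have FS : F x = S ^+ 2.
  rewrite -[RHS]mulr1 -(inward_unit_normal_norm Nx) /dotp big_distrr /=.
  by apply: eq_bigr => i _; rewrite !gS; ring.
have kS : k x = S^-1.
  rewrite /k FS lnXn // -[_ *+ 2]mulr_natr mulfK // expRN lnK //.
split.
- by apply/rowP => i; rewrite mxE gS kS mulrA mulVf ?mul1r // gt_eqF.
- by rewrite s0 mulr0.
have xD : D x.
  split; first by case: Bx.
  apply: (le_trans (bdist_le x Bx)); rewrite subrr enorm0; exact: ltW.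
have [C _ /(_ x xD)[g [gj _ _ _]]] := uk.
apply: jet1_eq (jet1_M gj sj).
by rewrite s0 scale0r addr0 kS scalerA mulVf ?scale1r // gt_eqF.
Qed.

End Collar.

(** * Maxima inside the domain *)

Section PsiBounds.
Context {R : realType} {n : nat}.
Implicit Types (O : set 'rV[R]_n) (psi : 'rV[R]_n -> R -> R) (x : 'rV[R]_n).

(** The norm is a sum of suprema, and one of them is bounded by the sum because the others are
    nonnegative. For this their index sets must be nonempty: [p] lies in the closure, and 0 < m
    supplies a multi-index of each length. *)
Lemma Ck_norm_ext (m k : nat) (A : set 'rV[R]_m) f (L : R) (s : seq 'I_m) p :
  (Ck_norm k A f <= L%:E)%E -> (0 < m)%N -> (size s <= k)%N -> closure A p ->
  `|ext A (partials s f) p| <= L.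
Proof.
move=> H m0 sk Ap; rewrite -lee_fin; apply: le_trans H.
pose T (j : nat) := [set (`|ext A (partials p.1 f) p.2|)%:E
      | p in [set p : j.-tuple 'I_m * 'rV[R]_m | closure A p.2]].
have T0 j : (0 <= ereal_sup (T j))%E.
  pose e := (`|ext A (partials (nseq_tuple j (Ordinal m0)) f) p|)%:E.
  apply: (@le_trans _ _ e); first by rewrite lee_fin.
  by apply: ereal_sup_ubound; exists (nseq_tuple j (Ordinal m0), p).
rewrite /Ck_norm (bigD1 (Ordinal (sk : (size s < k.+1)%N))) //=.
apply: (@le_trans _ _ (ereal_sup (T (size s)))).
  by apply: ereal_sup_ubound; exists (in_tuple s, p).
rewrite leeDl //; apply: sume_ge0 => i _; exact: T0.
Qed.

Lemma closure_cyl_pt O M0 x z : 0 < M0 -> closure O x -> - M0 <= z <= M0 ->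
  closure (cyl O M0) (pt x z).
Proof.
move=> M00 Ox zM U /near_normP[d d0 HU].
have [y [Oy yx]] : O `&` [set y | `|y - x| < d] !=set0.
  by apply: Ox; apply/near_normP; exists d.
pose t := Num.min (2^-1) (d / (2 * M0)).
have t0 : 0 < t by rewrite lt_min invr_gt0 ltr0n /= divr_gt0 // mulr_gt0.
have t1 : t <= 2^-1 by rewrite ge_min lexx.
have td : t * (2 * M0) <= d by rewrite -ler_pdivlMr ?mulr_gt0 // ge_min lexx orbT.
have {}zM : `|z| <= M0 by rewrite ler_norml.
have tz : t * `|z| <= t * M0 by rewrite ler_pM2l.
have tM : 0 < t * M0 by rewrite mulr_gt0.
have tM2 : t * M0 <= 2^-1 * M0 by rewrite ler_pM2r.
exists (pt y ((1 - t) * z)); split.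
  apply/cyl_pt; split=> //; rewrite -ltr_norml normrM ger0_norm; last lra.
  have : (1 - t) * `|z| <= (1 - t) * M0 by rewrite ler_wpM2l //; lra.
  lra.
apply: HU; rewrite ptB; apply: (le_lt_trans (pt_norm _ _)); rewrite gt_max yx /=.
have -> : (1 - t) * z - z = - (t * z) by ring.
rewrite normrN normrM gtr0_norm //; lra.
Qed.

Lemma psi_partial_bound O M0 L2 psi s p : open O -> psi_conditions O M0 L2 psi ->
  (size s <= 3)%N -> cyl O M0 p -> `|partials s (joint psi) p| <= L2.
Proof.
move=> oO [[C _ _] H] s3 Cp.
rewrite -(@ext_in _ _ (cyl O M0) (partials s (joint psi)) p) //; last by case: C => _; apply.
by apply: Ck_norm_ext H _ s3 _; [rewrite addn1|exact: subset_closure].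
Qed.

Lemma psi_bound O M0 L2 psi x z : open O -> 0 < M0 -> psi_conditions O M0 L2 psi ->
  closure O x -> - M0 <= z <= M0 -> `|psi x z| <= L2.
Proof.
move=> oO M00 pc Ox zM; have [[C cont _] H] := pc.
have cx := closure_cyl_pt M00 Ox zM.
rewrite -joint_pt -(@ext_closure _ _ (cyl O M0) (joint psi) (joint psi) _ cx cont) //.
by apply: (@Ck_norm_ext _ 3 _ _ _ [::]) H _ _ cx; rewrite ?addn1.
Qed.

End PsiBounds.

Section MBounds.
Context {R : realType} {n : nat}.
Implicit Types (O : set 'rV[R]_n) (u phi : 'rV[R]_n -> R) (x p : 'rV[R]_n).

(** All bounds are free of the slope: the frame has length at most 2, and p . b = (p . g) / v
    because [p] is an eigenvector of the square root. *)
Lemma nice_Mjet (C L phi : R) f x p : nice C f x -> `|phi| <= L -> exists b m,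
  [/\ Mjet x (frame p) (phi *: p) f (f x) b m, enorm b <= n%:R * C,
      `|dotp p b| <= n%:R * C & `|m| <= 2 * (n%:R * C) + L * (n%:R * C)].
Proof.
move=> [g [gj fC gC H]] pL.
have /choice[a aP] k : exists a : R, `|a| <= C /\
    J2 (fun t => f (x + t *: frame p k)) (f x) (dotp g (frame p k)) a.
  by have [a h1 h2] := H _ (frame_le2 p k); exists a.
have v0 := slope_gt0 p.
have gN : enorm g <= n%:R * C by apply: (le_trans (enorm_le_norm _)); rewrite ler_wpM2l.
have pb : `|dotp p (\row_k dotp g (frame p k))| <= n%:R * C.
  rewrite frame_dot_p normrM normfV (gtr0_norm v0) ler_pdivrMr //.
  apply: (le_trans (dotp_le_enorm _ _)); rewrite mulrC ler_pM ?enorm_ge0 //.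
  exact: enorm_slope.
have L0 : 0 <= L := le_trans (normr_ge0 _) pL.
exists (\row_k dotp g (frame p k)), (2 * \sum_k a k - dotp (phi *: p) (\row_k dotp g (frame p k))).
split=> //.
- by exists a => // k; rewrite vrowkE; have [] := aP k.
- apply: le_trans gN; rewrite -(@ler_pXn2r _ 2) ?nnegrE ?enorm_ge0 // !enorm_sqr.
  exact: frame_sqr.
rewrite (le_trans (ler_normB _ _)) // lerD //.
  rewrite normrM normr_nat ler_wpM2l // (le_trans (ler_norm_sum _ _ _)) //.
  rewrite mulr_natl -[X in _ *+ X](card_ord n) -sumr_const.
  by apply: ler_sum => k _; have [] := aP k.
by rewrite dotpZl normrM ler_pM.
Qed.

Section Psi.
Variables (O : set 'rV[R]_n) (u phi : 'rV[R]_n -> R).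
Hypotheses (oO : open O) (uC : Ck 3 O u).
Hypothesis eqn : forall x, O x -> mean_curvature_op u x = phi x.
Variables (x : 'rV[R]_n) (M0 L1 L2 : R) (psi : 'rV[R]_n -> R -> R).
Hypotheses (Ox : O x) (uM : - M0 < u x < M0) (phL : `|phi x| <= L1).
Hypothesis pc : psi_conditions O M0 L2 psi.

Let p := grad u x.
Let v := slope p.

(** Only p . b grows with the slope, through psi_z |p|^2 / v. The value of L stays bounded because L
    u and L of the coordinates do, and their frame gradients have length at most 1. *)
Lemma psi_Mjet : exists b m,
  [/\ Mjet x (frame p) (phi x *: p) (fun y => psi y (u y)) (psi x (u x)) b m,
      enorm b <= (n%:R + 1) * L2,
      `|dotp p b| <= n%:R * L2 + L2 * v &
      `|m| <= (n%:R + 1) * (L2 * L1) + (n%:R + 1) ^+ 2 * L2].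
Proof.
have v0 : 0 < v := slope_gt0 p.
have pv : enorm p <= v := enorm_slope p.
have Cx : cyl O M0 (pt x (u x)) by apply/cyl_pt.
have oC : open (cyl O M0) := cyl_open oO.
have [[C _ _] _] := pc.
have PB s : (size s <= 3)%N -> `|partials s (joint psi) (pt x (u x))| <= L2.
  by move=> s3; exact: psi_partial_bound pc s3 Cx.
have L20 : 0 <= L2 := le_trans (normr_ge0 _) (PB [::] isT).
have L10 : 0 <= L1 := le_trans (normr_ge0 _) phL.
pose b (i : 'I_(n + 1)) : 'rV[R]_n := match fintype.split i with
  inl j => \row_k dotp (delta_mx 0 j) (frame p k) | inr _ => v^-1 *: p end.
pose m (i : 'I_(n + 1)) : R := match fintype.split i with
  inl j => - (phi x * (p 0 j / v)) | inr _ => phi x / v end.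
have bl j : b (lshift 1 j) = \row_k dotp (delta_mx 0 j) (frame p k).
  by rewrite /b (unsplitK (inl j)).
have br j : b (rshift n j) = v^-1 *: p by rewrite /b (unsplitK (inr j)).
have ml j : m (lshift 1 j) = - (phi x * (p 0 j / v)) by rewrite /m (unsplitK (inl j)).
have mr j : m (rshift n j) = phi x / v by rewrite /m (unsplitK (inr j)).
have J i : Mjet x (frame p) (phi x *: p) (fun y => pt y (u y) 0 i) (pt x (u x) 0 i) (b i) (m i).
  case: (split_ordP i) => j ->.
    rewrite bl ml pt_l; apply: Mjet_ext (coord_Mjet u phi x j).
    by apply: filterE => y; rewrite pt_l.
  rewrite br mr (ord1 j) pt_r; apply: Mjet_ext (u_Mjet oO uC eqn Ox).
  by apply: filterE => y; rewrite pt_r.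
have pv1 : enorm p / v <= 1 by rewrite ler_pdivrMr // mul1r.
have c0 j : 0 <= `|p 0 j| / v by rewrite divr_ge0 // ltW.
have c1 j : `|p 0 j| / v <= 1.
  by apply: le_trans pv1; rewrite ler_pM2r ?invr_gt0 // coord_le_enorm.
have b1 i : enorm (b i) <= 1.
  case: (split_ordP i) => j ->.
    rewrite bl -(@ler_pXn2r _ 2) ?nnegrE ?enorm_ge0 // enorm_sqr expr1n.
    apply: (le_trans (frame_sqr _ _)).
    by rewrite dotp_delta mxE !eqxx.
  by rewrite br enormZ normfV (gtr0_norm v0) mulrC.
have m1 i : `|m i| <= L1.
  case: (split_ordP i) => j ->.
    by rewrite ml normrN !normrM normfV (gtr0_norm v0) -[leRHS]mulr1 ler_pM.
  rewrite mr normrM normfV (gtr0_norm v0) ler_pdivrMr //.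
  by apply: (le_trans phL); rewrite ler_peMr // slope_ge1.
set G := \row_i partials [:: i] (joint psi) (pt x (u x)).
set H := \matrix_(i, j) partials [:: j; i] (joint psi) (pt x (u x)).
have GL i : `|G 0 i| <= L2 by rewrite vrowkE; exact: PB.
have HL i j : `|H i j| <= L2 by rewrite mxE; exact: PB.
have PJ : jet2 (joint psi) (pt x (u x)) G H by exact: (Ck_jet2 (s := [::]) C oC Cx (isT : (1 < 3)%N)).
have card1 : n%:R + 1 = #|'I_(n + 1)|%:R :> R by rewrite card_ord natrD.
exists (\sum_i G 0 i *: b i), (\sum_i G 0 i * m i + \sum_i \sum_j H i j * dotp (b i) (b j)).
split.
- have := Mjet_mcomp (F := fun y => pt y (u y)) PJ J; rewrite joint_pt.
  by apply: Mjet_ext; apply: filterE => y; rewrite joint_pt.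
- apply: (@le_trans _ _ (\sum_i enorm (G 0 i *: b i))).
    elim/big_ind2: _ => [|a1 a2 e1 e2 h1 h2|i _] //; first by rewrite enorm0.
    by rewrite (le_trans (enormD _ _)) // lerD.
  rewrite card1 mulr_natl -sumr_const; apply: ler_sum => i _.
  by rewrite enormZ -[leRHS]mulr1 ler_pM // enorm_ge0.
- rewrite dotp_sumr big_split_ord /= big_ord1 (le_trans (ler_normD _ _)) // lerD //.
    rewrite (le_trans (ler_norm_sum _ _ _)) // mulr_natl -[X in _ *+ X](card_ord n) -sumr_const.
    apply: ler_sum => i _; rewrite bl dotpZr frame_dot_p dotp_delta !normrM normfV (gtr0_norm v0).
    by rewrite -[leRHS]mulr1 ler_pM.
  rewrite br !dotpZr normrM ler_pM // normrM normfV (gtr0_norm v0) ger0_norm ?dotp_ge0 //.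
  rewrite mulrC ler_pdivrMr // -enorm_sqr expr2 ler_pM ?enorm_ge0 //.
- rewrite (le_trans (ler_normD _ _)) // lerD //.
    rewrite (le_trans (ler_norm_sum _ _ _)) // card1 mulr_natl -sumr_const.
    by apply: ler_sum => i _; rewrite normrM ler_pM.
  rewrite (le_trans (ler_norm_sum _ _ _)) // expr2 -mulrA {1}card1 mulr_natl -sumr_const.
  apply: ler_sum => i _; rewrite (le_trans (ler_norm_sum _ _ _)) // card1 mulr_natl -sumr_const.
  apply: ler_sum => j _; rewrite normrM -[leRHS]mulr1 ler_pM //.
  apply: (le_trans (dotp_le_enorm _ _)); rewrite -[leRHS]mulr1 ler_pM ?enorm_ge0 //.
Qed.

End Psi.
End MBounds.

(** With K = 4 (Cw + 1) and |w|^2 >= 1/4, the exponential contributes at least Lam K e (K / 4 - Cw)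
    = Lam K e >= Lam e0 = T. By the choice of [T] this exceeds by one the losses 4 + 4 L1 from the
    logarithm and alpha Cm from sigma. *)
Lemma step_real {R : realFieldType} (K Lam e e0 T mw bb M1 ms alpha Cm Cw L1 : R) :
  0 < e0 -> e0 <= e -> 0 <= alpha -> 0 <= Lam -> Lam * e0 = T -> T = 5 + 4 * L1 + alpha * Cm ->
  K = 4 * (Cw + 1) -> 0 <= Cw -> 4^-1 <= bb -> - Cw <= mw -> - (4 + 4 * L1) <= M1 -> - Cm <= ms ->
  M1 + alpha * ms + Lam * (K * e * mw + 2 * (K ^+ 2 * e / 2) * bb) <= 0 -> False.
Proof.
move=> e00 ee a0 Lam0 LamE TE KE Cw0 bb4 mwC M1L msC.
have e1 : 0 < e := lt_le_trans e00 ee.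
have K4 : 4 <= K by rewrite KE; lra.
have Ke : 0 <= K * e by rewrite mulr_ge0 //; lra.
have h1 : K * e * - Cw <= K * e * mw by rewrite ler_wpM2l.
have h2 : K ^+ 2 * e * 4^-1 <= K ^+ 2 * e * bb by rewrite ler_wpM2l // mulr_ge0 ?sqr_ge0 // ltW.
have h3 : K * e * - Cw + K ^+ 2 * e * 4^-1 = K * e by rewrite KE; field.
have h4 : e <= K * e by rewrite ler_peMl ?(ltW e1) //; lra.
have h5 : e0 <= K * e * mw + 2 * (K ^+ 2 * e / 2) * bb.
  have -> : 2 * (K ^+ 2 * e / 2) * bb = K ^+ 2 * e * bb by field.
  lra.
have h6 : Lam * e0 <= Lam * (K * e * mw + 2 * (K ^+ 2 * e / 2) * bb) by rewrite ler_wpM2l.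
have h7 : alpha * - Cm <= alpha * ms by rewrite ler_wpM2l.
lra.
Qed.

(** A lower bound for p . w, w being the frame gradient of u - psi sigma: the part from [u] is v - 1
    / v, the part from D sigma is bounded, and the part from D psi is at most v / 4 plus a constant.
    The last point is the reason for keeping |sigma| L2 <= 1/4 in the collar. *)
Lemma slope_real {R : realFieldType} (v pp a b c N Bg L2 sg : R) : 0 < v -> pp = v ^+ 2 - 1 ->
  `|a| <= L2 * Bg -> `|b| <= N * L2 + L2 * v -> 0 <= N -> 0 <= L2 -> `|sg| * L2 <= 4^-1 ->
  4 * (1 + L2 * Bg + N) <= v -> 1 <= v -> c = sg * b -> v / 2 <= pp / v - (a + c).
Proof.
move=> v0 -> aB bB N0 L20 sL vV v1 ->.
have h1 : `|sg * b| <= N / 4 + v / 4.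
  rewrite normrM; have h : `|sg| * `|b| <= `|sg| * (N * L2 + L2 * v) by rewrite ler_wpM2l.
  have h' : `|sg| * L2 * (N + v) <= 4^-1 * (N + v) by rewrite ler_wpM2r // addr_ge0 // ltW.
  have -> : N / 4 + v / 4 = 4^-1 * (N + v) by ring.
  apply: (le_trans h); rewrite [leLHS](_ : _ = `|sg| * L2 * (N + v)) //; ring.
have -> : (v ^+ 2 - 1) / v = v - v^-1 by field; rewrite gt_eqF.
have h2 : v^-1 <= 1 by rewrite invf_le1.
move: aB h1; rewrite !ler_norml => /andP[_ aB] /andP[_ h1].
lra.
Qed.

Section Aux.
Context {R : realType} {n : nat}.
Variables (u : 'rV[R]_n -> R) (psi : 'rV[R]_n -> R -> R) (P g : 'rV[R]_n -> 'rV[R]_n)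
  (sigma : 'rV[R]_n -> R) (alpha K Lam : R).

(** The field [P] is [grad u] at interior points and [gradc O u] up to the boundary. On the
    boundary, where P . g = psi and |g| = 1, the value is q - 2 psi^2. *)
Definition corrected_slope2 y : R := slope2 (P y) - 2 * \sum_i P y 0 i * (psi y (u y) * g y 0 i).

(* On the boundary [u - psi sigma] has zero normal derivative, so the last term
   only helps inside the domain; [alpha sigma] is what helps on the boundary. *)
Definition aux y : R := ln (corrected_slope2 y) / 2 + alpha * sigma y
  + Lam * (expR (K * (u y - psi y (u y) * sigma y)) - 1).

End Aux.

(** The constant [alpha] is arbitrary here, since it is fixed by the boundary; [K], [Lam] and [V]
    depend on it and on bounds only, not on the domain, the solution or the data. *)
Lemma interior_step {R : realType} (n : nat) (M0 L1 L2 Cg alpha : R) :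
  0 < M0 -> 0 < L1 -> 0 < L2 -> 0 <= Cg -> 0 <= alpha ->
  exists K Lam V : R, forall (O : set 'rV[R]_n) f psi u (g : 'rV[R]_n -> 'rV[R]_n) (sigma : 'rV[R]_n -> R) x,
  open O -> f_conditions O M0 L1 f -> psi_conditions O M0 L2 psi -> Ck 3 O u ->
  (forall x, O x -> `|u x| <= M0) -> (forall x, O x -> mean_curvature_op u x = f x (u x)) ->
  O x -> (forall i, nice Cg (fun y => g y 0 i) x) -> nice Cg sigma x ->
  `|sigma x| <= 1 -> `|sigma x| * L2 <= 4^-1 -> V <= slope (grad u x) ->
  (\forall y \near x, aux u psi (grad u) g sigma alpha K Lam y <=
     aux u psi (grad u) g sigma alpha K Lam x) -> False.
Proof.
move=> M00 L10 L20 Cg0 a0; pose N : R := n%:R; have N0 : 0 <= N by [].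
(* [Bg] and [Cm] bound the frame gradients and L for sigma and the components of g, [Bp] and [Cp]
   for psi, [Xb] and [Xm] for the products psi g_i. [Cb] is the constant passed to [bernstein]; -Cw
   bounds L(u - psi sigma) from below, and [e0] bounds the exponential from below. *)
have [Bg BgE] : {B : R | B = N * Cg} by exists (N * Cg).
have [Cm CmE] : {B : R | B = 2 * Bg + L1 * Bg} by exists (2 * Bg + L1 * Bg).
have [Bp BpE] : {B : R | B = (N + 1) * L2} by exists ((N + 1) * L2).
have [Cp CpE] : {B : R | B = (N + 1) * (L2 * L1) + (N + 1) ^+ 2 * L2} by eexists.
have [Xm XmE] : {B : R | B = L2 * Cm + Cg * Cp + 2 * (Bp * Bg)} by eexists.
have [Xb XbE] : {B : R | B = L2 * Bg + Cg * Bp} by eexists.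
have [Cb CbE] : {B : R | B = N * (Xm + Xb + L2 * Cg) + 1} by eexists.
have [Cw CwE] : {B : R | B = L1 + (L2 * Cm + Cp + 2 * (Bp * Bg))} by eexists.
have [K KE] : {B : R | B = 4 * (Cw + 1)} by eexists.
have [e0 e0E] : {B : R | B = expR (- (K * (M0 + L2)))} by eexists.
have [T TE] : {B : R | B = 5 + 4 * L1 + alpha * Cm} by eexists.
have Bg0 : 0 <= Bg by rewrite BgE mulr_ge0.
have Cm0 : 0 <= Cm by rewrite CmE addr_ge0 // mulr_ge0 // ltW.
have Bp0 : 0 <= Bp by rewrite BpE mulr_ge0 ?(ltW L20) // addr_ge0.
have Cp0 : 0 <= Cp by rewrite CpE !(addr_ge0, mulr_ge0, exprn_ge0) ?(ltW L20) ?(ltW L10).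
have P0 : 0 <= Bp * Bg by rewrite mulr_ge0.
have Xm0 : 0 <= Xm by rewrite XmE !(addr_ge0, mulr_ge0) ?(ltW L20).
have Xb0 : 0 <= Xb by rewrite XbE !(addr_ge0, mulr_ge0) ?(ltW L20).
have Y0 : 0 <= L2 * Cg by rewrite mulr_ge0 // ltW.
have Cb1 : 1 <= Cb by rewrite CbE lerDr mulr_ge0 // !addr_ge0.
have Cw0 : 0 <= Cw by rewrite CwE !(addr_ge0, mulr_ge0) ?(ltW L20) ?(ltW L10).
have K0 : 0 < K by rewrite KE; lra.
have e00 : 0 < e0 by rewrite e0E expR_gt0.
have T0 : 0 <= T by rewrite TE !(addr_ge0, mulr_ge0) // ltW.
(* The first entry of the threshold is required by [bernstein], the second by [slope_real]. *)
exists K, (T / e0), (Num.max (80 * Cb) (4 * (1 + L2 * Bg + N))).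
move=> O f psi u g sigma x oO fc pc uC uM ueq Ox gn sn s1 sL; rewrite ge_max => /andP[vC vN] amax.
set p := grad u x in vC vN; set v := slope p in vC vN.
have v0 : 0 < v := slope_gt0 p.
have v1 : 1 <= v := slope_ge1 p.
have p0 : p != 0.
  apply/negP => /eqP p0; move: vC.
  rewrite /v /slope /slope2 p0 dotp0l addr0 sqrtr1; clear -Cb1; lra.
have uMx := grad_neq0_bound oO (Ck_le (isT : (1 <= 3)%N) uC) uM Ox p0.
have uMx' : - M0 <= u x <= M0 by case/andP: uMx => ? ?; rewrite !ltW.
have phid := f_jet oO fc Ox uMx (jet1_u oO uC Ox).
have [fz0 fxL fL] := f_at fc Ox uMx'.
have psL : `|psi x (u x)| <= L2 by exact: psi_bound oO M00 pc (subset_closure Ox) uMx'.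
have [bp [mp [pJ bpB pbp mpB]]] := psi_Mjet oO uC ueq Ox uMx fL pc.
rewrite -/N -/p -/v in pJ bpB pbp mpB.
rewrite -BpE in bpB; rewrite -CpE in mpB.
have [bs [ms [sJ bsB pbs msB]]] := nice_Mjet p sn fL.
rewrite -/N -BgE in bsB pbs msB; rewrite -CmE in msB.
have /choice[bg bgP] i := nice_Mjet p (gn i) fL.
have /choice[mg mgP] := bgP.
have gv i : `|g x 0 i| <= Cg by have [? []] := gn i.
have sumN (b : 'rV[R]_n) c : enorm b <= c -> 0 <= c by apply: le_trans; exact: enorm_ge0.
have GJ i : Mjet x (frame p) (f x (u x) *: p) (fun y => psi y (u y) * g y 0 i)
    ((\row_i (psi x (u x) * g x 0 i)) 0 i)
    (psi x (u x) *: bg i + g x 0 i *: bp)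
    ((\row_i (psi x (u x) * mg i + g x 0 i * mp + 2 * dotp bp (bg i))) 0 i).
  by rewrite !vrowkE; have [h _ _ _] := mgP i; exact: Mjet_M pJ h.
have bX i : enorm (psi x (u x) *: bg i + g x 0 i *: bp) <= Xb.
  have [_ h _ _] := mgP i; rewrite -/N -BgE in h.
  by rewrite XbE (le_trans (enormD _ _)) // !enormZ lerD // ler_pM ?enorm_ge0.
have dB i : `|dotp bp (bg i)| <= Bp * Bg.
  have [_ h _ _] := mgP i; rewrite -/N -BgE in h.
  by apply: (le_trans (dotp_le_enorm _ _)); rewrite ler_pM ?enorm_ge0.
have mX i : `|psi x (u x) * mg i + g x 0 i * mp + 2 * dotp bp (bg i)| <= Xm.
  have [_ _ _ h] := mgP i; rewrite -/N -BgE -CmE in h.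
  rewrite XmE (le_trans (ler_normD _ _)) // lerD //; last by rewrite normrM normr_nat ler_wpM2l.
  by rewrite (le_trans (ler_normD _ _)) // lerD // normrM ler_pM.
have NX (b : 'rV[R]_n) c : 0 <= c -> c <= Xm + Xb + L2 * Cg -> (forall i, `|b 0 i| <= c) -> enorm b <= Cb.
  move=> c0 cX H; apply: (le_trans (enorm_le_norm _)).
  have h : `|b| <= c by apply: norm_le_coord.
  have h1 : N * `|b| <= N * (Xm + Xb + L2 * Cg) by rewrite ler_wpM2l // (le_trans h).
  by rewrite CbE; apply: (le_trans h1); rewrite lerDl.
have gC : enorm (\row_i (psi x (u x) * g x 0 i)) <= Cb.
  apply: (NX _ (L2 * Cg)) => // [|i]; first by rewrite lerDr addr_ge0.
  by rewrite vrowkE normrM ler_pM.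
have mC : enorm (\row_i (psi x (u x) * mg i + g x 0 i * mp + 2 * dotp bp (bg i))) <= Cb.
  by apply: (NX _ Xm) => // [|i]; [rewrite -addrA lerDl addr_ge0|rewrite vrowkE].
have bC : \sum_i dotp (psi x (u x) *: bg i + g x 0 i *: bp) (psi x (u x) *: bg i + g x 0 i *: bp) <= Cb ^+ 2.
  apply: (@le_trans _ _ (N * Xb ^+ 2)).
    rewrite mulr_natl -[X in _ *+ X](card_ord n) -sumr_const; apply: ler_sum => i _.
    by rewrite -enorm_sqr lerXn2r ?nnegrE ?enorm_ge0.
  have NN : N <= N ^+ 2.
    rewrite /N -natrX ler_nat; case: (n) => // k; by rewrite expnS expn1 leq_pmulr.
  apply: (@le_trans _ _ (N ^+ 2 * Xb ^+ 2)); first by rewrite ler_wpM2r ?sqr_ge0.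
  rewrite -exprMn lerXn2r ?nnegrE ?mulr_ge0 //; first exact: le_trans ler01 Cb1.
  rewrite CbE; apply: (@le_trans _ _ (N * (Xm + Xb + L2 * Cg))); last by rewrite lerDl.
  by rewrite ler_wpM2l // addrAC lerDr addr_ge0.
have [q2 [b1 [M1 [J1 M1L]]]] := bernstein oO uC ueq Ox phid GJ (erefl _) fz0 fxL Cb1 (ltW L10) gC bC mC vC.
have wJ := Mjet_B (u_Mjet oO uC ueq Ox) (Mjet_M pJ sJ).
rewrite -/p -/v in wJ.
have eJ := Mjet_comp (h := fun s => expR (K * s) - 1) (J2_expR_scaled K (u x - psi x (u x) * sigma x)) wJ.
have aJ := Mjet_D (Mjet_D J1 (Mjet_Z alpha sJ)) (Mjet_Z (T / e0) eJ).
have [|_] := Mjet_max aJ.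
  move: amax; apply: filterS => y; rewrite /aux /corrected_slope2 /=.
  by apply.
set w := v^-1 *: p - _; set mw := f x (u x) / v - _; set e := expR _ => H.
(* From p . w >= v / 2 and |p| < v, Cauchy-Schwarz gives |w| >= 1/2. *)
have wb : 4^-1 <= dotp w w.
  have pw : v / 2 <= dotp p w.
    rewrite /w dotpBr dotpDr !dotpZr [v^-1 * _]mulrC.
    apply: (@slope_real _ v (dotp p p) (psi x (u x) * dotp p bs) (dotp p bp) (sigma x * dotp p bp) N Bg L2 (sigma x)) => //.
    - exact: dotp_slope.
    - by rewrite normrM ler_pM.
    - exact: ltW.
  have pw0 : 0 <= v / 2 by rewrite divr_ge0 // ltW.
  have h1 : (v / 2) ^+ 2 <= v ^+ 2 * dotp w w.
    apply: (@le_trans _ _ (dotp p w ^+ 2)); first by rewrite lerXn2r ?nnegrE // (le_trans pw0).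
    by apply: (le_trans (dotp_CS _ _)); rewrite ler_wpM2r ?dotp_ge0 // dotp_slope -/v gerBl ler01.
  have vv : 0 < v ^+ 2 by rewrite exprn_gt0.
  rewrite -(ler_pM2l vv); apply: le_trans h1; rewrite le_eqVlt; apply/orP; left; apply/eqP; by field.
have mwB : - Cw <= mw.
  have h1 : `|f x (u x) / v| <= L1.
    rewrite normrM normfV (gtr0_norm v0) ler_pdivrMr //.
    by apply: (le_trans fL); rewrite ler_peMr // ltW.
  have h2 : `|psi x (u x) * ms| <= L2 * Cm by rewrite normrM ler_pM.
  have h3 : `|sigma x * mp| <= Cp by rewrite normrM -[leRHS]mul1r ler_pM.
  have h4 : `|dotp bp bs| <= Bp * Bg.
    by apply: (le_trans (dotp_le_enorm _ _)); rewrite ler_pM ?enorm_ge0.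
  rewrite /mw CwE; move: h1 h2 h3 h4; rewrite !ler_norml.
  move=> /andP[h1 _] /andP[_ h2] /andP[_ h3] /andP[_ h4]; clear -h1 h2 h3 h4; lra.
have ee : e0 <= e.
  rewrite e0E /e ler_expR.
  have h : `|u x - psi x (u x) * sigma x| <= M0 + L2.
    rewrite (le_trans (ler_normB _ _)) // lerD ?uM // normrM -[leRHS]mulr1 ler_pM //.
  rewrite -mulrN ler_pM2l //; move: h; rewrite ler_norml => /andP[h _]; exact: h.
have LamE : T / e0 * e0 = T by rewrite divfK // gt_eqF.
have msL : - Cm <= ms by move: msB; rewrite ler_norml => /andP[].
have Lam0 : 0 <= T / e0 by rewrite divr_ge0 // ltW.
exact: (step_real e00 ee a0 Lam0 LamE TE KE Cw0 wb mwB M1L msL H).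
Qed.

(** * Maxima on the boundary *)

Section BoundaryJets.
Context {R : realType} {m : nat}.
Implicit Types (A : set 'rV[R]_m) (f : 'rV[R]_m -> R) (x e : 'rV[R]_m).

Lemma Ckc_ext k A f s : Ckc k A f -> (size s <= k)%N -> exists h : 'rV[R]_m -> R,
  [/\ {within closure A, continuous h}, {in A, h =1 partials s f} &
      forall y, closure A y -> ext A (partials s f) y = h y].
Proof.
move=> [_ _ H] sk; have [h [h1 h2]] := H s sk; exists h; split=> // y Ay.
exact: ext_closure.
Qed.

Lemma ext_continuous k A f s : Ckc k A f -> (size s <= k)%N ->
  {within closure A, continuous (ext A (partials s f))}.
Proof.
move=> C sk; have [h [h1 h2 h3]] := Ckc_ext C sk.
move/subspace_continuousP: h1 => h1; apply/subspace_continuousP => y Ay.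
have L : h @ within (closure A) (nbhs y) --> h y := h1 y Ay.
suff : ext A (partials s f) @ within (closure A) (nbhs y) --> ext A (partials s f) y by [].
rewrite [X in _ --> X](h3 y Ay); apply: cvg_trans L; apply: near_eq_cvg.
by rewrite near_withinE; apply: filterE => z Az; rewrite h3.
Qed.

Lemma ext_cvg k A f s x : Ckc k A f -> (size s <= k)%N -> closure A x ->
  partials s f @ within A (nbhs x) --> ext A (partials s f) x.
Proof.
move=> C sk Ax; have [h [h1 h2 h3]] := Ckc_ext C sk.
move/subspace_continuousP: h1 => h1; rewrite (h3 x Ax).
have L : h @ within A (nbhs x) --> h x.
  have L' : h @ within (closure A) (nbhs x) --> h x := h1 x Ax.
  apply: cvg_trans L'; apply: cvg_app => U H.
  have {}H : \forall y \near x, closure A y -> U y := H.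
  suff : \forall y \near x, A y -> U y by [].
  by apply: filterS H => y hy Ay; apply: hy; exact: subset_closure.
apply: cvg_trans L; apply: near_eq_cvg.
by rewrite near_withinE; apply: filterE => z Az; rewrite h2 // inE.
Qed.

(** Continuous extensions of the derivatives alone do not give expansions at a boundary point; the
    cone condition does, by [cone_jet1]. *)
Lemma Ckc_cone_jet k A f s x e : open A -> Ckc k A f -> (size s < k)%N -> closure A x -> cone A x e ->
  jet1 (closure A) (ext A (partials s f)) x (\row_i ext A (partials (i :: s) f) x).
Proof.
move=> oA C sk Ax Ce; have [CA _ _] := C.
apply: (@cone_jet1 _ _ A _ (fun z => \row_i partials (i :: s) f z) x e) => //.
- move=> z Az; apply: jet1_ext_near (Ck_jet1 CA oA Az sk).
  have := open_nbhs_nbhs (conj oA Az); apply: filterS => y Ay.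
  by rewrite ext_in //; case: CA => _; apply => //; exact: ltnW.
- exact: ext_continuous C (ltnW sk).
apply/(@cvgrPdist_le _ _ _ (within A (nbhs x))) => eps eps0.
have : \forall y \near within A (nbhs x), forall i,
    `|ext A (partials (i :: s) f) x - partials (i :: s) f y| <= eps.
  apply: (@near_ord _ (within A (nbhs x)) _ m (fun i y => `|_ - partials (i :: s) f y| <= eps)) => i.
  by have /cvgrPdist_le/(_ _ eps0) := @ext_cvg k A f (i :: s) x C sk Ax.
apply: filterS => y H; apply: norm_le_coord => [|i]; first exact: ltW.
by rewrite vsubE !vrowkE.
Qed.

Lemma Ckc_jet k A f x e : open A -> Ckc k A f -> (0 < k)%N -> closure A x -> cone A x e ->
  jet1 (closure A) f x (\row_i ext A (partials [:: i] f) x).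
Proof.
move=> oA C k0 Ax Ce; have := Ckc_cone_jet (s := [::]) oA C k0 Ax Ce.
have [_ cf _] := C; apply: jet1_ext; last exact: ext_closure.
by rewrite near_withinE; apply: filterE => y Ay; exact: ext_closure.
Qed.

Lemma ext_sym A f i j x : open A -> Ckc 2 A f -> closure A x ->
  ext A (partials [:: i; j] f) x = ext A (partials [:: j; i] f) x.
Proof.
move=> oA C Ax; have [h [h1 h2 h3]] := Ckc_ext C (isT : (size [:: i; j] <= 2)%N).
transitivity (h x); first exact: h3.
symmetry; apply: (ext_closure Ax h1) => y yA.
have [CA _ _] := C; have Ay : A y by move: yA; rewrite inE.
rewrite (h2 y yA); exact: (@Ck_sym R m 2 A f [::] y i j CA oA Ay isT).
Qed.

End BoundaryJets.

(** As Q >= v^2 / 2, the quotient D / Q is at least -2 C1, and [alpha] exceeds 2 C1. *)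
Lemma boundary_real {R : realFieldType} (Q v D C1 alpha : R) : 0 < v -> v ^+ 2 / 2 <= Q -> 0 <= C1 ->
  `|D| <= C1 * v ^+ 2 -> alpha = 2 * C1 + 1 -> 0 < Q^-1 * D + alpha.
Proof.
move=> v0 vQ C10 DC ->.
have vv : 0 < v ^+ 2 by rewrite exprn_gt0.
have Q0 : 0 < Q by lra.
have h : - (2 * C1) <= Q^-1 * D.
  rewrite [Q^-1 * D]mulrC ler_pdivlMr //.
  have h1 : C1 * (v ^+ 2 / 2) <= C1 * Q by rewrite ler_wpM2l.
  move: DC; rewrite ler_norml => /andP[DC _]; lra.
lra.
Qed.

Section BoundaryStep.
Context {R : realType} {n : nat}.
Implicit Types (O V : set 'rV[R]_n) (u sigma rho : 'rV[R]_n -> R) (g : 'rV[R]_n -> 'rV[R]_n) (x nu : 'rV[R]_n).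

(** The tangential part of the gradient vanishes at the maximum, so its length is the absolute value
    of its normal component. *)
Lemma boundary_max_slope O V rho w x G nu (L2 c : R) : open O -> local_defining 1 O V rho ->
  V x -> boundary O x -> grad rho x = c *: nu -> dotp nu nu = 1 ->
  jet1 (closure O) w x G -> (forall y, closure O y -> w y <= w x) ->
  `|dotp G nu| <= L2 -> slope G <= 1 + L2.
Proof.
move=> oO LD Vx Bx gE nn wj wM GL.
have wn : \forall y \near x, boundary O y -> w y <= w x.
  by apply: filterE => y /boundary_closure; exact: wM.
have := tangential_eq (v := G - dotp G nu *: nu) oO LD Vx Bx wj wn.
rewrite gE dotpZl !dotpBr !dotpZr nn mulr1 (dotpC nu) subrr mulr0 => /(_ erefl) GG.
have L20 : 0 <= L2 := le_trans (normr_ge0 _) GL.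
have s0 := slope_gt0 G.
have d2 : dotp G nu * dotp G nu <= L2 ^+ 2.
  by rewrite -expr2 -real_normK ?num_real // lerXn2r.
rewrite -(@ler_pXn2r _ 2) ?nnegrE ?(ltW s0) ?addr_ge0 // slope_sqr /slope2; nra.
Qed.

(** The boundary counterpart of [grad_neq0_bound]: at an extremal value the gradient is normal and
    hence bounded by the boundary data, which a large slope excludes. The strict bounds are what
    [cyl_cone] requires for expanding psi. *)
Lemma boundary_value_lt O V rho u x nu (M0 L2 c : R) : open O -> local_defining 1 O V rho ->
  V x -> boundary O x -> grad rho x = c *: nu -> dotp nu nu = 1 ->
  jet1 (closure O) u x (gradc O u x) -> (forall y, closure O y -> `|u y| <= M0) ->
  `|dotp (gradc O u x) nu| <= L2 -> 1 + L2 < slope (gradc O u x) -> - M0 < u x < M0.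
Proof.
move=> oO LD Vx Bx gE nn uj uM pL vV.
have Ox := boundary_closure Bx.
have uB y : closure O y -> - M0 <= u y <= M0 by move=> /uM; rewrite ler_norml.
have /andP[lo hi] := uB x Ox.
rewrite !lt_neqAle lo hi !andbT; apply/andP; split; apply/negP => /eqP uE.
  have N1 : dotp (-1 *: gradc O u x) nu = - dotp (gradc O u x) nu by rewrite dotpZl mulN1r.
  have := boundary_max_slope oO LD Vx Bx gE nn (jet1_Z (-1) uj) _ (L2 := L2).
  rewrite N1 normrN => /(_ _ pL); rewrite /slope /slope2 dotpZl dotpZr !mulN1r opprK leNgt.
  move=> H; move: vV; rewrite /slope /slope2; apply/negP; apply: H => y /uB/andP[h _].
  by rewrite !mulN1r lerN2 -uE.
have H := boundary_max_slope oO LD Vx Bx gE nn uj _ pL.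
suff : slope (gradc O u x) <= 1 + L2 by rewrite leNgt vV.
by apply: H => y /uB/andP[_]; rewrite -uE.
Qed.

(** [alpha] and [V] precede [K] and [Lam], which are arbitrary. All expansions are taken within the
    closure; differentiating the auxiliary function once in the normal direction involves no more
    than the second derivatives of [u], available there. *)
Lemma boundary_step (M0 L2 Cg : R) : 0 < M0 -> 0 < L2 -> 0 <= Cg ->
  exists2 alpha : R, 0 <= alpha & exists V : R, forall K Lam O V' rho psi u g sigma x nu (c : R),
  open O -> psi_conditions O M0 L2 psi -> Ckc 2 O u -> (forall y, closure O y -> `|u y| <= M0) ->
  local_defining 1 O V' rho -> V' x -> boundary O x -> 0 < c -> grad rho x = c *: nu -> dotp nu nu = 1 ->
  (forall i, nice Cg (fun y => g y 0 i) x) -> g x = nu -> sigma x = 0 -> jet1 setT sigma x nu ->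
  (forall y, boundary O y -> dotp (gradc O u y) (g y) = psi y (u y)) ->
  V <= slope (gradc O u x) ->
  (\forall y \near x, O y -> aux u psi (gradc O u) g sigma alpha K Lam y <=
     aux u psi (gradc O u) g sigma alpha K Lam x) -> False.
Proof.
move=> M00 L20 Cg0; pose N : R := n%:R; have N0 : 0 <= N by [].
have [C1 C1E] : {B : R | B = N * (N * Cg) + (N * L2 + L2) + L2 * (N * (N * Cg)) + L2 * (N * L2 + L2)} by eexists.
have [a1 a1E] : {B : R | B = N * (N * Cg)} by eexists.
have [a2 a2E] : {B : R | B = N * L2 + L2} by eexists.
have a10 : 0 <= a1 by rewrite a1E !mulr_ge0.
have a20 : 0 <= a2 by rewrite a2E addr_ge0 ?mulr_ge0 // ltW.
have La1 : 0 <= L2 * a1 by rewrite mulr_ge0 // ltW.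
have La2 : 0 <= L2 * a2 by rewrite mulr_ge0 // ltW.
have C10 : 0 <= C1 by rewrite C1E -a1E -a2E; lra.
exists (2 * C1 + 1); first lra.
exists (2 + 2 * L2) => K Lam O V' rho psi u g sigma x nu c oO pc uC uM LD Vx Bx c0 gE nn gn gx sx sj bc vV amax.
have Ox := boundary_closure Bx.
have Ce : cone O x nu by apply: (defining_cone oO LD Vx); rewrite gE dotpZl nn mulr1.
have uj : jet1 (closure O) u x (gradc O u x) by exact: (Ckc_jet oO uC (isT : (0 < 2)%N) Ox Ce).
set p := gradc O u x in uj vV; set v := slope p in vV.
have v0 : 0 < v := slope_gt0 p.
have v1 : 1 <= v := slope_ge1 p.
have uMx : - M0 <= u x <= M0 by rewrite -ler_norml; exact: uM.
have pn : dotp p nu = psi x (u x) by rewrite -gx; exact: bc.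
have psL : `|psi x (u x)| <= L2 by exact: psi_bound oO M00 pc Ox uMx.
set ps := psi x (u x) in pn psL.
have uMlt : - M0 < u x < M0.
  apply: (@boundary_value_lt _ _ _ _ _ _ M0 L2 c oO LD Vx Bx gE nn uj uM).
    by rewrite -/p pn.
  by rewrite -/p -/v; lra.
have [G GL psj] : exists2 G : 'rV[R]_(n + 1), `|G| <= L2 &
    jet1 (closure O) (fun y => psi y (u y)) x (lsubmx G + rsubmx G 0 0 *: p).
  have [pC pN] := pc; have [_ pcont _] := pC.
  have Cy := closure_cyl_pt M00 Ox uMx.
  have oC : open (cyl O M0) := cyl_open oO.
  have := Ckc_jet oC pC (isT : (0 < 3)%N) Cy (cyl_cone Ce uMlt).
  set G := \row_i _ => Pj; exists G.
    apply: norm_le_coord => [|i]; first exact: ltW.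
    by rewrite vrowkE; apply: Ck_norm_ext pN _ _ Cy; rewrite ?addn1.
  apply: (jet1_ext (f := fun y => joint psi (pt y (u y)))); last apply: joint_jet1 Pj uj _.
  - by rewrite near_withinE; apply: filterE => y _; rewrite joint_pt.
  - by rewrite joint_pt.
  by rewrite near_withinE; apply: filterE => y Oy; apply: closure_cyl_pt => //; rewrite -ler_norml; exact: uM.
set Gp := lsubmx G + _ in psj.
have GpB z : `|dotp Gp z| <= (N * L2 + L2 * v) * enorm z.
  rewrite /Gp dotpDl dotpZl (le_trans (ler_normD _ _)) // mulrDl lerD //.
    apply: (le_trans (dotp_le_norm _ _)); apply: ler_pM; rewrite ?mulr_ge0 ?norm_le_enorm //.
    by rewrite ler_wpM2l // (le_trans (lsubmx_norm _)).
  rewrite normrM -mulrA ler_pM //; first by rewrite (le_trans (rsubmx_norm _)).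
  by apply: (le_trans (dotp_le_enorm _ _)); rewrite ler_wpM2r ?enorm_ge0 // enorm_slope.
pose U : 'M[R]_n := \matrix_(i, j) ext O (partials [:: j; i] u) x.
have Usym i j : U i j = U j i by rewrite !mxE; exact: ext_sym.
have Uj i : jet1 (closure O) (fun y => gradc O u y 0 i) x (row i U).
  have := Ckc_cone_jet (s := [:: i]) oO uC (isT : (1 < 2)%N) Ox Ce.
  have -> : ext O (partials [:: i] u) = (fun y => gradc O u y 0 i).
    by apply/funext => y; rewrite vrowkE.
  by apply: jet1_eq; apply/rowP => j; rewrite !mxE.
have /choice[d dP] i := gn i.
have dj i : jet1 (closure O) (fun y => g y 0 i) x (d i).
  by apply: jet1T; have [] := dP i.
have dB i z : `|dotp (d i) z| <= N * Cg * enorm z.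
  have [_ _ h _] := dP i.
  apply: (le_trans (dotp_le_norm _ _)); rewrite ler_pM ?mulr_ge0 ?norm_le_enorm //.
  by rewrite ler_wpM2l.
have pc1 i : `|p 0 i| <= v by apply: (le_trans (coord_le_enorm _ _)); exact: enorm_slope.
have SB z : `|\sum_i p 0 i * dotp (d i) z| <= a1 * v * enorm z.
  apply: (le_trans (ler_norm_sum _ _ _)).
  have -> : a1 * v * enorm z = N * (v * (N * Cg * enorm z)) by rewrite a1E; ring.
  rewrite mulr_natl -[X in _ *+ X](card_ord n) -sumr_const.
  by apply: ler_sum => i _; rewrite normrM ler_pM.
pose y i := dotp (row i U) nu.
(* The tangential part of the gradient. *)
pose p' := p - ps *: nu.
have p'nu : dotp nu p' = 0 by rewrite dotpBr dotpZr nn (dotpC nu) pn mulr1 subrr.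
have pp' : enorm p' <= v.
  rewrite -(@ler_pXn2r _ 2) ?nnegrE ?enorm_ge0 ?(ltW v0) // enorm_sqr /p'.
  rewrite dotpBl !dotpBr !dotpZl !dotpZr nn (dotpC nu) pn dotp_slope -/v; nra.
pose X := \sum_i p' 0 i * y i.
have XE : X = \sum_i nu 0 i * dotp (row i U) p'.
  rewrite /X /y /dotp; under eq_bigr do rewrite big_distrr /=.
  under [RHS]eq_bigr do rewrite big_distrr /=.
  rewrite exchange_big; apply: eq_bigr => i _; apply: eq_bigr => j _ /=.
  by rewrite !vrowE Usym; ring.
(* The function Du . g - psi(., u) vanishes on the boundary, so its derivative along [p'] is zero.
   This expresses the mixed second derivative [X] through first-order quantities of size at most
   v^2. *)
have tang : \sum_i p 0 i * dotp (d i) p' + X - dotp Gp p' = 0.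
  have Fj := jet1_B (jet1_sum (fun i => jet1_M (Uj i) (dj i))) psj.
  have Fm : \forall y \near x, boundary O y ->
      \sum_i gradc O u y 0 i * g y 0 i - psi y (u y) <= \sum_i gradc O u x 0 i * g x 0 i - psi x (u x).
    apply: filterE => z Bz.
    by rewrite -!/(dotp _ _) (bc z Bz) (bc x Bx) !subrr.
  have := tangential_eq (v := p') oO LD Vx Bx Fj Fm.
  have E : \sum_i dotp (gradc O u x 0 i *: d i + g x 0 i *: row i U) p' = \sum_i p 0 i * dotp (d i) p' + X.
    rewrite XE -big_split; apply: eq_bigr => i _ /=.
    by rewrite dotpDl !dotpZl -/p gx.
  by rewrite gE dotpZl p'nu mulr0 => /(_ erefl); rewrite dotpBl dotp_suml E.
pose Q := slope2 p - 2 * \sum_i p 0 i * (ps * nu 0 i).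
have QE : Q = v ^+ 2 - 2 * ps ^+ 2.
  rewrite /Q -slope_sqr -/v; congr (_ - 2 * _).
  transitivity (ps * dotp p nu); last by rewrite pn expr2.
  by rewrite /dotp big_distrr; apply: eq_bigr => i _ /=; ring.
have ps2 : ps ^+ 2 <= L2 ^+ 2 by rewrite -real_normK ?num_real // lerXn2r ?nnegrE // ltW.
have Qv : v ^+ 2 / 2 <= Q by rewrite QE; clear -ps2 vV L20 v0; nra.
have Q0 : 0 < Q by apply: lt_le_trans Qv; rewrite divr_gt0 // exprn_gt0.
have s2j : jet1 (closure O) (fun z => slope2 (gradc O u z)) x (0 + \sum_i (p 0 i *: row i U + p 0 i *: row i U)).
  apply: (jet1_D (jet1_cst _ 1 x)); apply: (jet1_sum (f := fun i z => gradc O u z 0 i * gradc O u z 0 i)) => i.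
  exact: jet1_M.
have Gj : jet1 (closure O) (fun z => \sum_i gradc O u z 0 i * (psi z (u z) * g z 0 i)) x
   (\sum_i (p 0 i *: (ps *: d i + nu 0 i *: Gp) + (ps * nu 0 i) *: row i U)).
  apply: (jet1_sum (f := fun i z => gradc O u z 0 i * (psi z (u z) * g z 0 i))) => i.
  have := jet1_M (Uj i) (jet1_M psj (dj i)); apply: jet1_eq.
  by rewrite gx -/ps -/p.
have Qj := jet1_B s2j (jet1_Z 2 Gj).
set GQ := 0 + _ - _ in Qj.
have Qx : corrected_slope2 u psi (gradc O u) g x = Q by rewrite /corrected_slope2 gx.
have lnj : jet1 (closure O) (fun z => ln (corrected_slope2 u psi (gradc O u) g z)) x (Q^-1 *: GQ).
  by apply: (jet1_comp (h := @ln R)) Qj; rewrite -/(corrected_slope2 u psi (gradc O u) g x) Qx; exact: J2_J1 (J2_ln Q0).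
have ej := jet1_comp (h := fun s => expR (K * s) - 1)
  (J2_J1 (J2_expR_scaled K (u x - psi x (u x) * sigma x))) (jet1_B uj (jet1_M psj (jet1T (closure O) sj))).
have aj := jet1_D (jet1_D (jet1_Z 2^-1 lnj) (jet1_Z (2 * C1 + 1) (jet1T (closure O) sj))) (jet1_Z Lam ej).
(* The inward derivative at a maximum is nonpositive; the rest of the proof shows that it is
   positive. *)
have := cone_max_le0 Ox Ce aj.
have -> : (\forall y \near x, O y ->
    2^-1 * ln (corrected_slope2 u psi (gradc O u) g y) + (2 * C1 + 1) * sigma y
      + Lam * (expR (K * (u y - psi y (u y) * sigma y)) - 1) <=
    2^-1 * ln (corrected_slope2 u psi (gradc O u) g x) + (2 * C1 + 1) * sigma x
      + Lam * (expR (K * (u x - psi x (u x) * sigma x)) - 1)) = True.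
  apply/propext; split=> // _; move: amax; apply: filterS => z H Oz.
  by rewrite ![2^-1 * _]mulrC; exact: H.
move=> /(_ I); rewrite !dotpDl !dotpZl nn.
(* The normal derivative of u - psi sigma is psi - psi = 0, since sigma vanishes and has normal
   derivative 1. With it [K] and [Lam] disappear. *)
have -> : dotp (p - (psi x (u x) *: nu + sigma x *: Gp)) nu = 0.
  by rewrite dotpBl dotpDl !dotpZl nn pn sx mul0r addr0 mulr1 subrr.
rewrite !mulr0 addr0 mulr1.
pose D := X - ps * \sum_i p 0 i * dotp (d i) nu - ps * dotp Gp nu.
have -> : dotp GQ nu = 2 * D.
  have S1 : dotp (\sum_i (p 0 i *: row i U + p 0 i *: row i U)) nu = 2 * \sum_i p 0 i * y i.
    rewrite dotp_suml big_distrr; apply: eq_bigr => i _ /=.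
    by rewrite dotpDl dotpZl -/(y i); ring.
  have S2 : dotp (\sum_i (p 0 i *: (ps *: d i + nu 0 i *: Gp) + (ps * nu 0 i) *: row i U)) nu =
      ps * \sum_i p 0 i * dotp (d i) nu + ps * dotp Gp nu + ps * \sum_i nu 0 i * y i.
    transitivity (ps * \sum_i p 0 i * dotp (d i) nu + dotp Gp nu * (\sum_i p 0 i * nu 0 i) + ps * \sum_i nu 0 i * y i).
      rewrite dotp_suml !big_distrr -!big_split; apply: eq_bigr => i _ /=.
      by rewrite !(dotpDl, dotpZl) -/(y i); ring.
    by rewrite -/(dotp p nu) pn; ring.
  (* The second normal derivative enters only inside [X], with the coefficient that makes the first
     argument of D^2u tangential. *)
  have XD : X = \sum_i p 0 i * y i - ps * \sum_i nu 0 i * y i.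
    by rewrite big_distrr -sumrB; apply: eq_bigr => i _ /=; rewrite vsubE vsclE; ring.
  rewrite /GQ add0r dotpBl dotpZl S1 S2 /D XD; ring.
have en : enorm nu = 1 by rewrite /enorm nn sqrtr1.
have vv : v <= v ^+ 2 by rewrite expr2 ler_peMr // ltW.
have DB : `|D| <= C1 * v ^+ 2.
  have E1 := GpB p'; have E2 := SB p'; have E3 := GpB nu; have E4 := SB nu.
  rewrite en mulr1 in E3; rewrite en mulr1 in E4.
  have N1 : N * L2 <= N * L2 * v by rewrite ler_peMr // mulr_ge0 // ltW.
  have F0 : N * L2 + L2 * v <= a2 * v by rewrite a2E mulrDl lerD2r.
  have e0 := enorm_ge0 p'.
  have F1 : (N * L2 + L2 * v) * enorm p' <= a2 * v ^+ 2.
    rewrite expr2 mulrA; apply: ler_pM => //; apply: addr_ge0; apply: mulr_ge0 => //; exact: ltW.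
  have F2 : a1 * v * enorm p' <= a1 * v ^+ 2.
    by rewrite expr2 mulrA ler_wpM2l // mulr_ge0 // ltW.
  have F3 : a2 * v <= a2 * v ^+ 2 by rewrite ler_wpM2l.
  have F4 : a1 * v <= a1 * v ^+ 2 by rewrite ler_wpM2l.
  have T1 : `|ps * dotp Gp nu| <= L2 * (a2 * v ^+ 2).
    by rewrite normrM ler_pM // (le_trans E3) // (le_trans F0).
  have T2 : `|ps * \sum_i p 0 i * dotp (d i) nu| <= L2 * (a1 * v ^+ 2).
    by rewrite normrM ler_pM // (le_trans E4).
  have XT : D = dotp Gp p' - \sum_i p 0 i * dotp (d i) p'
       - ps * \sum_i p 0 i * dotp (d i) nu - ps * dotp Gp nu.
    by rewrite /D; congr (_ - _ - _); clear -tang; lra.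
  have C1v : C1 * v ^+ 2 = a2 * v ^+ 2 + a1 * v ^+ 2 + L2 * (a1 * v ^+ 2) + L2 * (a2 * v ^+ 2).
    by rewrite C1E -a1E -a2E; ring.
  rewrite XT C1v (le_trans (ler_normB _ _)) // lerD // (le_trans (ler_normB _ _)) // lerD //.
  by rewrite (le_trans (ler_normB _ _)) // lerD // ?(le_trans E1) // (le_trans E2).
have := @boundary_real _ Q v D C1 _ v0 Qv C10 DB erefl.
have -> : 2^-1 * (Q^-1 * (2 * D)) = Q^-1 * D by field; rewrite gt_eqF.
by move=> h1 h2; clear -h1 h2; lra.
Qed.

End BoundaryStep.

(** * The gradient bound *)

Section Final.
Context {R : realType} {n : nat}.
Implicit Types (O K : set 'rV[R]_n) (x y : 'rV[R]_n).

Lemma bdist_gt0 O x : open O -> boundary O !=set0 -> O x -> 0 < bdist O x.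
Proof.
move=> oO B0 Ox; have [e e0 H] := open_normP oO Ox.
apply: (lt_le_trans e0); apply: le_bdist => // y [_ nOy].
apply: le_trans (norm_le_enorm _); rewrite leNgt distrC; apply/negP => /H Oy.
by apply: nOy; rewrite /interior; exact: open_nbhs_nbhs.
Qed.

Lemma dist_compactly_inside O O' : (0 < n)%N -> open O -> bounded_set O -> O' !=set0 ->
  compactly_inside O' O -> 0 < dist O' (boundary O).
Proof.
move=> n0 oO bO O'0 [cO' sO]; have [z0 Oz0] := O'0.
have O0 : O !=set0 by exists z0; apply: sO; exact: subset_closure.
have B0 := boundary_nonempty n0 oO O0 bO.
have O'1 : closure O' !=set0 by exists z0; exact: subset_closure.
have [|z] := @EVT_max_rV R n (fun y => - bdist O y) (closure O') O'1 cO'.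
  apply/subspace_continuousP => y _; apply: cvg_within_filter; apply: cvgN.
  exact: bdist_continuous.
rewrite inE => Oz H; apply: (lt_le_trans (bdist_gt0 oO B0 (sO z Oz))).
apply: le_dist => // x y O'x By; apply: le_trans (bdist_le x By).
by rewrite -lerN2; apply: H; rewrite inE; exact: subset_closure.
Qed.

Lemma within_closed_ge K (f : 'rV[R]_n -> R) (c : R) : closed K ->
  (forall x, K x -> f @ within K (nbhs x) --> f x) -> closed [set x | K x /\ c <= f x].
Proof.
move=> cK cf x Cx; have Kx : K x.
  by apply: cK; apply: closure_subset Cx => y [].
split=> //; rewrite leNgt; apply/negP => fc.
have : \forall y \near within K (nbhs x), f y < c by have /cvgr_lt := cf x Kx; apply.
rewrite near_withinE => N; have [y [[Ky cy]]] := Cx _ N.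
by move=> /(_ Ky); rewrite ltNge cy.
Qed.

Lemma closure_collar O (mu : R) x : boundary O !=set0 -> closure (collar O mu) x ->
  closure O x /\ bdist O x <= mu.
Proof.
move=> B0 Cx; split; first by apply: closure_subset Cx => y [].
rewrite leNgt; apply/negP => xmu.
have N : \forall y \near x, mu < bdist O y.
  by have /cvgr_gt := @bdist_continuous _ _ O x B0; apply.
by have [y [[_ +]]] := Cx _ N; move=> /ltW; rewrite leNgt => /negP.
Qed.

Lemma ubd_family (D : set 'rV[R]_n) (g : 'I_n -> 'rV[R]_n -> R) (f : 'rV[R]_n -> R) :
  (forall i, ubd D (g i)) -> ubd D f ->
  exists2 C : R, 0 <= C & forall x, D x -> (forall i, nice C (g i) x) /\ nice C f x.
Proof.
move=> ug [Cf Cf0 Hf].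
have /choice[c cP] i : exists c : R, 0 <= c /\ forall x, D x -> nice c (g i) x.
  by have [c c0 H] := ug i; exists c.
have s0 : 0 <= \sum_i c i by rewrite sumr_ge0 // => i _; have [] := cP i.
exists (Cf + \sum_i c i); first by rewrite addr_ge0.
move=> x Dx; split=> [i|]; last by apply: nice_le (Hf x Dx); rewrite lerDl.
have [_ H] := cP i; apply: nice_le (H x Dx).
rewrite (bigD1 i) //= addrCA lerDl addr_ge0 // sumr_ge0 // => j _.
by have [] := cP j.
Qed.

Section Continuity.
Variables (O : set 'rV[R]_n) (y : 'rV[R]_n).
Let F := within (closure O) (nbhs y).

Lemma pt_cvg (u : 'rV[R]_n -> R) : u @ F --> u y ->
  (fun z => pt z (u z)) @ F --> pt y (u y).
Proof.
move=> cu; apply/(@cvgrPdist_le _ _ _ F) => e e0.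
have h1 : \forall z \near F, `|u y - u z| <= e by have /cvgrPdist_le := cu; apply.
have h2 : \forall z \near F, `|z - y| <= e by exact: within_norm_le.
apply: filterS2 h1 h2 => z zu zy.
by rewrite ptB (le_trans (pt_norm _ _)) // ge_max distrC zy.
Qed.

Lemma psi_cvg (psi : 'rV[R]_n -> R -> R) (M0 : R) u : 0 < M0 ->
  {within closure (cyl O M0), continuous (joint psi)} ->
  closure O y -> (forall z, closure O z -> `|u z| <= M0) -> u @ F --> u y ->
  (fun z => psi z (u z)) @ F --> psi y (u y).
Proof.
move=> M00 /subspace_continuousP pc Oy uM cu.
have inc z : closure O z -> closure (cyl O M0) (pt z (u z)).
  by move=> Oz; apply: closure_cyl_pt => //; rewrite -ler_norml; exact: uM.
have L : joint psi @ within (closure (cyl O M0)) (nbhs (pt y (u y))) --> joint psi (pt y (u y)).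
  exact: pc (inc y Oy).
rewrite -joint_pt in L *.
have -> : (fun z => psi z (u z)) = joint psi \o (fun z => pt z (u z)).
  by apply/funext => z; rewrite /= joint_pt.
apply: (cvg_comp _ _ _ L) => U HU.
have {}HU : \forall p \near pt y (u y), closure (cyl O M0) p -> U p := HU.
have := pt_cvg cu HU; rewrite /= => H.
suff : \forall z \near F, U (pt z (u z)) by [].
have Fz : \forall z \near F, closure O z by exact: withinT.
have {}H : \forall z \near F, closure (cyl O M0) (pt z (u z)) -> U (pt z (u z)) by exact: H.
by apply: filterS2 H Fz => z Hz Oz; apply: Hz; exact: inc.
Qed.

Lemma sum_cvg (f : 'I_n -> 'rV[R]_n -> R) : (forall i, f i @ F --> f i y) ->
  (fun z => \sum_i f i z) @ F --> \sum_i f i y.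
Proof.
move=> cf; elim: (index_enum _) => [|i s ih].
  under eq_fun do rewrite big_nil; rewrite big_nil; exact: cvg_cst.
under eq_fun do rewrite big_cons; rewrite big_cons; exact: cvgD.
Qed.

End Continuity.
End Final.

(** The correction is linear in the slope, so for large slope it changes q by at most one half of
    it. In particular the logarithm in [aux] is then meaningful. *)
Lemma corrected_slope2_bound {R : realType} (n : nat) (u : 'rV[R]_n -> R) psi (P g : 'rV[R]_n -> 'rV[R]_n) (y : 'rV[R]_n) (L2 Cg : R) :
  `|psi y (u y)| <= L2 -> (forall i, `|g y 0 i| <= Cg) -> 4 * (n%:R * (L2 * Cg)) <= slope (P y) ->
  slope2 (P y) / 2 <= corrected_slope2 u psi P g y <= 3 / 2 * slope2 (P y).
Proof.
move=> psL gC vV; have v0 := slope_gt0 (P y).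
have B : `|\sum_i P y 0 i * (psi y (u y) * g y 0 i)| <= n%:R * (slope (P y) * (L2 * Cg)).
  rewrite (le_trans (ler_norm_sum _ _ _)) // mulr_natl -[X in _ *+ X](card_ord n) -sumr_const.
  apply: ler_sum => i _; rewrite !normrM; apply: ler_pM; rewrite ?mulr_ge0 //.
    by apply: (le_trans (coord_le_enorm _ _)); exact: enorm_slope.
  exact: ler_pM.
have H : 4 * (n%:R * (L2 * Cg)) * slope (P y) <= slope (P y) * slope (P y) by rewrite ler_pM2r.
rewrite /corrected_slope2 -slope_sqr; move: B; rewrite ler_norml => /andP[B1 B2].
by apply/andP; split; rewrite expr2; lra.
Qed.

Lemma sqr_le_slope2 {R : realType} (n : nat) (p : 'rV[R]_n) (c : R) : 0 <= c ->
  (c ^+ 2 <= slope2 p) = (c <= slope p).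
Proof. by move=> c0; rewrite -slope_sqr ler_pXn2r // nnegrE ltW // slope_gt0. Qed.

Lemma sqr_lt_slope2 {R : realType} (n : nat) (p : 'rV[R]_n) (c : R) : 0 <= c ->
  (c ^+ 2 < slope2 p) = (c < slope p).
Proof. by move=> c0; rewrite -slope_sqr ltr_pXn2r // nnegrE ltW // slope_gt0. Qed.

Lemma slope2_le_sqr {R : realType} (n : nat) (p : 'rV[R]_n) (c : R) : 0 <= c ->
  (slope2 p <= c ^+ 2) = (slope p <= c).
Proof. by move=> c0; rewrite leNgt sqr_lt_slope2 // -leNgt. Qed.

Lemma slope_le_slope2 {R : realType} (n : nat) (p : 'rV[R]_n) : slope p <= slope2 p.
Proof. by rewrite -slope_sqr expr2 ler_peMr ?slope_ge1 // ltW // slope_gt0. Qed.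

Lemma slope_le_enorm {R : realType} (n : nat) (p : 'rV[R]_n) (c : R) : enorm p <= c -> slope p <= 1 + c.
Proof.
move=> pc; have e0 := enorm_ge0 p.
rewrite -slope2_le_sqr; last lra.
by rewrite /slope2 -enorm_sqr; nra.
Qed.

Lemma lower_terms_bound {R : realType} (alpha K Lam s w W : R) : 0 <= alpha -> `|s| <= 1 -> `|w| <= W ->
  `|alpha * s + Lam * (expR (K * w) - 1)| <= alpha + `|Lam| * (expR (`|K| * W) + 1).
Proof.
move=> a0 s1 wW; rewrite (le_trans (ler_normD _ _)) // !normrM (ger0_norm a0) lerD //.
  by rewrite ler_piMr.
rewrite ler_wpM2l // (le_trans (ler_normB _ _)) // normr1 lerD2r ger0_norm ?expR_ge0 // ler_expR.
by rewrite (le_trans (ler_norm _)) // normrM ler_wpM2l.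
Qed.

(** Apart from the logarithm the auxiliary function is bounded by [Eb]. Comparing it at two points
    gives ln q' <= ln q + 4 Eb, hence s <= 2 q' <= 3 exp(4 Eb) V^2. *)
Lemma slope_of_max {R : realType} (V Eb q q' f f' s2 s2' s : R) : 0 < q -> 0 < q' -> f' <= f ->
  `|f - ln q / 2| <= Eb -> `|f' - ln q' / 2| <= Eb -> q <= 3 / 2 * s2 -> s2 <= V ^+ 2 ->
  s2' / 2 <= q' -> s <= s2' -> 0 <= V -> s <= V + 3 * expR (4 * Eb) * V ^+ 2.
Proof.
move=> q0 q'0 ff; rewrite !ler_norml => /andP[? ?] /andP[? ?] qs sV sq ss V0.
have h4 : ln q' <= ln q + 4 * Eb by lra.
have e0 : 0 < expR (4 * Eb) by exact: expR_gt0.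
have h5 : q' <= q * expR (4 * Eb).
  by rewrite -ler_ln ?posrE ?mulr_gt0 // lnM ?posrE // expRK.
have h6 : q * expR (4 * Eb) <= 3 / 2 * V ^+ 2 * expR (4 * Eb).
  by rewrite ler_pM2r //; lra.
lra.
Qed.

Section BoundaryEstimate.
Context {R : realType} {n : nat}.
Variables (O : set 'rV[R]_n) (u : 'rV[R]_n -> R) (psi : 'rV[R]_n -> R -> R) (M0 : R).
Hypotheses (M00 : 0 < M0) (uC : Ckc 2 O u) (uM : forall x, closure O x -> `|u x| <= M0).
Hypothesis pcont : {within closure (cyl O M0), continuous (joint psi)}.

Let P := gradc O u.

Lemma gradc_in x : O x -> P x = grad u x.
Proof.
move=> Ox; apply/rowP => i; rewrite !vrowkE; apply: ext_in => //.
by have [[_ c] _ _] := uC; exact: (c [:: i]).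
Qed.

Section At.
Variable y : 'rV[R]_n.
Hypothesis Oy : closure O y.
Let F := within (closure O) (nbhs y).

Lemma gradc_cvg i : (fun z => P z 0 i) @ F --> P y 0 i.
Proof.
have /subspace_continuousP/(_ y Oy) L := ext_continuous (s := [:: i]) uC isT.
have -> : (fun z => P z 0 i) = ext O (partials [:: i] u) by apply/funext => z; rewrite vrowkE.
by rewrite /P vrowkE; exact: L.
Qed.

Lemma slope2_gradc_cvg : (fun z => slope2 (P z)) @ F --> slope2 (P y).
Proof.
apply: cvgD; first exact: cvg_cst.
apply: (@sum_cvg _ _ _ _ (fun i z => P z 0 i * P z 0 i)) => i.
by apply: cvgM; exact: gradc_cvg.
Qed.

Lemma aux_cvg (g : 'rV[R]_n -> 'rV[R]_n) (sigma : 'rV[R]_n -> R) (alpha K Lam : R) : (forall i, {for y, continuous (fun z => g z 0 i)}) ->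
  {for y, continuous sigma} -> 0 < corrected_slope2 u psi P g y ->
  aux u psi P g sigma alpha K Lam @ F --> aux u psi P g sigma alpha K Lam y.
Proof.
move=> cg cs Q0.
have cu : u @ F --> u y.
  by have [_ /subspace_continuousP/(_ y Oy) L _] := uC; exact: L.
have cpsi := psi_cvg M00 pcont Oy uM cu.
have cg' i : (fun z => g z 0 i) @ F --> g y 0 i by apply: cvg_within_filter; exact: cg.
have cs' : sigma @ F --> sigma y by apply: cvg_within_filter; exact: cs.
have cQ : corrected_slope2 u psi P g @ F --> corrected_slope2 u psi P g y.
  apply: cvgB; first exact: slope2_gradc_cvg.
  apply: cvgM; first exact: cvg_cst.
  apply: (@sum_cvg _ _ _ _ (fun i z => P z 0 i * (psi z (u z) * g z 0 i))) => i.
  by apply: cvgM; [exact: gradc_cvg|apply: cvgM].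
apply: cvgD; first apply: cvgD.
- apply: cvgM; last exact: cvg_cst.
  apply: (cvg_comp _ _ cQ); exact: (J1_continuous (J2_J1 (J2_ln Q0))).
- by apply: cvgM => //; exact: cvg_cst.
apply: cvgM; first exact: cvg_cst.
apply: cvgB; last exact: cvg_cst.
have cw : (fun z => K * (u z - psi z (u z) * sigma z)) @ F --> K * (u y - psi y (u y) * sigma y).
  by apply: cvgM; [exact: cvg_cst|apply: cvgB => //; exact: cvgM].
by apply: (cvg_comp _ _ cw); exact: continuous_expR.
Qed.

End At.
End BoundaryEstimate.

(** If the slope exceeds [V3] at a maximum point of the auxiliary function over the closed collar,
    that point is at distance at least mu from the boundary, or inside the collar, or on the
    boundary. These are excluded by the interior estimate, [interior_step] and [boundary_step]
    respectively. *)
Lemma boundary_estimate {R : realType} (n : nat) (O : set 'rV[R]_n) (M0 L1 L2 : R) :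
  (0 < n)%N -> open O -> O !=set0 -> bounded_set O -> Ck_boundary 3 O ->
  0 < M0 -> 0 < L1 -> 0 < L2 -> exists mu M : R, [/\ 0 < mu, 0 < M &
  forall f psi (u : 'rV[R]_n -> R) (gamma : 'rV[R]_n -> 'rV[R]_n), (forall x, boundary O x -> inward_unit_normal O x (gamma x)) ->
  f_conditions O M0 L1 f -> psi_conditions O M0 L2 psi -> Ckc 2 O u -> Ck 3 O u ->
  (forall x, closure O x -> `|u x| <= M0) -> (forall x, O x -> mean_curvature_op u x = f x (u x)) ->
  (forall x, boundary O x -> dotp (gradc O u x) (gamma x) = psi x (u x)) ->
  forall x, closure O x -> bdist O x <= mu -> slope (gradc O u x) <= M].
Proof.
move=> n0 oO O0 bO CO M00 L10 L20.
have B0 := boundary_nonempty n0 oO O0 bO.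
have eps0 : 0 < Num.min 1 (4 * L2)^-1 :> R by rewrite lt_min ltr01 invr_gt0 mulr_gt0.
have [mu [g [sigma [mu0 ug us sB gam]]]] := collar_functions n0 oO O0 bO CO eps0.
set D := [set x | _] in ug us sB.
have [Cg Cg0 nC] := ubd_family ug us.
(* The boundary fixes [alpha]; only then are [K] and [Lam] chosen for the interior, and the boundary
   step holds for these as for any others. *)
have [alpha a0 [Vb Hb]] := @boundary_step R n M0 L2 Cg M00 L20 Cg0.
have [K [Lam [Vi Hi]]] := @interior_step R n M0 L1 L2 Cg alpha M00 L10 L20 Cg0 a0.
have [Ve Ve0 He] := @interior_estimate R n mu M0 L1 mu0 M00 L10.
have [Eb EbE] : {B : R | B = alpha + `|Lam| * (expR (`|K| * (M0 + L2)) + 1)} by eexists.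
have [V0 [V0b V0i V02 V04]] : exists V0 : R, [/\ Vb <= V0, Vi <= V0, 2 <= V0 & 4 * (n%:R * (L2 * Cg)) <= V0].
  exists (Num.max (Num.max Vb Vi) (Num.max 2 (4 * (n%:R * (L2 * Cg))))).
  by split; rewrite !le_max lexx ?orbT.
have [V3 [V30 V3e]] : exists V3 : R, V0 <= V3 /\ 1 + Ve <= V3.
  by exists (Num.max V0 (1 + Ve)); rewrite !le_max !lexx orbT.
have V3p : 0 < V3 by lra.
(* The second summand comes from [slope_of_max]. The first ensures that a point violating the bound
   has slope above [V0], so that it belongs to the set over which the maximum is taken. *)
exists mu, (V3 + 3 * expR (4 * Eb) * V3 ^+ 2).
have Bp : 0 <= 3 * expR (4 * Eb) * V3 ^+ 2 by rewrite mulr_ge0 ?sqr_ge0 // mulr_ge0 // expR_ge0.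
split=> //; first by rewrite ltr_pwDl.
move=> f psi u gamma gaN fc pc uC uC3 uM ueq bc x0 Ox0 x0mu.
rewrite leNgt; apply/negP => x0V.
pose P := gradc O u.
have pcont : {within closure (cyl O M0), continuous (joint psi)} by have [[]] := pc.
have cO : closed (closure O) by exact: closed_closure.
(* The maximum is restricted to slopes of at least [V0], because only there is the argument of the
   logarithm known to be positive. *)
pose D' := [set y | (closure O y /\ V0 ^+ 2 <= slope2 (P y)) /\ bdist O y <= mu].
have slopeV y : V0 ^+ 2 <= slope2 (P y) <-> V0 <= slope (P y).
  by rewrite sqr_le_slope2 // (le_trans _ V02).
have D'D y : D' y -> D y by move=> [[]].
have gC y i : D y -> `|g y 0 i| <= Cg by move=> /nC[/(_ i)[? []]].
have s1 y : D y -> `|sigma y| <= 1 by move=> /sB; rewrite le_min => /andP[].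
have sL y : D y -> `|sigma y| * L2 <= 4^-1.
  move=> /sB; rewrite le_min => /andP[_ h].
  have : `|sigma y| * L2 <= (4 * L2)^-1 * L2 by rewrite ler_pM2r.
  by rewrite invfM mulfVK // gt_eqF.
have uM' y : closure O y -> - M0 <= u y <= M0 by move=> /uM; rewrite ler_norml.
have psL y : closure O y -> `|psi y (u y)| <= L2.
  by move=> Oy; exact: psi_bound oO M00 pc Oy (uM' y Oy).
have Qb y : D' y -> slope2 (P y) / 2 <= corrected_slope2 u psi P g y <= 3 / 2 * slope2 (P y).
  move=> Dy; have [[Oy /slopeV Vy] _] := Dy.
  by apply: corrected_slope2_bound (psL y Oy) (fun i => gC y i (D'D y Dy)) (le_trans V04 Vy).
have Q0 y : D' y -> 0 < corrected_slope2 u psi P g y.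
  by move=> Dy; have /andP[h _] := Qb y Dy; apply: lt_le_trans h; rewrite divr_gt0 // slope2_gt0.
pose Phi := aux u psi P g sigma alpha K Lam.
have rest y : D' y -> `|Phi y - ln (corrected_slope2 u psi P g y) / 2| <= Eb.
  move=> Dy; have [[Oy _] _] := Dy; have Dy' := D'D y Dy.
  have E (a b c : R) : a + b + c - a = b + c by ring.
  rewrite /Phi /aux E EbE.
  apply: lower_terms_bound => //; first exact: s1.
  rewrite (le_trans (ler_normB _ _)) // lerD ?uM // normrM -[leRHS]mulr1.
  by apply: ler_pM => //; [exact: psL|exact: s1].
have Dx0 : D' x0.
  split=> //; split=> //; apply/slopeV; apply: (le_trans V30); apply: ltW.
  by apply: le_lt_trans x0V; rewrite lerDl.
have cD' : compact D'.
  apply: (subclosed_compact _ (compact_closure bO)) => [|y [[]]//].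
  apply: closedI; first by apply: within_closed_ge cO _ => y Oy; exact: slope2_gradc_cvg uC _ Oy.
  apply: (@closed_comp _ _ (bdist O) [set t | t <= mu]); last exact: closed_le.
  by move=> y _; exact: bdist_continuous.
have Phic : {within D', continuous Phi}.
  apply/subspace_continuousP => y Dy; have [[Oy _] _] := Dy; have Dy' := D'D y Dy.
  have cg i : {for y, continuous (fun z => g z 0 i)}.
    by have [/(_ i)[G [Gj _ _ _]] _] := nC y Dy'; exact: jet1_continuous Gj.
  have cs : {for y, continuous sigma}.
    by have [_ [G [Gj _ _ _]]] := nC y Dy'; exact: jet1_continuous Gj.
  have L := aux_cvg M00 uC uM pcont Oy (alpha := alpha) (K := K) (Lam := Lam) cg cs (Q0 y Dy).
  apply: cvg_trans L; apply: cvg_app => U H.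
  have {}H : \forall z \near y, closure O z -> U z := H.
  suff : \forall z \near y, D' z -> U z by [].
  by apply: filterS H => z hz [[Oz _] _]; exact: hz.
have [x] := @EVT_max_rV R n Phi D' (ex_intro _ x0 Dx0) cD' Phic.
rewrite inE => Dx Phim.
have {}Phim y : D' y -> Phi y <= Phi x by move=> Dy; apply: Phim; rewrite inE.
(* A bound on the slope at the maximum point carries over to [x0] through the values of [Phi]. *)
suff vx : slope (P x) <= V3.
  have /andP[q1 _] := Qb x0 Dx0; have /andP[_ q2] := Qb x Dx.
  have s2 : slope2 (P x) <= V3 ^+ 2 by rewrite slope2_le_sqr // ltW.
  have := slope_of_max (Q0 x Dx) (Q0 x0 Dx0) (Phim x0 Dx0) (rest x Dx) (rest x0 Dx0) q2 s2 q1
    (slope_le_slope2 _) (ltW V3p).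
  by rewrite leNgt x0V.
rewrite leNgt; apply/negP => xV.
have [[Ox /slopeV Vx] xmu] := Dx; have Dx' := D'D x Dx.
(* The slope at [x] is strictly above [V0], so by continuity the restriction is inactive nearby: [x]
   is a local maximum among all points of the closure when its distance to the boundary is below
   mu. *)
have nearD' : bdist O x < mu -> \forall y \near x, closure O y -> D' y.
  move=> xm.
  have N1 : \forall y \near x, bdist O y < mu.
    by have /cvgr_lt := @bdist_continuous _ _ O x B0; apply.
  have V2 : V0 ^+ 2 < slope2 (P x).
    by rewrite sqr_lt_slope2 ?(le_lt_trans V30) // (le_trans _ V02).
  have : \forall y \near within (closure O) (nbhs x), V0 ^+ 2 < slope2 (P y).
    by have /cvgr_gt := slope2_gradc_cvg uC Ox; apply.
  rewrite near_withinE => N2; apply: filterS2 N1 N2 => y h1 h2 Oy.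
  exact: (conj (conj Oy (ltW (h2 Oy))) (ltW h1)).
have [gn sn] := nC x Dx'.
have [Ox'|Bx] := closure_open oO Ox.
  have Px : P x = grad u x := gradc_in uC Ox'.
  have [xm|xm] := ltP (bdist O x) mu; last first.
    have := He O f u x oO fc uC3 (fun y Oy => uM y (subset_closure Oy)) ueq.
    have bx : forall y, enorm (y - x) < mu -> O y.
      by move=> y yx; apply: (bdist_ball oO Ox'); exact: lt_le_trans xm.
    move=> /(_ bx); rewrite -Px => eV.
    by have := le_lt_trans (le_trans (slope_le_enorm eV) V3e) xV; rewrite ltxx.
  apply: (Hi O f psi u g sigma x oO fc pc uC3 (fun y Oy => uM y (subset_closure Oy)) ueq Ox' gn sn (s1 x Dx') (sL x Dx')).
    by rewrite -Px; exact: le_trans V0i Vx.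
  have auxE y : O y -> aux u psi (grad u) g sigma alpha K Lam y = Phi y.
    by move=> Oy; rewrite /Phi /aux /corrected_slope2 /P (gradc_in uC Oy).
  have N := open_nbhs_nbhs (conj oO Ox'); apply: filterS2 (nearD' xm) N => y h Oy.
  rewrite (auxE y Oy) (auxE x Ox'); apply: Phim; apply: h; exact: subset_closure.
have xm : bdist O x < mu.
  by apply: (le_lt_trans (bdist_le x Bx)); rewrite subrr enorm0.
have [V' [rho [V'x LD3]]] := CO x Bx.
have LD := local_defining_le (isT : (1 <= 3)%N) LD3.
have [_ _ rg0 _ _] := LD.
have Nx := gaN x Bx.
have [gx sx sj] := gam x _ Bx Nx.
have bc' y : boundary O y -> dotp (gradc O u y) (g y) = psi y (u y).
  by move=> By; have [-> _ _] := gam y _ By (gaN y By); exact: bc.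
have amax : \forall y \near x, O y -> Phi y <= Phi x.
  by have := nearD' xm; apply: filterS => y h Oy; apply: Phim; apply: h; exact: subset_closure.
exact: (Hb K Lam O V' rho psi u g sigma x (gamma x) (enorm (grad rho x)) oO pc uC uM LD V'x Bx
  (enorm_gt0 (rg0 x V'x)) (inward_unit_normal_eq oO Bx LD V'x Nx) (inward_unit_normal_norm Nx)
  gn gx sx sj bc' (le_trans V0b Vx) amax).
Qed.

(** The constants are gathered into one function of the data by choice. For data outside the
    admissible range any positive value does, so that positivity holds without conditions. *)
Lemma interior_constant {R : realType} : exists M1 : nat -> R -> R -> R -> R,
  (forall n del M0 L1, 0 < M1 n del M0 L1) /\
  forall n del M0 L1, 0 < del -> 0 < M0 -> 0 < L1 ->
  forall (O : set 'rV[R]_n) (f : 'rV[R]_n -> R -> R) (u : 'rV[R]_n -> R) x0,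
    open O -> f_conditions O M0 L1 f -> Ck 3 O u -> (forall x, O x -> `|u x| <= M0) ->
    (forall x, O x -> mean_curvature_op u x = f x (u x)) ->
    (forall y, enorm (y - x0) < del -> O y) -> enorm (grad u x0) <= M1 n del M0 L1.
Proof.
have H (a : nat * R * R * R) : exists V : R, 0 < V /\
  let: (n, del, M0, L1) := a in 0 < del -> 0 < M0 -> 0 < L1 ->
  forall (O : set 'rV[R]_n) (f : 'rV[R]_n -> R -> R) (u : 'rV[R]_n -> R) x0,
    open O -> f_conditions O M0 L1 f -> Ck 3 O u -> (forall x, O x -> `|u x| <= M0) ->
    (forall x, O x -> mean_curvature_op u x = f x (u x)) ->
    (forall y, enorm (y - x0) < del -> O y) -> enorm (grad u x0) <= V.
  case: a => -[[n del] M0] L1.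
  have [[del0 M00 L10]|h] := pselect [/\ 0 < del, 0 < M0 & 0 < L1].
    by have [V V0 HV] := interior_estimate n del0 M00 L10; exists V.
  by exists 1; split=> // del0 M00 L10; case: h.
have [M1 M1P] := choice H.
exists (fun n del M0 L1 => M1 (n, del, M0, L1)); split=> n del M0 L1.
  by have [] := M1P (n, del, M0, L1).
by have [_] := M1P (n, del, M0, L1).
Qed.

Theorem theorem1p1 (R : realType) :
  exists M1 : nat -> R -> R -> R -> R,
    (forall n mu M0 L1, 0 < M1 n mu M0 L1) /\
    interior_gradient_bound M1 /\
    forall (n : nat) (Omega : set 'rV[R]_n) (gamma : 'rV[R]_n -> 'rV[R]_n)
      (M0 L1 L2 : R),
    (2 <= n)%N ->
    domain Omega -> bounded_set Omega -> Ck_boundary 3 Omega ->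
    (forall x, boundary Omega x -> inward_unit_normal Omega x (gamma x)) ->
    0 < M0 -> 0 < L1 -> 0 < L2 ->
    exists mu0 M2 : R, 0 < mu0 /\ 0 < M2 /\
      forall (f psi : 'rV[R]_n -> R -> R) (u : 'rV[R]_n -> R),
      f_conditions Omega M0 L1 f ->
      psi_conditions Omega M0 L2 psi ->
      Ckc 2 Omega u -> Ck 3 Omega u ->
      (forall x, closure Omega x -> `|u x| <= M0) ->
      (forall x, Omega x -> mean_curvature_op u x = f x (u x)) ->
      (forall x, boundary Omega x ->
         dotp (gradc Omega u x) (gamma x) = psi x (u x)) ->
      (ereal_sup [set (enorm (gradc Omega u x))%:E
                   | x in closure (collar Omega mu0)]
         <= (Num.max (M1 n mu0 M0 L1) M2)%:E)%E.
Proof.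
have [M1 [M10 M1P]] := @interior_constant R; exists M1; split=> //; split.
  move=> n O W M0 L1 f u n2 [neO oO _] bO M00 L10 fc uC uM ueq [W0 _ _] cW.
  have n0 : (0 < n)%N by exact: leq_trans n2.
  have B0 := boundary_nonempty n0 oO neO bO.
  apply: ge_ereal_sup => _ [x Wx <-]; rewrite lee_fin.
  apply: (M1P n _ M0 L1 (dist_compactly_inside n0 oO bO W0 cW) M00 L10 O f u x oO fc uC uM ueq).
  have Ox : O x by have [_] := cW; apply; exact: subset_closure.
  move=> y yx; apply: (bdist_ball oO Ox); apply: (lt_le_trans yx).
  by apply: le_bdist => // z Bz; exact: dist_le.
move=> n O gamma M0 L1 L2 n2 [neO oO _] bO CO gaN M00 L10 L20.
have n0 : (0 < n)%N by exact: leq_trans n2.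
have B0 := boundary_nonempty n0 oO neO bO.
have [mu [M [mu0 Mp H]]] := boundary_estimate n0 oO neO bO CO M00 L10 L20.
exists mu, M; split=> //; split=> // f psi u fc pc uC uC3 uM ueq bc.
apply: ge_ereal_sup => _ [x /(closure_collar B0)[Ox xmu] <-]; rewrite lee_fin le_max; apply/orP; right.
apply: (le_trans (enorm_slope _)).
exact: (H f psi u gamma gaN fc pc uC uC3 uM ueq bc x Ox xmu).
Qed.
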